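(* Let $n\ge1$ and let $B$ be a weakly localized operator on $H^2(\mathbb{C}^n,d\mu)$. Then $B$ is compact if and only if its Berezin transform vanishes at infinity, i.e. if and only if $\langle Bk_z,k_z\rangle\to 0$ as $|z|\to\infty$.
   Context: $dV$ is the standard volume (Lebesgue) measure on $\mathbb{C}^n$ and $d\mu(z)=\pi^{-n}e^{-|z|^2}dV(z)$. $H^2(\mathbb{C}^n,d\mu)$ is the Hilbert space of entire functions in $L^2(\mathbb{C}^n,d\mu)$, with inner product $\langle f,g\rangle=\int f\overline{g}\,d\mu$. On $\mathbb{C}^n$, $\langle \zeta,z\rangle=\sum_j\zeta_j\overline{z_j}$. The normalized reproducing kernel is $k_z(\zeta)=e^{\langle\zeta,z\rangle}e^{-|z|^2/2}$. The Berezin transform of a bounded operator $A$ is the function $z\mapsto\langle Ak_z,k_z\rangle$ on $\mathbb{C}^n$. Let $\mathcal{S}$ be the linear span of $\{k_z:z\in\mathbb{C}^n\}$. A linear operator $B:\mathcal{S}\to H^2(\mathbb{C}^n,d\mu)$ is admissible if there is a linear operator $B^*:\mathcal{S}\to H^2(\mathbb{C}^n,d\mu)$ with $\langle Bk_z,k_w\rangle=\langle k_z,B^*k_w\rangle$ for all $z,w\in\mathbb{C}^n$. An admissible operator $B$ is weakly localized if $$\sup_{z}\int_{\mathbb{C}^n}|\langle Bk_z,k_w\rangle|\,dV(w)<\infty,\qquad \sup_{z}\int_{\mathbb{C}^n}|\langle B^*k_z,k_w\rangle|\,dV(w)<\infty,$$ $$\lim_{r\to\infty}\sup_{z}\int_{|z-w|\ge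 r}|\langle Bk_z,k_w\rangle|\,dV(w)=0,\qquad \lim_{r\to\infty}\sup_{z}\int_{|z-w|\ge r}|\langle B^*k_z,k_w\rangle|\,dV(w)=0,$$ suprema over $z\in\mathbb{C}^n$. A weakly localized operator is identified with its (unique) bounded extension to $H^2(\mathbb{C}^n,d\mu)$. *)

(* Defs.v *)
From HB Require Import structures.
From mathcomp Require Import all_boot all_order all_algebra.
From mathcomp Require Import complex.
From mathcomp Require Import all_classical all_reals all_analysis.
From mathcomp Require Import measurable_realfun ring.

Set Implicit Arguments.
Unset Strict Implicit.
Unset Printing Implicit Defensive.
Import Order.TTheory GRing.Theory Num.Theory.
Import numFieldNormedType.Exports.
Local Open Scope classical_set_scope.
Local Open Scope ring_scope.
Local Open Scope complex_scope.

(* C^n is 'rV[R[i]]_n, with the complex normed-module structure of the        *)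
(* library; its sigma-algebra is the product one, generated by the real and   *)
(* imaginary parts of the coordinates (for n = 0 it is {set0, setT}).         *)
Fact Cn_display : measure_display. Proof. exact: default_measure_display. Qed.

HB.instance Definition _ (R : realType) := isPointed.Build R[i] 0.

Section Cn_measurable.
Variables (R : realType) (n : nat).

Definition ccoord (i : 'I_n) (z : 'rV[R[i]]_n) :
    measurableTypeR R * measurableTypeR R :=
  (complex.Re (z 0 i), complex.Im (z 0 i)).

Lemma Cn_measurable0 : g_sigma_preimage ccoord set0.
Proof. exact: sigma_algebra0. Qed.

Lemma Cn_measurableC (A : set 'rV[R[i]]_n) :
  g_sigma_preimage ccoord A -> g_sigma_preimage ccoord (~` A).
Proof. by move=> mA; rewrite -setTD; exact: sigma_algebraCD. Qed.

Lemma Cn_measurable_bigcup (F : (set 'rV[R[i]]_n)^nat) :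
  (forall i, g_sigma_preimage ccoord (F i)) ->
  g_sigma_preimage ccoord (\bigcup_i (F i)).
Proof. exact: sigma_algebra_bigcup. Qed.

HB.instance Definition _ := @isMeasurable.Build Cn_display 'rV[R[i]]_n
  (g_sigma_preimage ccoord) Cn_measurable0 Cn_measurableC Cn_measurable_bigcup.

Lemma measurable_ccoord i : measurable_fun setT (@ccoord i).
Proof.
move=> _ Y mY; rewrite setTI; apply: sub_sigma_algebra.
rewrite -bigcup_seq/=; exists i => /=; first by rewrite mem_index_enum.
by exists Y => //; rewrite setTI.
Qed.

Lemma measurable_fun_Cn d (T : measurableType d) (f : T -> 'rV[R[i]]_n) :
  (forall i, measurable_fun setT (@ccoord i \o f)) -> measurable_fun setT f.
Proof.
move=> mf _ A mA; rewrite setTI.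
suff: g_sigma_preimage ccoord `<=` image_set_system setT f measurable.
  by move=> /(_ _ mA); rewrite /image_set_system/= setTI.
apply: smallest_sub.
  by apply: sigma_algebra_image; exact: sigma_algebra_measurable.
rewrite -bigcup_seq/=; apply: bigcup_sub => i _ _ [B mB <-].
rewrite /image_set_system/= !setTI -comp_preimage -[_ @^-1` _]setTI.
exact: mf.
Qed.

End Cn_measurable.

Section ccons.
Variables (R : realType) (n : nat).
Local Notation C2 := (measurableTypeR R * measurableTypeR R)%type.

Definition ccons (x : C2 * 'rV[R[i]]_n) : 'rV[R[i]]_n.+1 :=
  \row_(i < n.+1)
    if unlift ord0 i is Some j then x.2 0 j else x.1.1 +i* x.1.2.

Definition cuncons (z : 'rV[R[i]]_n.+1) : C2 * 'rV[R[i]]_n :=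
  (ccoord ord0 z, \row_(j < n) z 0 (lift ord0 j)).

Lemma cconsK : cancel ccons cuncons.
Proof.
move=> [[a b] v]; rewrite /cuncons /ccoord !mxE unlift_none/=.
by congr pair; apply/rowP => j; rewrite !mxE liftK.
Qed.

Lemma cunconsK : cancel cuncons ccons.
Proof.
move=> z; apply/rowP => i; rewrite !mxE/=.
by case: unliftP => [j ->|->]; rewrite ?mxE//; case: (z 0 ord0).
Qed.

Lemma measurable_ccons : measurable_fun setT ccons.
Proof.
apply: measurable_fun_Cn => i; case: (unliftP ord0 i) => [j ->|->].
  rewrite (_ : _ \o _ = @ccoord R n j \o snd); last first.
    by apply/funext => x; rewrite /= /ccoord !mxE liftK.
  by apply: measurableT_comp => //; exact: measurable_ccoord.
rewrite (_ : _ \o _ = fst)//.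
by apply/funext => -[[a b] v]; rewrite /= /ccoord !mxE unlift_none.
Qed.

Lemma measurable_cuncons : measurable_fun setT cuncons.
Proof.
apply/measurable_fun_pairP; split; first exact: measurable_ccoord.
apply: measurable_fun_Cn => j.
rewrite (_ : _ \o _ = @ccoord R n.+1 (lift ord0 j)).
  exact: measurable_ccoord.
by apply/funext => z; rewrite /= /ccoord !mxE.
Qed.

End ccons.

Lemma product_measure1_sigma_finite d1 d2 (T1 : measurableType d1)
    (T2 : measurableType d2) (R : realType)
    (m1 : {sigma_finite_measure set T1 -> \bar R})
    (m2 : {sigma_finite_measure set T2 -> \bar R}) :
  sigma_finite setT (m1 \x m2)%E.
Proof.
have /sigma_finiteP[F [TF ndF Foo]] := sigma_finiteT m1.
have /sigma_finiteP[G [TG ndG Goo]] := sigma_finiteT m2.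
exists (fun k => F k `*` G k).
  apply/seteqP; split=> [[x y] _|//].
  have [j _ Fjx] : (\bigcup_k F k) x by rewrite -TF.
  have [k _ Gky] : (\bigcup_k G k) y by rewrite -TG.
  exists (maxn j k) => //; split.
    by move: x Fjx; exact/subsetPset/ndF/leq_maxl.
  by move: y Gky; exact/subsetPset/ndG/leq_maxr.
move=> k; have [? ?] := Foo k; have [? ?] := Goo k.
split; first exact: measurableX.
by rewrite product_measure1E// lte_mul_pinfty// ge0_fin_numE.
Qed.

Section volume.
Variable R : realType.

Definition plane_measure :
    set (measurableTypeR R * measurableTypeR R) -> \bar R :=
  (@lebesgue_measure R \x @lebesgue_measure R)%E.

HB.instance Definition _ := Measure.on plane_measure.
HB.instance Definition _ := @Measure_isSigmaFinite.Build _ _ _ plane_measure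
  (product_measure1_sigma_finite (@lebesgue_measure R) (@lebesgue_measure R)).

Section step.
Variables (n : nat) (mu : {sigma_finite_measure set 'rV[R[i]]_n -> \bar R}).

Definition volumeS : set 'rV[R[i]]_n.+1 -> \bar R :=
  pushforward (plane_measure \x mu)%E (@ccons R n).

HB.instance Definition _ := Measure.copy volumeS
  (measure_function_pushforward__canonical__measure_function_Measure
    (plane_measure \x mu)%E (@measurable_ccons R n)).

Lemma volumeS_sigma_finite : sigma_finite setT volumeS.
Proof.
have [F UF mF] := product_measure1_sigma_finite plane_measure mu.
exists (fun k => @cuncons R n @^-1` F k).
  by rewrite -preimage_bigcup -UF preimage_setT.
move=> k; have [mFk Fkoo] := mF k; split.
  by rewrite -[_ @^-1` _]setTI; exact: measurable_cuncons.
rewrite /volumeS /pushforward -comp_preimage.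
rewrite (_ : _ \o _ = id) ?preimage_id//.
by apply/funext => x /=; rewrite cconsK.
Qed.

HB.instance Definition _ := @Measure_isSigmaFinite.Build _ _ _ volumeS
  volumeS_sigma_finite.

End step.

(* Lebesgue measure on C^n, from C^(m+1) = R^2 x C^m. *)
Fixpoint volume (n : nat) : {sigma_finite_measure set 'rV[R[i]]_n -> \bar R} :=
  if n is m.+1 then volumeS (volume m) else \d_(0 : 'rV[R[i]]_0).

End volume.

Section Fock.
Variables (R : realType) (n : nat).
Local Notation C := (R[i]^o).
Local Notation normc := ComplexField.Normc.normc.
Local Notation Cn := 'rV[R[i]]_n.

(* <zeta, z>; the norm of the library on 'rV[R[i]]_n is the sup norm. *)
Definition cdot (zeta z : Cn) : R[i] := \sum_j zeta 0 j * (z 0 j)^*.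

Definition sqcnorm (z : Cn) : R := \sum_j normc (z 0 j) ^+ 2.

Definition cnorm (z : Cn) : R := Num.sqrt (sqcnorm z).

Definition cexp (x : R[i]) : R[i] :=
  (expR (complex.Re x))%:C * (cos (complex.Im x) +i* sin (complex.Im x)).

Definition gaussian (z : Cn) : R := pi ^- n * expR (- sqcnorm z).

Definition Cintegral (f : Cn -> R[i]) : R[i] :=
  (\int[volume R n]_z complex.Re (f z))%R +i*
  (\int[volume R n]_z complex.Im (f z))%R.

(* The integral of f g^* against dmu. *)
Definition inner (f g : Cn -> C) : R[i] :=
  Cintegral (fun z => f z * (g z)^* * (gaussian z)%:C).

Definition sqintegrable (f : Cn -> C) : Prop :=
  [/\ measurable_fun setT (fun z => complex.Re (f z)),
      measurable_fun setT (fun z => complex.Im (f z)) &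
      (\int[volume R n]_z (normc (f z) ^+ 2 * gaussian z)%:E < +oo)%E].

(* Complex differentiability: the scalar field here is R[i]. *)
Definition entire (f : Cn -> C) : Prop := forall z, differentiable f z.

Definition fock : {pred (Cn -> C)} := fun f => `[< entire f /\ sqintegrable f >].

Lemma normc_sqr (x : R[i]) :
  normc x ^+ 2 = complex.Re x ^+ 2 + complex.Im x ^+ 2.
Proof. by case: x => a b /=; rewrite sqr_sqrtr// addr_ge0// sqr_ge0. Qed.

Lemma ler_normc_sqrD (x y : R[i]) :
  normc (x + y) ^+ 2 <= 2 * normc x ^+ 2 + 2 * normc y ^+ 2.
Proof.
rewrite !normc_sqr; case: x y => [a b] [c d] /=; rewrite -subr_ge0.
rewrite [leRHS](_ : _ = (a - c) ^+ 2 + (b - d) ^+ 2); last by ring.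
by rewrite addr_ge0// sqr_ge0.
Qed.

Lemma gaussian_ge0 z : 0 <= gaussian z.
Proof. by rewrite mulr_ge0 ?expR_ge0// invr_ge0 exprn_ge0// pi_ge0. Qed.

Lemma measurable_sqcnorm : measurable_fun setT sqcnorm.
Proof.
apply: measurable_sum => j; under eq_fun do rewrite normc_sqr.
by apply: measurable_funD; apply: measurable_funX;
  [apply: (measurableT_comp measurable_fst (@measurable_ccoord R n j))
  |apply: (measurableT_comp measurable_snd (@measurable_ccoord R n j))].
Qed.

Lemma measurable_gaussian : measurable_fun setT gaussian.
Proof.
apply: measurable_funM => //; apply: measurableT_comp => //.
by apply: measurableT_comp => //; exact: measurable_sqcnorm.
Qed.

Lemma fock_submod_closed : GRing.submod_closed fock.
Proof.
have [g0 mg] := (gaussian_ge0, measurable_gaussian).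
split=> [|a f g /asboolP[df [mRf mIf intf]] /asboolP[dg [mRg mIg intg]]].
  apply/asboolP; split; first by move=> z; exact: differentiable_cst.
  split; [exact: measurable_cst|exact: measurable_cst|].
  under eq_integral.
    move=> z _; rewrite (_ : normc _ = 0) ?expr0n ?mul0r; last first.
      exact: ComplexField.Normc.normc0.
    over.
  by rewrite integral0 ltry.
have mRafg : measurable_fun setT (fun z => complex.Re ((a *: f + g) z)).
  rewrite (_ : (fun _ => _) = fun z => complex.Re a * complex.Re (f z)
    - complex.Im a * complex.Im (f z) + complex.Re (g z)).
    apply: measurable_funD => //.
    by apply: measurable_funB; apply: measurable_funM.
  apply/funext => z; rewrite /= -[(a *: f + g) z]/(a * f z + g z).
  by case: (a) (f z) (g z) => [? ?] [? ?] [? ?].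
have mIafg : measurable_fun setT (fun z => complex.Im ((a *: f + g) z)).
  rewrite (_ : (fun _ => _) = fun z => complex.Re a * complex.Im (f z)
    + complex.Im a * complex.Re (f z) + complex.Im (g z)).
    apply: measurable_funD => //.
    by apply: measurable_funD; apply: measurable_funM.
  apply/funext => z; rewrite /= -[(a *: f + g) z]/(a * f z + g z).
  by case: (a) (f z) (g z) => [? ?] [? ?] [? ?].
have mint (h : Cn -> C) : measurable_fun setT (fun z => complex.Re (h z)) ->
    measurable_fun setT (fun z => complex.Im (h z)) ->
    measurable_fun setT (fun z : Cn => (normc (h z) ^+ 2 * gaussian z)%:E).
  move=> mR mI; apply/measurable_EFinP; apply: measurable_funM => //.
  under eq_fun do rewrite normc_sqr.
  by apply: measurable_funD; exact: measurable_funX.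
have ge0 (h : Cn -> C) z : (0 <= (normc (h z) ^+ 2 * gaussian z)%:E)%E.
  by rewrite lee_fin mulr_ge0// sqr_ge0.
apply/asboolP; split.
  move=> z; apply: differentiableD; last exact: dg.
  by apply: differentiableZ; exact: df.
split=> //.
apply: (@le_lt_trans _ _ (\int[volume R n]_z
  ((2 * normc a ^+ 2)%:E * (normc (f z) ^+ 2 * gaussian z)%:E
   + 2%:E * (normc (g z) ^+ 2 * gaussian z)%:E))%E).
  apply: ge0_le_integral => //; first exact: mint.
    by apply: emeasurable_funD; apply: measurable_funeM; exact: mint.
  move=> z _; rewrite -!EFinM -EFinD lee_fin.
  have := ler_wpM2r (gaussian_ge0 z) (ler_normc_sqrD (a * f z) (g z)).
  by rewrite ComplexField.Normc.normcM exprMn mulrDl -!mulrA.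
rewrite ge0_integralD//; first last.
- by apply: measurable_funeM; exact: mint.
- by move=> z _; rewrite mule_ge0.
- by apply: measurable_funeM; exact: mint.
- by move=> z _; rewrite mule_ge0// lee_fin mulr_ge0// sqr_ge0.
rewrite !ge0_integralZl//; first last.
- by rewrite lee_fin mulr_ge0// sqr_ge0.
- exact: mint.
- exact: mint.
by rewrite lte_add_pinfty// lte_mul_pinfty// lee_fin mulr_ge0// sqr_ge0.
Qed.

HB.instance Definition _ := GRing.isSubmodClosed.Build _ _ fock
  fock_submod_closed.

Record H2 := MkH2 { H2val :> Cn -> C ; _ : H2val \in fock }.

HB.instance Definition _ := [isSub for H2val].
HB.instance Definition _ := [Choice of H2 by <:].
HB.instance Definition _ := [SubChoice_isSubLmodule of H2 by <:].

(* The normalized reproducing kernel k_z, as a function on C^n. *)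
Definition nkernel (z : Cn) : Cn -> C :=
  fun zeta => cexp (cdot zeta z) * (expR (- (sqcnorm z / 2)))%:C.

Definition kernel_span : {pred (Cn -> C)} := fun f =>
  `[< exists s : seq (R[i] * Cn), f = \sum_(az <- s) az.1 *: nkernel az.2 >].

Lemma kernel_span_submod_closed : GRing.submod_closed kernel_span.
Proof.
split=> [|a _ _ /asboolP[s ->] /asboolP[t ->]].
  by apply/asboolP; exists [::]; rewrite big_nil.
apply/asboolP; exists ([seq (a * az.1, az.2) | az <- s] ++ t).
rewrite big_cat big_map scaler_sumr; congr (_ + _).
by apply: eq_bigr => az _; rewrite scalerA.
Qed.

HB.instance Definition _ := GRing.isSubmodClosed.Build _ _ kernel_span
  kernel_span_submod_closed.

Record kspan := MkKspan { kspan_val :> Cn -> C ; _ : kspan_val \in kernel_span }.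

HB.instance Definition _ := [isSub for kspan_val].
HB.instance Definition _ := [Choice of kspan by <:].
HB.instance Definition _ := [SubChoice_isSubLmodule of kspan by <:].

Lemma kernel_in_span z : nkernel z \in kernel_span.
Proof. by apply/asboolP; exists [:: (1, z)]; rewrite big_seq1 scale1r. Qed.

Definition k_ (z : Cn) : kspan := MkKspan (kernel_in_span z).

Definition normH2 (f : Cn -> C) : R := Num.sqrt (complex.Re (inner f f)).

Definition adjoint_on_span (B B' : {linear kspan -> H2}) : Prop :=
  forall z w, inner (B (k_ z)) (k_ w) = inner (k_ z) (B' (k_ w)).

(* sup_z of the integral of |<B k_z, k_w>| dV(w) over w with |z - w| >= r;    *)
(* for r <= 0 the integral is over all of C^n.                                *)
Definition tail_sup (B : {linear kspan -> H2}) (r : R) : \bar R :=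
  ereal_sup (range (fun z : Cn =>
    \int[volume R n]_(w in [set w | (r <= cnorm (z - w))%R])
      (normc (inner (B (k_ z)) (k_ w)))%:E)%E).

Definition localized (B : {linear kspan -> H2}) : Prop :=
  (ereal_sup (range (fun z : Cn =>
     \int[volume R n]_w (normc (inner (B (k_ z)) (k_ w)))%:E)) < +oo)%E /\
  tail_sup B r @[r --> +oo%R] --> (0 : \bar R)%E.

Definition weakly_localized (B : {linear kspan -> H2}) : Prop :=
  exists B' : {linear kspan -> H2},
    [/\ adjoint_on_span B B', localized B & localized B'].

Definition berezin (B : {linear kspan -> H2}) (z : Cn) : C :=
  inner (B (k_ z)) (k_ z).

Definition vanishes_at_infinity (f : Cn -> C) : Prop :=
  forall e : R, 0 < e ->
    exists M : R, forall z, M <= cnorm z -> normc (f z) < e.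

(* kspan and H2 are subtypes of the same type of functions, whence the        *)
(* comparison of s and f as functions.                                        *)
Definition bounded_extension (B : {linear kspan -> H2})
    (T : {linear H2 -> H2}) : Prop :=
  (exists M : R, forall f : H2, normH2 (T f) <= M * normH2 f) /\
  forall (s : kspan) (f : H2), f = s :> (Cn -> C) -> T f = B s.

Definition sequentially_compact (T : {linear H2 -> H2}) : Prop :=
  forall u : nat -> H2, (exists M : R, forall j, normH2 (u j) <= M) ->
    exists2 phi : nat -> nat, {homo phi : i j / (i < j)%N} &
      exists g : H2, normH2 (T (u (phi j)) - g) @[j --> \oo] --> (0 : R).

(* B stands for its bounded extension to H^2 (unique, the span of the k_z     *)
(* being dense), and it is this extension that has to be compact.             *)
Definition compact_operator (B : {linear kspan -> H2}) : Prop :=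
  exists2 T : {linear H2 -> H2}, bounded_extension B T & sequentially_compact T.

End Fock.

(* Main.v *)
(** Write b(z, w) = <B k_z, k_w>.  Localization makes |b| a Schur kernel, so
    T f (w) = <f, B^* K_w>, with K_w the unnormalized kernel, satisfies the
    weighted Schur bound ||T f||^2 <= c \int |f|^2 A dmu, where
    A(z) = \int |b(z, w)| dV(w); by Fubini T f equals its own Bergman
    projection, hence lies in the Fock space, and T is the bounded extension of
    B.

    Suppose that the Berezin transform vanishes at infinity.  Applying the
    reproducing formula in both variables, around a base point z, writes
    exp(|l|^2 |y|^2) b(z + l^* y, z + l y), up to a unimodular factor, as an
    integral X_z(l) of exp(l * (linear form)) against a bounded kernel times a
    Gaussian.  For real l this is a value of the Berezin transform, so
    X_z(l) --> 0 as |z| --> oo; expanding the exponential, this propagates to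
    l = i, that is, b(z, z + u) --> 0 for every u.  With the uniform smallness
    of the tails, A vanishes at infinity.  A bounded sequence in the Fock space
    has a pointwise convergent subsequence f_j --> f, and then
    \int |f_j - f|^2 A dmu --> 0, so T is compact.

    Conversely, <h, k_z> --> 0 at infinity for every h in the Fock space, so a
    compact T satisfies <T k_z, k_z> --> 0. *)
Require Import Defs.
From HB Require Import structures.
From mathcomp Require Import all_boot all_order all_algebra.
From mathcomp Require Import complex.
From mathcomp Require Import all_classical all_reals all_analysis.
From mathcomp Require Import measurable_realfun ring lra.

Set Implicit Arguments.
Unset Strict Implicit.
Unset Printing Implicit Defensive.
Import Order.TTheory GRing.Theory Num.Theory.
Import numFieldNormedType.Exports.
Local Open Scope classical_set_scope.
Local Open Scope complex_scope.
Local Open Scope ring_scope.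

(** The obstacle is the passage from the diagonal to the off-diagonal. The Berezin transform sees
    only b(z, z), while b(z, w) is, up to Gaussian factors, antiholomorphic in z and holomorphic in
    w; smallness on the diagonal must be polarized uniformly in a base point going to infinity.
    Translation by z costs only unimodular factors, so the integrals X_z(l) have kernels bounded
    uniformly in z against one fixed weight. The step from real l to l = i is then a normal-families
    argument made quantitative: the functions g with X_z(g exp(t l)) --> 0 for all real t are stable
    under multiplication by l, and exp(i l) is the limit of (1 + i l / N)^N. An entire function is
    given as a pointwise differentiable one, so its integral formulas start from Goursat: circle
    means, then Gaussian means by rotation invariance, then the reproducing formula. Conversely, f =
    [bergman f] is the test for membership in the Fock space. The row mass A stays inside the Schur
    bound instead of being replaced by its supremum: pointwise convergence, all that a bounded
    sequence offers, thereby becomes norm convergence after applying T. *)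

Local Notation normc := ComplexField.Normc.normc.
Local Notation Re := complex.Re.
Local Notation Im := complex.Im.

(** * Complex numbers and the exponential *)

Section complex_numbers.
Variable R : realType.
Implicit Types (x y z : R[i]) (a b t : R).

Lemma normc_ge0 x : 0 <= normc x.
Proof. by case: x => a b; exact: sqrtr_ge0. Qed.

Lemma normcE x : `|x| = (normc x)%:C.
Proof. by []. Qed.

Lemma normcD x y : normc (x + y) <= normc x + normc y.
Proof. exact: le_normcD. Qed.

Lemma normcM x y : normc (x * y) = normc x * normc y.
Proof. exact: ComplexField.Normc.normcM. Qed.

Lemma normcN x : normc (- x) = normc x.
Proof. exact: normcN. Qed.

Lemma normcB x y : normc (x - y) = normc (y - x).
Proof. by rewrite -normcN opprB. Qed.

Lemma normcJ x : normc x^* = normc x.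
Proof. by case: x => a b /=; rewrite sqrrN. Qed.

Lemma normcR a : normc a%:C = `|a|.
Proof. by rewrite /= expr0n/= addr0 sqrtr_sqr. Qed.

Lemma normcX x k : normc (x ^+ k) = normc x ^+ k.
Proof.
elim: k => [|k IH]; first by rewrite !expr0 ComplexField.Normc.normc1.
by rewrite !exprS normcM IH.
Qed.

Lemma normc_sum I (r : seq I) (P : pred I) (F : I -> R[i]) :
  normc (\sum_(i <- r | P i) F i) <= \sum_(i <- r | P i) normc (F i).
Proof.
elim/big_ind2: _ => //; first by rewrite ComplexField.Normc.normc0.
by move=> ? ? ? ? h1 h2; rewrite (le_trans (normcD _ _))// lerD.
Qed.

Lemma ReD x y : Re (x + y) = Re x + Re y. Proof. by case: x y => ? ? []. Qed.
Lemma ImD x y : Im (x + y) = Im x + Im y. Proof. by case: x y => ? ? []. Qed.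
Lemma ReN x : Re (- x) = - Re x. Proof. by case: x. Qed.
Lemma ImN x : Im (- x) = - Im x. Proof. by case: x. Qed.
Lemma ReM x y : Re (x * y) = Re x * Re y - Im x * Im y.
Proof. by case: x y => ? ? []. Qed.
Lemma ImM x y : Im (x * y) = Re x * Im y + Im x * Re y.
Proof. by case: x y => ? ? [] ? ? /=; rewrite addrC. Qed.
Lemma ReJ x : Re x^* = Re x. Proof. by case: x. Qed.
Lemma ImJ x : Im x^* = - Im x. Proof. by case: x. Qed.

Lemma complexP x y : Re x = Re y -> Im x = Im y -> x = y.
Proof. by case: x y => a b [c d] /= -> ->. Qed.

Lemma ler_Re_normc x : `|Re x| <= normc x.
Proof.
rewrite -(ler_pXn2r (n := 2))// ?nnegrE ?normr_ge0 ?normc_ge0//.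
by rewrite normc_sqr real_normK ?num_real// lerDl sqr_ge0.
Qed.

Lemma ler_Im_normc x : `|Im x| <= normc x.
Proof.
rewrite -(ler_pXn2r (n := 2))// ?nnegrE ?normr_ge0 ?normc_ge0//.
by rewrite normc_sqr real_normK ?num_real// lerDr sqr_ge0.
Qed.

Lemma normc_le_ReIm x : normc x <= `|Re x| + `|Im x|.
Proof.
rewrite {1}(_ : x = (Re x)%:C + 'i%C * (Im x)%:C).
  rewrite (le_trans (normcD _ _))// normcM !normcR lerD//.
  by rewrite (_ : normc 'i%C = 1) ?mul1r//= expr0n/= expr1n add0r sqrtr1.
by apply: complexP; rewrite /= ?mulr0 ?mul0r ?subr0 ?addr0 ?mul1r ?add0r.
Qed.

Lemma mul_conjc x : x * x^* = (normc x ^+ 2)%:C.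
Proof.
rewrite normc_sqr; apply: complexP; rewrite ?ReM ?ImM ReJ ImJ /=; last by ring.
by rewrite mulrN opprK -!expr2.
Qed.

Lemma normc_eq0 x : normc x = 0 -> x = 0.
Proof. exact: ComplexField.Normc.eq0_normc. Qed.

Lemma conjcD x y : (x + y)^* = x^* + y^*.
Proof. by rewrite rmorphD. Qed.
Lemma conjcM x y : (x * y)^* = x^* * y^*.
Proof. by rewrite rmorphM. Qed.
Lemma conjK x : x^*^* = x.
Proof. by case: x => a b; apply: complexP; rewrite /= ?opprK. Qed.
Lemma conjcR a : (a%:C)^* = a%:C.
Proof. by apply: complexP; rewrite /= ?oppr0. Qed.

Lemma unit_phase x : exists2 c : R[i], normc c = 1 & c * x = (normc x)%:C.
Proof.
have [->|x0] := eqVneq x 0.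
  by exists 1; rewrite ?ComplexField.Normc.normc1 ?mulr0 ?ComplexField.Normc.normc0.
have nx0 : normc x != 0 by apply: contra x0 => /eqP/normc_eq0 ->.
exists (x^* * ((normc x)^-1)%:C).
  by rewrite normcM normcJ normcR ger0_norm ?invr_ge0 ?normc_ge0// divff.
rewrite mulrAC [x^* * x]mulrC mul_conjc expr2 -rmorphM/=.
by rewrite -mulrA divff// mulr1.
Qed.

Lemma cexpD x y : cexp (x + y) = cexp x * cexp y.
Proof.
rewrite /cexp ReD ImD expRD cosD sinD; apply: complexP.
  by rewrite !(ReM, ImM)/=; ring.
by rewrite !(ReM, ImM)/=; ring.
Qed.

Lemma cexp0 : cexp 0 = 1 :> R[i].
Proof. by rewrite /cexp/= expR0 cos0 sin0 mul1r. Qed.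

Lemma normc_cexp x : normc (cexp x) = expR (Re x).
Proof.
rewrite /cexp normcM normcR ger0_norm ?expR_ge0//=.
by rewrite cos2Dsin2 sqrtr1 mulr1.
Qed.

Lemma conjc_cexp x : (cexp x)^* = cexp x^*.
Proof.
by apply: complexP; rewrite /cexp !(ReM, ImM, ReJ, ImJ)/= cosN sinN; ring.
Qed.

Lemma cexpR a : cexp a%:C = (expR a)%:C.
Proof. by rewrite /cexp /= cos0 sin0 mulr1. Qed.

Lemma Re_cexp x : Re (cexp x) = expR (Re x) * cos (Im x).
Proof. by rewrite /cexp ReM/= mul0r subr0. Qed.
Lemma Im_cexp x : Im (cexp x) = expR (Re x) * sin (Im x).
Proof. by rewrite /cexp ImM/= mul0r addr0. Qed.

(** Both signs reduce to the tangent inequality 1 + s <= exp s, at s = -t for t >= 0 and at s = t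
    otherwise. *)
Lemma expR_B1_bound t : `|expR t - 1| <= `|t| * expR `|t|.
Proof.
have [t0|t0] := leP 0 t.
  have := expR_ge1Dx (- t); rewrite expRN => h.
  rewrite (ger0_norm t0) ger0_norm ?subr_ge0 -?expR0 ?ler_expR//.
  have e0 := expR_gt0 t.
  have : (1 - t) * expR t <= 1 by rewrite -ler_pdivlMr// mul1r.
  by rewrite mulrBl mul1r expR0 lerBlDr lerBlDl addrC.
have := expR_ge1Dx t => h.
rewrite (ltr0_norm t0) ler0_norm ?subr_le0 -?expR0 ?ler_expR ?(ltW t0)// expR0.
have : 1 <= expR (- t) by rewrite -[leLHS]expR0 ler_expR oppr_ge0 ltW.
by move: (expR (- t)) h t0 => u h t0 u1; nra.
Qed.

Lemma expR_B1Bx_bound t : `|expR t - 1 - t| <= t ^+ 2 * expR `|t|.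
Proof.
have h := expR_ge1Dx t.
rewrite ger0_norm; last by lra.
have e0 := expR_gt0 t.
have h2 : (1 - t) * expR t <= 1.
  by have := expR_ge1Dx (- t); rewrite expRN -ler_pdivlMr// mul1r.
have h3 : expR t - 1 - t <= t * (expR t - 1).
  by rewrite mulrBr mulr1; lra.
apply: (le_trans h3); apply: (le_trans (ler_norm _)).
rewrite normrM -[t ^+ 2]real_normK ?num_real// expr2 -mulrA.
by rewrite ler_wpM2l// expR_B1_bound.
Qed.

Lemma ler_norm_sin t : `|sin t| <= `|t|.
Proof.
wlog t0 : t / 0 <= t => [H|].
  have [/H//|/ltW t0] := leP 0 t.
  by rewrite -normrN -sinN -(normrN t) H// oppr_ge0.
have [->|tn0] := eqVneq t 0; first by rewrite sin0.
have tp : 0 < t by rewrite lt_neqAle eq_sym tn0.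
have [|c _] := @MVT R sin cos 0 t tp (fun (s : R) _ => is_derive_sin s).
  by apply: continuous_subspaceT => x; exact: continuous_sin.
rewrite sin0 !subr0 => ->; rewrite normrM ler_piMl//.
by rewrite ler_norml cos_geN1 cos_le1.
Qed.

Lemma cos_B1_bound t : `|cos t - 1| <= t ^+ 2.
Proof.
rewrite -normrN opprB.
have -> : 1 - cos t = 2 * sin (t / 2) ^+ 2.
  have : t = t / 2 + t / 2 by rewrite -splitr.
  move=> {1}->; rewrite cosD -!expr2 cos2sin2; ring.
rewrite ger0_norm; last by rewrite mulr_ge0// sqr_ge0.
have := ler_norm_sin (t / 2).
rewrite -(ler_pXn2r (n := 2))// ?nnegrE// !real_normK ?num_real//.
rewrite exprMn => h; have : 0 <= t ^+ 2 by apply: sqr_ge0.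
move: h; have -> : (2^-1 : R) ^+ 2 = 4^-1 by field.
move: (sin (t/2) ^+ 2) (t ^+ 2) => u v; lra.
Qed.

(** By the mean value theorem sin t - t = (cos c - 1) t with 0 < c < t, and 1 - cos c = 2 sin(c/2)^2
    <= 2 |sin(c/2)| <= c. *)
Lemma sin_Bx_bound t : `|sin t - t| <= t ^+ 2.
Proof.
wlog t0 : t / 0 <= t => [H|].
  have [/H//|/ltW t0] := leP 0 t.
  rewrite -normrN opprB -[X in X - _]opprK addrC -sinN -(sqrrN t).
  by apply: H; rewrite oppr_ge0.
have [->|tn0] := eqVneq t 0; first by rewrite sin0 subr0 normr0 sqr_ge0.
have tp : 0 < t by rewrite lt_neqAle eq_sym tn0.
have dsin (s : R) : s \in `]0, t[ ->
    is_derive s 1 (fun s : R => sin s - s) (cos s - 1).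
  by move=> _; apply: is_deriveB.
have [|c /= ci] := MVT tp dsin.
  apply: continuous_subspaceT => x; apply: cvgB; first exact: continuous_sin.
  exact: cvg_id.
rewrite sin0 !subr0 => ->; rewrite normrM expr2 (ger0_norm t0) ler_wpM2r//.
have -> : cos c - 1 = - (2 * sin (c / 2) ^+ 2).
  have : c = c / 2 + c / 2 by rewrite -splitr.
  move=> {1}->; rewrite cosD -!expr2 cos2sin2; ring.
move: ci; rewrite in_itv/= => /andP[c0 ct].
have := ler_norm_sin (c / 2); have : `|sin (c/2)| <= 1.
  by rewrite ler_norml sin_geN1 sin_le1.
move=> h1 h2; rewrite normrN ger0_norm; last by rewrite mulr_ge0// sqr_ge0.
move: h1 h2.
rewrite -[sin _ ^+ 2]real_normK ?num_real//.
have -> : `|c / 2| = c / 2 by rewrite ger0_norm// divr_ge0 ?ltW.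
move: (normr_ge0 (sin (c/2))) ; move: (`|sin _|) => u *; nra.
Qed.

(** The constant 4 counts pieces: the real and the imaginary part each split into two terms, each at
    most |x|^2 exp |x|. This remainder serves for the derivative of [cexp], for [bergman_entire],
    for the difference quotients in [null_l] and for comparing 1 + y with exp y. *)
Lemma cexp_bound x :
  normc (cexp x - 1 - x) <= 4 * normc x ^+ 2 * expR (normc x).
Proof.
have [na nb] := (ler_Re_normc x, ler_Im_normc x).
have := normc_ge0 x; move: na nb; move: (normc x) => N na nb N0.
apply: (le_trans (normc_le_ReIm _)).
rewrite !(ReD, ReN, ImD, ImN, Re_cexp, Im_cexp)/= oppr0 addr0.
move: (Re x) (Im x) na nb => a b na nb.
have -> : expR a * cos b - 1 - a = (expR a - 1 - a) + expR a * (cos b - 1).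
  by ring.
have -> : expR a * sin b - b = expR a * (sin b - b) + (expR a - 1) * b by ring.
have h1 := expR_B1Bx_bound a; have h2 := cos_B1_bound b.
have h3 := sin_Bx_bound b; have h4 := expR_B1_bound a.
have ea : expR a <= expR N by rewrite ler_expR (le_trans (ler_norm _)).
have ena : expR `|a| <= expR N by rewrite ler_expR.
have e0 := expR_ge0 a; have e0' := expR_ge0 N.
have a2 : a ^+ 2 <= N ^+ 2 by rewrite -[a ^+ 2]real_normK ?num_real// ler_pXn2r ?nnegrE.
have b2 : b ^+ 2 <= N ^+ 2 by rewrite -[b ^+ 2]real_normK ?num_real// ler_pXn2r ?nnegrE.
have H1 : `|expR a - 1 - a| <= N ^+ 2 * expR N.
  by rewrite (le_trans h1)// ler_pM ?sqr_ge0 ?expR_ge0.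
have H2 : `|expR a * (cos b - 1)| <= N ^+ 2 * expR N.
  by rewrite normrM (ger0_norm e0) mulrC ler_pM// (le_trans h2).
have H3 : `|expR a * (sin b - b)| <= N ^+ 2 * expR N.
  by rewrite normrM (ger0_norm e0) mulrC ler_pM// (le_trans h3).
have H4 : `|(expR a - 1) * b| <= N ^+ 2 * expR N.
  rewrite normrM expr2 -mulrA mulrC [leRHS]mulrC mulrC ler_pM//.
  by rewrite (le_trans h4)// ler_pM ?expR_ge0.
have := ler_normD (expR a - 1 - a) (expR a * (cos b - 1)).
have := ler_normD (expR a * (sin b - b)) ((expR a - 1) * b).
lra.
Qed.

Lemma cexpB1_bound x : normc (cexp x - 1) <= 5 * normc x * expR (2 * normc x).
Proof.
have -> : cexp x - 1 = (cexp x - 1 - x) + x by rewrite subrK.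
rewrite (le_trans (normcD _ _))//.
have := cexp_bound x; set N := normc x => h.
have N0 : 0 <= N := normc_ge0 _.
have e1 : 1 <= expR N by rewrite -[leLHS]expR0 ler_expR.
have h2 : N <= expR N by have := expR_ge1Dx N; lra.
have -> : 2 * N = N + N by ring.
rewrite expRD; apply: (le_trans (lerD h (lexx _))).
have : N ^+ 2 * expR N <= N * (expR N * expR N).
  by rewrite expr2 -mulrA ler_wpM2l// ler_wpM2r// expR_ge0.
have : N * 1 <= N * (expR N * expR N) by rewrite ler_wpM2l//; nra.
rewrite -!mulrA mulr1; move: (N ^+ 2 * expR N) (N * (expR N * expR N)) => u v; lra.
Qed.

End complex_numbers.

Section normc_values.
Variable R : realType.

Lemma normc_imag (t : R) : normc (0 +i* t) = `|t|.
Proof. by rewrite /= expr0n/= add0r sqrtr_sqr. Qed.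

Lemma normc_i : normc ('i%C : R[i]) = 1.
Proof. by rewrite normc_imag normr1. Qed.

End normc_values.
Local Arguments ComplexField.Normc.normc : simpl never.
Local Arguments cexp : simpl never.

(** * Integration of complex-valued functions *)

Lemma integrableZR d (T : measurableType d) (R : realType)
    (mu : {measure set T -> \bar R}) (D : set T) (c : R) (f : T -> R) : measurable D ->
  mu.-integrable D (EFin \o f) -> mu.-integrable D (EFin \o (fun x => c * f x)).
Proof.
move=> mD i_f; under [X in integrable _ _ X]eq_fun do rewrite /= EFinM.
exact: integrableZl.
Qed.

Section complex_integral.
Context d (T : measurableType d) (R : realType).
Variable mu : {measure set T -> \bar R}.
Implicit Types (D : set T) (f g : T -> R[i]) (c : R[i]).

Definition cmeas D f :=
  measurable_fun D (fun x => Re (f x)) /\ measurable_fun D (fun x => Im (f x)).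

(** Componentwise like [Cintegral], so that [inner] and [pint] agree by computation. *)
Definition cint D f : R[i] :=
  (\int[mu]_(x in D) Re (f x)) +i* (\int[mu]_(x in D) Im (f x)).

Definition cintegrable D f :=
  cmeas D f /\ mu.-integrable D (fun x => (normc (f x))%:E).

Lemma cmeasD D f g : cmeas D f -> cmeas D g -> cmeas D (fun x => f x + g x).
Proof.
move=> [? ?] [? ?]; split.
  by under eq_fun do rewrite ReD; exact: measurable_funD.
by under eq_fun do rewrite ImD; exact: measurable_funD.
Qed.

Lemma cmeasN D f : cmeas D f -> cmeas D (fun x => - f x).
Proof.
move=> [? ?]; split.
  by under eq_fun do rewrite ReN; exact: measurable_funN.
by under eq_fun do rewrite ImN; exact: measurable_funN.
Qed.

Lemma cmeasB D f g : cmeas D f -> cmeas D g -> cmeas D (fun x => f x - g x).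
Proof. by move=> mf mg; apply: cmeasD => //; exact: cmeasN. Qed.

Lemma cmeasM D f g : cmeas D f -> cmeas D g -> cmeas D (fun x => f x * g x).
Proof.
move=> [? ?] [? ?]; split.
  under eq_fun do rewrite ReM.
  by apply: measurable_funB; exact: measurable_funM.
under eq_fun do rewrite ImM.
by apply: measurable_funD; exact: measurable_funM.
Qed.

Lemma cmeasJ D f : cmeas D f -> cmeas D (fun x => (f x)^*).
Proof.
move=> [? ?]; split.
  by under eq_fun do rewrite ReJ.
by under eq_fun do rewrite ImJ; exact: measurable_funN.
Qed.

Lemma cmeas_cst D c : cmeas D (fun=> c).
Proof. by split; exact: measurable_cst. Qed.

Lemma cmeasR D (a : T -> R) : measurable_fun D a -> cmeas D (fun x => (a x)%:C).
Proof. by move=> ma; split => //=; exact: measurable_cst. Qed.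

Lemma cmeas_sum D I (r : seq I) (F : I -> T -> R[i]) :
  (forall i, cmeas D (F i)) -> cmeas D (fun x => \sum_(i <- r) F i x).
Proof.
move=> mF; elim: r => [|i r IH].
  by under eq_fun do rewrite big_nil; exact: cmeas_cst.
by under eq_fun do rewrite big_cons; exact: cmeasD.
Qed.

Lemma cmeas_cexp D f : measurable D -> cmeas D f -> cmeas D (fun x => cexp (f x)).
Proof.
move=> mD [mR mI]; split.
  under eq_fun do rewrite Re_cexp.
  apply: measurable_funM; first exact: measurableT_comp.
  apply: (measurableT_comp (f := @cos R) _ mI).
  by apply: continuous_measurable_fun => ?; exact: continuous_cos.
under eq_fun do rewrite Im_cexp.
apply: measurable_funM; first exact: measurableT_comp.
apply: (measurableT_comp (f := @sin R) _ mI).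
by apply: continuous_measurable_fun => ?; exact: continuous_sin.
Qed.

Lemma measurable_normc D f : cmeas D f -> measurable_fun D (fun x => normc (f x)).
Proof.
move=> [mR mI].
have -> : (fun x => normc (f x)) =
    Num.sqrt \o (fun x => Re (f x) ^+ 2 + Im (f x) ^+ 2).
  by apply/funext => x /=; case: (f x).
apply: measurableT_comp.
  by apply: continuous_measurable_fun; exact: sqrt_continuous.
by apply: measurable_funD; exact: measurable_funX.
Qed.

Lemma integrable_Re D f : cintegrable D f -> measurable D ->
  mu.-integrable D (EFin \o (fun x => Re (f x))).
Proof.
move=> [[mR mI] iN] mD; apply: le_integrable iN => //; first exact/measurable_EFinP.
by move=> x _ /=; rewrite lee_fin [leRHS]ger0_norm ?normc_ge0// ler_Re_normc.
Qed.

Lemma integrable_Im D f : cintegrable D f -> measurable D ->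
  mu.-integrable D (EFin \o (fun x => Im (f x))).
Proof.
move=> [[mR mI] iN] mD; apply: le_integrable iN => //; first exact/measurable_EFinP.
by move=> x _ /=; rewrite lee_fin [leRHS]ger0_norm ?normc_ge0// ler_Im_normc.
Qed.

Lemma le_cintegrable D f (g : T -> R) : measurable D -> cmeas D f ->
  (forall x, D x -> normc (f x) <= g x) -> mu.-integrable D (EFin \o g) ->
  cintegrable D f.
Proof.
move=> mD mf fg ig; split => //.
apply: le_integrable ig => //; first exact/measurable_EFinP/measurable_normc.
move=> x Dx /=; rewrite lee_fin ger0_norm ?normc_ge0//.
by rewrite (le_trans (fg _ Dx))// ler_norm.
Qed.

Lemma cintegrableD D f g : measurable D -> cintegrable D f -> cintegrable D g ->
  cintegrable D (fun x => f x + g x).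
Proof.
move=> mD [mf nf] [mg ng].
apply: (@le_cintegrable _ _ (fun x => normc (f x) + normc (g x))) => //.
- exact: cmeasD.
- by move=> x _; exact: normcD.
- under [X in integrable _ _ X]eq_fun do rewrite /= EFinD.
  exact: integrableD.
Qed.

Lemma cintegrableZ D c f : measurable D -> cintegrable D f ->
  cintegrable D (fun x => c * f x).
Proof.
move=> mD [mf nf]; split; first by apply: cmeasM => //; exact: cmeas_cst.
under [X in integrable _ _ X]eq_fun do rewrite normcM EFinM.
exact: integrableZl.
Qed.

Lemma cintegrableN D f : cintegrable D f -> cintegrable D (fun x => - f x).
Proof.
move=> [mf nf]; split; first exact: cmeasN.
by under [X in integrable _ _ X]eq_fun do rewrite normcN.
Qed.

Lemma cintegrableB D f g : measurable D -> cintegrable D f -> cintegrable D g ->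
  cintegrable D (fun x => f x - g x).
Proof. by move=> *; apply: cintegrableD => //; exact: cintegrableN. Qed.

Lemma cintegrableJ D f : cintegrable D f -> cintegrable D (fun x => (f x)^*).
Proof.
move=> [mf nf]; split; first exact: cmeasJ.
by under [X in integrable _ _ X]eq_fun do rewrite normcJ.
Qed.

Lemma cintegrableR D (a : T -> R) : measurable D ->
  mu.-integrable D (EFin \o a) -> cintegrable D (fun x => (a x)%:C).
Proof.
move=> mD ia; have ma : measurable_fun D a by exact/measurable_EFinP/(measurable_int mu).
apply: (@le_cintegrable _ _ (fun x => `|a x|)) => //.
- by move=> x _; rewrite normcR.
- exact: (integrable_abse ia).
Qed.

Lemma eq_cint D f g : (forall x, D x -> f x = g x) -> cint D f = cint D g.
Proof.
move=> fg; congr (_ +i* _); apply: eq_Rintegral => x /set_mem Dx; by rewrite fg.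
Qed.

Lemma cintD D f g : measurable D -> cintegrable D f -> cintegrable D g ->
  cint D (fun x => f x + g x) = cint D f + cint D g.
Proof.
move=> mD fi gi; apply: complexP; rewrite /= ?ReD ?ImD /=.
  rewrite -RintegralD//; [|exact: integrable_Re..].
  by apply: eq_Rintegral => x _; rewrite ReD.
rewrite -RintegralD//; [|exact: integrable_Im..].
by apply: eq_Rintegral => x _; rewrite ImD.
Qed.

Lemma cintZ D c f : measurable D -> cintegrable D f ->
  cint D (fun x => c * f x) = c * cint D f.
Proof.
move=> mD fi; have [iR iI] := (integrable_Re fi mD, integrable_Im fi mD).
apply: complexP; rewrite ?ReM ?ImM /=.
  rewrite -!RintegralZl// -RintegralB//; [|exact: integrableZR..].
  by apply: eq_Rintegral => x _; rewrite ReM.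
rewrite -!RintegralZl// -RintegralD//; [|exact: integrableZR..].
by apply: eq_Rintegral => x _; rewrite ImM.
Qed.

Lemma cintN D f : measurable D -> cintegrable D f ->
  cint D (fun x => - f x) = - cint D f.
Proof.
move=> mD fi; rewrite -mulN1r -cintZ//; by apply: eq_cint => x _; rewrite mulN1r.
Qed.

Lemma cintB D f g : measurable D -> cintegrable D f -> cintegrable D g ->
  cint D (fun x => f x - g x) = cint D f - cint D g.
Proof.
by move=> mD fi gi; rewrite cintD ?cintN//; exact: cintegrableN.
Qed.

Lemma cint_sum D I (r : seq I) (F : I -> T -> R[i]) : measurable D ->
  (forall i, cintegrable D (F i)) ->
  cintegrable D (fun x => \sum_(i <- r) F i x) /\
  cint D (fun x => \sum_(i <- r) F i x) = \sum_(i <- r) cint D (F i).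
Proof.
move=> mD iF; elim: r => [|i r [IH1 IH2]].
  split.
    under [X in cintegrable _ X]eq_fun do rewrite big_nil.
    split; first exact: cmeas_cst.
    under [X in integrable _ _ X]eq_fun do rewrite ComplexField.Normc.normc0.
    exact: integrable0.
  rewrite big_nil (eq_cint (g := fun=> 0)); last by move=> x _; rewrite big_nil.
  by apply: complexP; rewrite /= Rintegral_cst// mul0r.
split.
  under [X in cintegrable _ X]eq_fun do rewrite big_cons.
  exact: cintegrableD.
rewrite big_cons -IH2 -cintD//; by apply: eq_cint => x _; rewrite big_cons.
Qed.

Lemma cintJ D f : measurable D -> cintegrable D f ->
  cint D (fun x => (f x)^*) = (cint D f)^*.
Proof.
move=> mD fi; apply: complexP; rewrite ?ReJ ?ImJ /=.
  by apply: eq_Rintegral => x _; rewrite ReJ.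
rewrite -mulN1r -RintegralZl//; last exact: integrable_Im.
by apply: eq_Rintegral => x _; rewrite ImJ mulN1r.
Qed.

Lemma cintR D (a : T -> R) :
  cint D (fun x => (a x)%:C) = (\int[mu]_(x in D) a x)%:C.
Proof.
apply: complexP => //=; rewrite (@eq_Rintegral _ _ _ _ _ (cst 0))//.
by rewrite /Rintegral integral0.
Qed.

(* Rotating the integral onto the positive half-line leaves the modulus of the *)
(* integrand unchanged.                                                        *)
Lemma normc_cint_le D f : measurable D -> cintegrable D f ->
  normc (cint D f) <= \int[mu]_(x in D) normc (f x).
Proof.
move=> mD fi; have [c c1 cE] := unit_phase (cint D f).
have -> : normc (cint D f) = Re (cint D (fun x => c * f x)) by rewrite cintZ// cE.
apply: le_Rintegral => //.
- by apply: (@integrable_Re _ (fun x => c * f x)) => //; exact: cintegrableZ.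
- by case: fi.
- by move=> x _; rewrite (le_trans (ler_norm _))// (le_trans (ler_Re_normc _))// normcM c1 mul1r.
Qed.

Lemma Rintegral_cvg0 D (h : (T -> R)^nat) (g : T -> R) : measurable D ->
  (forall k, measurable_fun D (h k)) ->
  (forall k x, D x -> `|h k x| <= g x) -> mu.-integrable D (EFin \o g) ->
  (forall x, D x -> h ^~ x @ \oo --> (0 : R)) ->
  (\int[mu]_(x in D) h k x @[k --> \oo] --> (0 : R)).
Proof.
move=> mD mh hg ig h0.
have m1 k : measurable_fun D (EFin \o h k) by exact/measurable_EFinP.
have m2 : measurable_fun D (cst 0%E : T -> \bar R) by exact: measurable_cst.
have c1 : {ae mu, forall x, D x -> (EFin \o h k) x @[k --> \oo] --> cst 0%E x}.
  by apply: aeW => x Dx; apply: cvg_EFin; [exact: nearW|exact: h0].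
have c2 : {ae mu, forall x n, D x -> (`|(EFin \o h n) x| <= (EFin \o g) x)%E}.
  by apply: aeW => x k Dx /=; rewrite lee_fin; exact: hg.
have [_ _] := dominated_convergence mD m1 m2 c1 ig c2.
rewrite integral0 => H.
exact: (fine_cvg H).
Qed.

Lemma cint_cvg D (f_ : (T -> R[i])^nat) f (g : T -> R) : measurable D ->
  (forall k, cmeas D (f_ k)) -> cmeas D f ->
  (forall k x, D x -> normc (f_ k x) <= g x) ->
  (forall x, D x -> normc (f x) <= g x) ->
  mu.-integrable D (EFin \o g) ->
  (forall x, D x -> normc (f_ k x - f x) @[k --> \oo] --> (0 : R)) ->
  normc (cint D (f_ k) - cint D f) @[k --> \oo] --> (0 : R).
Proof.
move=> mD mf_ mf f_g fg ig f_f.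
have i_ k : cintegrable D (f_ k) by apply: (le_cintegrable _ _ (f_g k)).
have i : cintegrable D f by apply: (le_cintegrable _ _ fg).
have H : \int[mu]_(x in D) normc (f_ k x - f x) @[k --> \oo] --> (0 : R).
  apply: (@Rintegral_cvg0 D _ (fun x => 2 * g x)) => //.
  - by move=> k; apply: measurable_normc; exact: cmeasB.
  - move=> k x Dx; rewrite ger0_norm ?normc_ge0// (le_trans (normcD _ _))// normcN.
    by rewrite mulr2n mulrDl mul1r lerD// ?f_g ?fg.
  - exact: integrableZR.
apply: (squeeze_cvgr _ (cvg_cst 0) H).
apply: nearW => k; apply/andP; split; first exact: normc_ge0.
by rewrite -cintB//; apply: normc_cint_le => //; exact: cintegrableB.
Qed.

End complex_integral.

(** * Change of variables under measure-preserving maps *)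

Section measure_preserving_map.
Context d (T : measurableType d) (R : realType).
Variables (mu : {measure set T -> \bar R}) (phi : T -> T).

Definition mpreserving := measurable_fun setT phi /\
  forall A, measurable A -> mu (phi @^-1` A) = mu A.

Hypothesis phiP : mpreserving.

Lemma ge0_integral_mpreserving (f : T -> \bar R) : measurable_fun setT f ->
  (forall x, 0 <= f x)%E -> (\int[mu]_x f (phi x) = \int[mu]_x f x)%E.
Proof.
move=> mf f0; have [mphi h] := phiP.
rewrite -[LHS](ge0_integral_pushforward mphi mu measurableT mf)//.
by apply: eq_measure_integral => A mA _; exact: h.
Qed.

Lemma integral_mpreserving (f : T -> R) : measurable_fun setT f ->
  (\int[mu]_x (f (phi x))%:E = \int[mu]_x (f x)%:E)%E.
Proof.
move=> mf; have mfE : measurable_fun setT (EFin \o f) by exact/measurable_EFinP.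
rewrite integralE [RHS]integralE; congr (_ - _)%E.
  rewrite -[RHS]ge0_integral_mpreserving//; last exact: measurable_funepos.
  by apply: eq_integral => x _; rewrite !funeposE.
rewrite -[RHS]ge0_integral_mpreserving//; last exact: measurable_funeneg.
by apply: eq_integral => x _; rewrite !funenegE.
Qed.

Lemma integrable_mpreserving (f : T -> R) :
  mu.-integrable setT (EFin \o f) -> mu.-integrable setT (fun x => (f (phi x))%:E).
Proof.
move=> /integrableP[mf fi]; apply/integrableP; split.
  by apply: (measurableT_comp mf); exact: phiP.1.
rewrite (ge0_integral_mpreserving (f := fun x => `|(f x)%:E|%E))//.
exact: measurableT_comp.
Qed.

Lemma cint_mpreserving (f : T -> R[i]) : cmeas setT f ->
  cint mu setT (fun x => f (phi x)) = cint mu setT f.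
Proof.
move=> [mR mI]; congr (_ +i* _); rewrite /Rintegral; congr fine.
  exact: (integral_mpreserving mR).
exact: (integral_mpreserving mI).
Qed.

End measure_preserving_map.

Lemma cmeas_comp d1 d2 (T1 : measurableType d1) (T2 : measurableType d2)
    (R : realType) (f : T2 -> R[i]) (h : T1 -> T2) :
  cmeas setT f -> measurable_fun setT h -> cmeas setT (fun x => f (h x)).
Proof.
by move=> [mR mI] mh; split;
  [exact: (measurableT_comp mR mh)|exact: (measurableT_comp mI mh)].
Qed.

(** * Fubini's theorem for complex-valued functions *)

Section complex_fubini.
Context d1 d2 (T1 : measurableType d1) (T2 : measurableType d2) (R : realType).
Variables (m1 : {sigma_finite_measure set T1 -> \bar R}).
Variables (m2 : {sigma_finite_measure set T2 -> \bar R}).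

(** Tonelli applies to the positive and the negative part separately, and [fine] of their difference
    is measurable even where the inner integral is infinite. *)
Lemma measurable_Rintegral_r (f : T1 * T2 -> R) : measurable_fun setT f ->
  measurable_fun setT (fun x => \int[m2]_y f (x, y)).
Proof.
move=> mf; apply: (measurableT_comp (f := fine)) => //.
under eq_fun do rewrite integralE.
have mfE : measurable_fun setT (EFin \o f) by exact/measurable_EFinP.
apply: emeasurable_funB.
  have h := @measurable_fun_fubini_tonelli_F _ _ T1 T2 R m2 ((EFin \o f)^\+)%E.
  have -> : (fun x => \int[m2]_y (fun y => (f (x, y))%:E)^\+ y)%E =
      fubini_F m2 ((EFin \o f)^\+)%E.
    by apply/funext => x; apply: eq_integral => y _; rewrite !funeposE.
  by apply: h => //; exact: measurable_funepos.
have h := @measurable_fun_fubini_tonelli_F _ _ T1 T2 R m2 ((EFin \o f)^\-)%E.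
have -> : (fun x => \int[m2]_y (fun y => (f (x, y))%:E)^\- y)%E =
    fubini_F m2 ((EFin \o f)^\-)%E.
  by apply/funext => x; apply: eq_integral => y _; rewrite !funenegE.
by apply: h => //; exact: measurable_funeneg.
Qed.

Lemma cmeas_cint_r (f : T1 * T2 -> R[i]) : cmeas setT f ->
  cmeas setT (fun x => cint m2 setT (fun y => f (x, y))).
Proof.
move=> [mR mI]; split => /=.
  exact: (measurable_Rintegral_r mR).
exact: (measurable_Rintegral_r mI).
Qed.

Lemma Rintegral_fubini (f : T1 * T2 -> R) :
  (m1 \x m2)%E.-integrable setT (EFin \o f) ->
  \int[m1]_x \int[m2]_y f (x, y) = \int[(m1 \x m2)%E]_z f z /\
  \int[m2]_y \int[m1]_x f (x, y) = \int[(m1 \x m2)%E]_z f z.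
Proof.
move=> fi; have mf : measurable_fun setT f.
  by apply/measurable_EFinP; case/integrableP : fi.
split; rewrite /Rintegral; congr fine.
  rewrite -integral12_prod_meas1//; apply: ae_eq_integral => //.
  - exact/measurable_EFinP/(measurable_Rintegral_r mf).
  - exact: (measurable_fubini_F fi).
  (* The inner integral is finite for almost every x; on the exceptional null set [fine] may differ
     from it without effect. *)
  - have := ae_integrable1 fi; apply: filterS => x ix _ /=.
    by rewrite fineK//; exact: integrable_fin_num ix.
rewrite -integral21_prod_meas1//; apply: ae_eq_integral => //.
- apply/measurable_EFinP; apply: (measurableT_comp (f := fine)) => //.
  exact: (measurable_fubini_G fi).
- exact: (measurable_fubini_G fi).
- have := ae_integrable2 fi; apply: filterS => x ix _ /=.
  by rewrite fineK//; exact: integrable_fin_num ix.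
Qed.

Lemma cint_fubini (f : T1 * T2 -> R[i]) : cintegrable (m1 \x m2)%E setT f ->
  cint m1 setT (fun x => cint m2 setT (fun y => f (x, y))) =
    cint (m1 \x m2)%E setT f /\
  cint m2 setT (fun y => cint m1 setT (fun x => f (x, y))) =
    cint (m1 \x m2)%E setT f.
Proof.
move=> fi; have [iR iI] := (integrable_Re fi measurableT, integrable_Im fi measurableT).
have [R1 R2] := Rintegral_fubini iR; have [I1 I2] := Rintegral_fubini iI.
by split; congr (_ +i* _).
Qed.

Lemma cintegrable_prod (f : T1 * T2 -> R[i]) : cmeas setT f ->
  (\int[m1]_x \int[m2]_y (normc (f (x, y)))%:E < +oo)%E ->
  cintegrable (m1 \x m2)%E setT f.
Proof.
move=> mf foo; split => //.
apply/integrable12ltyP; first exact/measurable_EFinP/measurable_normc.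
move: foo; congr (_ < _)%E; apply: eq_integral => x _; apply: eq_integral => y _.
by rewrite /= ger0_norm ?normc_ge0.
Qed.

End complex_fubini.

(** * Goursat's theorem and circle means *)

Section goursat.
Variable R : realType.
Local Notation mu := (@lebesgue_measure R).
Implicit Types (g : R[i] -> R[i]) (w h : R[i]) (a b c d e : R).

(** Written with the real-valued modulus, so that the error is a real inequality that can be
    integrated along segments. *)
Definition cdiff g w := exists D : R[i], forall e, 0 < e ->
  exists2 d, 0 < d & forall h, normc h < d ->
    normc (g (w + h) - g w - D * h) <= e * normc h.

Definition ccont g w := forall e, 0 < e ->
  exists2 d, 0 < d & forall h, normc h < d -> normc (g (w + h) - g w) <= e.

Lemma cdiff_ccont g w : cdiff g w -> ccont g w.
Proof.
move=> [D /(_ 1 ltr01)[d d0 dg]] e e0.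
have N0 : 0 < 1 + normc D by rewrite ltr_pwDl// normc_ge0.
exists (Num.min d (e / (1 + normc D))); first by rewrite lt_min d0 divr_gt0.
move=> h; rewrite lt_min ltr_pdivlMr// => /andP[hd he].
have -> : g (w + h) - g w = (g (w + h) - g w - D * h) + D * h by rewrite subrK.
rewrite (le_trans (normcD _ _))// normcM.
by have := dg _ hd; move: he; nra.
Qed.

Lemma cdiff_comp g k w : cdiff k w -> cdiff g (k w) -> cdiff (g \o k) w.
Proof.
move=> dk [E dg]; have ck := cdiff_ccont dk; move: dk => [D dk].
exists (E * D) => e e0.
pose ND := normc D; pose NE := normc E.
have [ND0 NE0] : 0 <= ND /\ 0 <= NE by split; exact: normc_ge0.
(* The error of [k] is multiplied by |E| <= 1 + NE, that of [g] is taken at an increment of size at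
   most (1 + ND) |h|; both are tuned to e / 2. The minimum with 1 gives the second bound. *)
pose e1 := Num.min 1 (e / (2 * (1 + NE))).
have e10 : 0 < e1 by rewrite lt_min ltr01 divr_gt0// mulr_gt0// ltr_pwDl.
pose e2 := e / (2 * (1 + ND)).
have e20 : 0 < e2 by rewrite divr_gt0// mulr_gt0// ltr_pwDl.
have [d1 d10 h1] := dk _ e10; have [d2 d20 h2] := dg _ e20.
have d22 : 0 < d2 / 2 by rewrite divr_gt0.
have [d3 d30 h3] := ck _ d22.
exists (Num.min d1 d3); first by rewrite lt_min d10.
move=> h; rewrite lt_min => /andP[hd1 hd3] /=.
have := h3 _ hd3; set t := k (w + h) - k w => td2.
have td : normc t < d2 by rewrite (le_lt_trans td2)// ltr_pdivrMr// ltr_pMr// ltr1n.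
have -> : k (w + h) = k w + t by rewrite /t; ring.
have -> : g (k w + t) - g (k w) - E * D * h =
    (g (k w + t) - g (k w) - E * t) + E * (t - D * h) by ring.
rewrite (le_trans (normcD _ _))// normcM.
have b2 := h2 _ td; have b1 := h1 _ hd1; rewrite -/t in b1.
have tb : normc t <= (1 + ND) * normc h.
  have -> : t = (t - D * h) + D * h by rewrite subrK.
  rewrite (le_trans (normcD _ _))// normcM mulrDl lerD//.
  by rewrite (le_trans b1)// ler_wpM2r ?normc_ge0// /e1 ge_min lexx.
have N0 := normc_ge0 h.
have b3 : e2 * normc t <= e / 2 * normc h.
  have -> : e / 2 * normc h = e2 * ((1 + ND) * normc h).
    by rewrite /e2; field; apply/lt0r_neq0; rewrite ltr_pwDl.
  by rewrite ler_wpM2l// ltW.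
have b4 : NE * normc (t - D * h) <= e / 2 * normc h.
  have -> : e / 2 * normc h = (1 + NE) * (e / (2 * (1 + NE)) * normc h).
    by field; apply/lt0r_neq0; rewrite ltr_pwDl.
  apply: ler_pM => //; [exact: normc_ge0|by rewrite lerDr|].
  by rewrite (le_trans b1)// ler_wpM2r// /e1 ge_min lexx orbT.
by rewrite /NE in b4; lra.
Qed.

Lemma cdiff_cexp w : cdiff (@cexp R) w.
Proof.
exists (cexp w) => e e0.
pose N := normc (cexp w); have N0 : 0 <= N := normc_ge0 _.
pose K := (1 + N) * 4 * expR 1.
have K0 : 0 < K by rewrite !mulr_gt0 ?expR_gt0// ltr_pwDl.
exists (Num.min 1 (e / K)); first by rewrite lt_min ltr01 divr_gt0.
move=> h; rewrite lt_min ltr_pdivlMr// => /andP[h1 hK].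
rewrite cexpD -{2}[cexp w]mulr1 -mulrBr -mulrBr normcM -/N.
have h0 := normc_ge0 h.
have B := cexp_bound h.
have E : expR (normc h) <= expR 1 by rewrite ler_expR ltW.
have B2 : normc (cexp h - 1 - h) <= 4 * expR 1 * normc h * normc h.
  rewrite (le_trans B)// expr2 -!mulrA ler_wpM2l//.
  by rewrite mulrA [leRHS]mulrC ler_wpM2l// mulr_ge0.
apply: (@le_trans _ _ ((1 + N) * (4 * expR 1 * normc h * normc h))).
  by apply: ler_pM => //; [exact: normc_ge0|rewrite lerDr].
have -> : (1 + N) * (4 * expR 1 * normc h * normc h) = normc h * K * normc h.
  by rewrite /K; ring.
by rewrite ler_wpM2r// ltW.
Qed.

Lemma ccont_real_line g a c : (forall w, ccont g w) ->
  continuous (fun x : R => Re (g (x +i* c))) /\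
  continuous (fun x : R => Im (g (x +i* c))).
Proof.
move=> cg; split => x; apply/cvgrPdist_le => e e0.
all: have [d d0 dg] := cg (x +i* c) _ e0.
all: near=> t.
all: have td : normc (t - x)%:C < d
  by rewrite normcR distrC; near: t; exact: (@cvgr_dist_lt _ _ _ (nbhs x) _ id x).
all: have := dg _ td.
all: have -> : (x +i* c) + (t - x)%:C = t +i* c
  by apply: complexP; rewrite /= ?addr0// addrC subrK.
all: rewrite distrC; apply: le_trans.
- by rewrite -ReN -ReD ler_Re_normc.
- by rewrite -ImN -ImD ler_Im_normc.
Unshelve. all: by end_near. Qed.

Lemma ccont_imag_line g a : (forall w, ccont g w) ->
  continuous (fun y : R => Re (g (a +i* y))) /\
  continuous (fun y : R => Im (g (a +i* y))).
Proof.
move=> cg; split => x; apply/cvgrPdist_le => e e0.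
all: have [d d0 dg] := cg (a +i* x) _ e0.
all: near=> t.
all: have td : normc (0 +i* (t - x)) < d
  by rewrite normc_imag distrC; near: t; exact: (@cvgr_dist_lt _ _ _ (nbhs x) _ id x).
all: have := dg _ td.
all: have -> : (a +i* x) + (0 +i* (t - x)) = a +i* t
  by apply: complexP; rewrite /= ?addr0// addrC subrK.
all: rewrite distrC; apply: le_trans.
- by rewrite -ReN -ReD ler_Re_normc.
- by rewrite -ImN -ImD ler_Im_normc.
Unshelve. all: by end_near. Qed.

Definition seg (f : R -> R[i]) a b := cint mu `[a, b] f.

Definition fcont (f : R -> R[i]) :=
  continuous (fun x => Re (f x)) /\ continuous (fun x => Im (f x)).

Lemma measurable_segment a b : measurable (`[a, b] : set (measurableTypeR R)).
Proof. exact: measurable_itv. Qed.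

Lemma fcont_cmeas f (D : set (measurableTypeR R)) :
  fcont f -> measurable D -> @cmeas _ (measurableTypeR R) R D f.
Proof.
move=> [cR cI] mD; split; apply: measurable_funTS; exact: continuous_measurable_fun.
Qed.

Lemma fcont_integrable f a b : fcont f -> cintegrable mu `[a, b] f.
Proof.
move=> fc; have [cR cI] := fc; have mf := fcont_cmeas fc (measurable_segment a b).
apply: (@le_cintegrable _ _ _ mu _ _ (fun x => `|Re (f x)| + `|Im (f x)|)) => //.
  by move=> x _; exact: normc_le_ReIm.
apply: continuous_compact_integrable; first exact: segment_compact.
apply: continuous_subspaceT => x; apply: cvgD.
  by apply: cvg_norm; exact: cR.
by apply: cvg_norm; exact: cI.
Qed.

Lemma seg_split f a b m : fcont f -> a <= m -> m <= b ->
  seg f a b = seg f a m + seg f m b.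
Proof.
move=> fc am mb; have fi := fcont_integrable a b fc.
have mab := measurable_segment a b.
have [iR iI] := (integrable_Re fi mab, integrable_Im fi mab).
have H (h : R -> R) : mu.-integrable `[a, b] (EFin \o h) ->
    \int[mu]_(x in `[a, b]) h x =
    \int[mu]_(x in `[a, m]) h x + \int[mu]_(x in `[m, b]) h x.
  move=> ih; apply/eqP; rewrite addrC -subr_eq; apply/eqP.
  rewrite (Rintegral_itvB ih) ?bnd_simp// Rintegral_itv_obnd_cbnd//.
  by apply: integrableS ih => //; apply: subset_itvr; rewrite bnd_simp.
by apply: complexP; rewrite ?ReD ?ImD /= H.
Qed.

Lemma seg_cst (k : R[i]) a b : a <= b -> seg (fun=> k) a b = (b - a)%:C * k.
Proof.
move=> ab; have mE : fine (mu `[a, b]) = b - a.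
  by rewrite lebesgue_measure_itv/= lte_fin; case: ltgtP ab => //= -> _; rewrite subrr.
by apply: complexP; rewrite ?ReM ?ImM /= Rintegral_cst//= mE mul0r ?subr0 ?addr0 mulrC.
Qed.

Lemma seg_bound f a b e : fcont f -> a <= b ->
  (forall x, a <= x <= b -> normc (f x) <= e) ->
  normc (seg f a b) <= (b - a) * e.
Proof.
move=> fc ab fe; have fi := fcont_integrable a b fc.
rewrite (le_trans (normc_cint_le (measurable_segment a b) fi))//.
have mE : fine (mu `[a, b]) = b - a.
  by rewrite lebesgue_measure_itv/= lte_fin; case: ltgtP ab => //= -> _; rewrite subrr.
rewrite [leRHS]mulrC -mE -(Rintegral_cst mu (measurable_segment a b)).
apply: le_Rintegral => //.
- by case: fi.
- apply: continuous_compact_integrable; first exact: segment_compact.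
  by apply: continuous_subspaceT => x; exact: cvg_cst.
Qed.

(** The contour integral of g dz, counterclockwise around the rectangle [a, b] x [c, d]; the
    vertical sides carry the factor i because dz = i dy there. *)
Definition boundary_integral g a b c d : R[i] :=
  seg (fun x => g (x +i* c)) a b - seg (fun x => g (x +i* d)) a b
  + 'i%C * (seg (fun y => g (b +i* y)) c d - seg (fun y => g (a +i* y)) c d).

Lemma boundary_integral_quarter g a m b c k d : (forall w, ccont g w) ->
  a <= m -> m <= b -> c <= k -> k <= d ->
  boundary_integral g a b c d =
  boundary_integral g a m c k + boundary_integral g m b c k +
  boundary_integral g a m k d + boundary_integral g m b k d.
Proof.
move=> cg am mb ck kd.
have hx y : fcont (fun x => g (x +i* y)) by exact: ccont_real_line.
have hy x : fcont (fun y => g (x +i* y)) by exact: ccont_imag_line.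
rewrite /boundary_integral (seg_split (hx c) am mb) (seg_split (hx d) am mb).
rewrite (seg_split (hy a) ck kd) (seg_split (hy b) ck kd); ring.
Qed.

(** An affine function has zero contour integral, by direct computation, so only the deviation from
    it is integrated, over a path of length the perimeter. *)
Lemma boundary_integral_affine_bound g a b c d (A D : R[i]) e :
  (forall w, ccont g w) -> a <= b -> c <= d ->
  (forall x y, a <= x <= b -> c <= y <= d ->
     normc (g (x +i* y) - (A + D * (x +i* y))) <= e) ->
  normc (boundary_integral g a b c d) <= 2 * ((b - a) + (d - c)) * e.
Proof.
move=> cg ab cd ge.
pose r w := g w - (A + D * w).
have dcaff w : ccont (fun w => A + D * w) w.
  move=> e1 e10; exists (e1 / (1 + normc D)).
    by rewrite divr_gt0// ltr_pwDl// normc_ge0.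
  move=> h; rewrite ltr_pdivlMr ?ltr_pwDl ?normc_ge0// => he.
  have -> : A + D * (w + h) - (A + D * w) = D * h by ring.
  rewrite normcM; have := normc_ge0 h; have := normc_ge0 D; nra.
have cr w : ccont r w.
  move=> e1 e10; have e2 : 0 < e1 / 2 by rewrite divr_gt0.
  have [d1 d10 h1] := cg w _ e2; have [d2 d20 h2] := dcaff w _ e2.
  exists (Num.min d1 d2); first by rewrite lt_min d10.
  move=> h; rewrite lt_min => /andP[/h1 b1 /h2 b2].
  have -> : r (w + h) - r w =
    (g (w + h) - g w) - (A + D * (w + h) - (A + D * w)) by rewrite /r; ring.
  by rewrite (le_trans (normcD _ _))// normcN; lra.
have hx k y : (forall w, ccont k w) -> fcont (fun x => k (x +i* y)).
  by move=> ck; exact: ccont_real_line.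
have hy k x : (forall w, ccont k w) -> fcont (fun y => k (x +i* y)).
  by move=> ck; exact: ccont_imag_line.
have segB f f' s t : fcont f -> fcont f' ->
    seg f s t - seg f' s t = seg (fun x => f x - f' x) s t.
  by move=> *; rewrite /seg -cintB//; exact: fcont_integrable.
have J0 : boundary_integral (fun w => A + D * w) a b c d = 0.
  (* Between opposite sides an affine function changes by a constant, so each pair of sides gives an
     explicit product, and the two products cancel. *)
  rewrite /boundary_integral (segB _ _ a b (hx _ c dcaff) (hx _ d dcaff)).
  rewrite (segB _ _ c d (hy _ b dcaff) (hy _ a dcaff)).
  have -> : (fun x => A + D * (x +i* c) - (A + D * (x +i* d))) =
      fun=> D * (0 +i* (c - d)).
    by apply/funext => x; apply: complexP; rewrite !(ReD, ImD, ReN, ImN, ReM, ImM)/=; ring.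
  have -> : (fun x => A + D * (b +i* x) - (A + D * (a +i* x))) =
      fun=> D * ((b - a)%:C).
    by apply/funext => x; apply: complexP; rewrite !(ReD, ImD, ReN, ImN, ReM, ImM)/=; ring.
  rewrite !seg_cst//.
  by apply: complexP; rewrite !(ReD, ImD, ReN, ImN, ReM, ImM)/=; ring.
have -> : boundary_integral g a b c d = boundary_integral r a b c d.
  rewrite -[RHS]addr0 -J0 /boundary_integral.
  have E f f' s t : fcont f -> fcont f' ->
      seg (fun x => f x - f' x) s t = seg f s t - seg f' s t.
    by move=> *; rewrite segB.
  rewrite (E _ _ a b (hx _ c cg) (hx _ c dcaff)).
  rewrite (E _ _ a b (hx _ d cg) (hx _ d dcaff)).
  rewrite (E _ _ c d (hy _ a cg) (hy _ a dcaff)).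
  rewrite (E _ _ c d (hy _ b cg) (hy _ b dcaff)); ring.
have B1 y : c <= y <= d -> normc (seg (fun x => r (x +i* y)) a b) <= (b - a) * e.
  by move=> yI; apply: seg_bound => // [|x xI]; [exact: hx|exact: ge].
have B2 x : a <= x <= b -> normc (seg (fun y => r (x +i* y)) c d) <= (d - c) * e.
  by move=> xI; apply: seg_bound => // [|y yI]; [exact: hy|exact: ge].
rewrite /boundary_integral (le_trans (normcD _ _))//.
rewrite normcM normc_i mul1r.
have N1 := normcD (seg (fun x => r (x +i* c)) a b) (- seg (fun x => r (x +i* d)) a b).
have N2 := normcD (seg (fun y => r (b +i* y)) c d) (- seg (fun y => r (a +i* y)) c d).
rewrite !normcN in N1 N2.
have C1 := B1 c; have C2 := B1 d; have C3 := B2 a; have C4 := B2 b.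
rewrite lexx cd in C1; rewrite lexx cd in C2.
rewrite lexx ab in C3; rewrite lexx ab in C4.
apply: (le_trans (lerD N1 N2)).
apply: (le_trans (lerD (lerD (C1 isT) (C2 isT)) (lerD (C4 isT) (C3 isT)))).
by rewrite le_eqVlt; apply/orP; left; apply/eqP; ring.
Qed.

(** Quadrisection: one of the four quarters carries at least a quarter of the modulus. The nested
    rectangles shrink to a point, where differentiability makes the function affine up to an error
    small relative to the size of the rectangle. *)
Theorem goursat g a b c d : (forall w, cdiff g w) -> a <= b -> c <= d ->
  boundary_integral g a b c d = 0.
Proof.
move=> dg ab cd; have cg w := cdiff_ccont (dg w).
pose p := b - a; pose q := d - c.
have [p0 q0] : 0 <= p /\ 0 <= q by rewrite /p /q !subr_ge0.
pose J n (x : R * R) := normc (boundary_integral g x.1 (x.1 + p / 2 ^+ n)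
  x.2 (x.2 + q / 2 ^+ n)).
have half (s : R) n : s / 2 ^+ n.+1 = s / 2 ^+ n / 2.
  by rewrite exprSr invfM mulrA.
pose inside n (x y : R * R) := [/\ x.1 <= y.1, y.1 + p / 2 ^+ n.+1 <= x.1 + p / 2 ^+ n,
  x.2 <= y.2 & y.2 + q / 2 ^+ n.+1 <= x.2 + q / 2 ^+ n].
have corner (x y P Q u v : R) : 0 <= P -> 0 <= Q ->
    u = x \/ u = x + P -> v = y \/ v = y + Q ->
    [/\ x <= u, u + P <= x + (P + P), y <= v & v + Q <= y + (Q + Q)].
  by clear => P0 Q0 [] -> [] ->; split; lra.
have step (nx : nat * (R * R)) : exists y, inside nx.1 nx.2 y /\
    J nx.1 nx.2 / 4 <= J nx.1.+1 y.
  case: nx => n [x y] /=.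
  have e0 (s : R) : 0 <= s -> 0 <= s / 2 ^+ n.+1.
    by move=> ?; rewrite divr_ge0// exprn_ge0.
  pose P := p / 2 ^+ n.+1; pose Q := q / 2 ^+ n.+1.
  have P0 : 0 <= P := e0 _ p0; have Q0 : 0 <= Q := e0 _ q0.
  have PE : p / 2 ^+ n = P + P by rewrite /P half -splitr.
  have QE : q / 2 ^+ n = Q + Q by rewrite /Q half -splitr.
  have JE : J n (x, y) <= J n.+1 (x, y) + J n.+1 (x + P, y) +
      J n.+1 (x, y + Q) + J n.+1 (x + P, y + Q).
    rewrite /J/= -/P -/Q PE QE !addrA.
    rewrite (@boundary_integral_quarter g x (x + P) _ y (y + Q)) ?lerDl//.
    rewrite (le_trans (normcD _ _))// lerD2r (le_trans (normcD _ _))// lerD2r.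
    exact: normcD.
  rewrite /inside/= -/P -/Q PE QE.
  have [h1|h1] := leP (J n (x, y) / 4) (J n.+1 (x, y)).
    by exists (x, y); split; [apply: corner => //; left|].
  have [h2|h2] := leP (J n (x, y) / 4) (J n.+1 (x + P, y)).
    by exists (x + P, y); split; [apply: corner => //; [right|left]|].
  have [h3|h3] := leP (J n (x, y) / 4) (J n.+1 (x, y + Q)).
    by exists (x, y + Q); split; [apply: corner => //; [left|right]|].
  exists (x + P, y + Q); split; first by apply: corner => //; right.
  move: JE h1 h2 h3; move: (J n.+1 _) (J n.+1 _) (J n.+1 _) (J n.+1 _) (J n _).
  by clear => *; lra.
have [F FP] := choice step.
pose s := fix s n := if n is m.+1 then F (m, s m) else (a, c).
have sP n : inside n (s n) (s n.+1) by have [] := FP (n, s n).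
have sJ n : J 0%N (a, c) / 4 ^+ n <= J n (s n).
  elim: n => [|n IH]; first by rewrite expr0 divr1.
  have [_] := FP (n, s n); apply: le_trans.
  by rewrite exprSr invfM mulrA ler_wpM2r// invr_ge0.
have nest n m : (n <= m)%N -> [/\ (s n).1 <= (s m).1,
    (s m).1 + p / 2 ^+ m <= (s n).1 + p / 2 ^+ n,
    (s n).2 <= (s m).2 & (s m).2 + q / 2 ^+ m <= (s n).2 + q / 2 ^+ n].
  elim: m => [|m IH]; first by rewrite leqn0 => /eqP ->.
  rewrite leq_eqVlt => /predU1P[->//|]; rewrite ltnS => /IH[i1 i2 i3 i4].
  have [j1 j2 j3 j4] := sP m.
  by split; [exact: le_trans j1|exact: le_trans i2|exact: le_trans j3|exact: le_trans i4].
have pn0 n : 0 <= p / 2 ^+ n by rewrite divr_ge0// exprn_ge0.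
have qn0 n : 0 <= q / 2 ^+ n by rewrite divr_ge0// exprn_ge0.
have up1 n m : (s n).1 <= (s m).1 + p / 2 ^+ m.
  have [nm|/ltnW mn] := leqP n m.
    by have [h _ _ _] := nest _ _ nm; rewrite (le_trans h)// lerDl.
  by have [_ h _ _] := nest _ _ mn; rewrite (le_trans _ h)// lerDl.
have up2 n m : (s n).2 <= (s m).2 + q / 2 ^+ m.
  have [nm|/ltnW mn] := leqP n m.
    by have [_ _ h _] := nest _ _ nm; rewrite (le_trans h)// lerDl.
  by have [_ _ _ h] := nest _ _ mn; rewrite (le_trans _ h)// lerDl.
(* Every lower corner lies below every upper corner, so the supremum of the lower ones belongs to
   all the intervals. *)
have pick (u v : nat -> R) : (forall n m, u n <= v m) ->
    exists t, forall n, u n <= t <= v n.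
  move=> uv; exists (sup (range u)) => n; apply/andP; split.
    by apply: ub_le_sup; [exists (v 0%N) => _ [m _ <-]|exists n].
  by apply: ge_sup; [exists (u 0%N), 0%N|move=> _ [m _ <-]].
have [x0 x0P] := pick _ _ up1; have [y0 y0P] := pick _ _ up2.
pose w0 := x0 +i* y0.
have [D Dg] := dg w0.
(* The lower bound loses 4^n; the perimeter and the diameter of the n-th rectangle each give back a
   factor 2^-n, so that n disappears. *)
have main e : 0 < e -> J 0%N (a, c) <= e * (2 * (p + q) ^+ 2).
  move=> e0; have [dl dl0 dlP] := Dg _ e0.
  have [n nP] : exists n, (p + q) / 2 ^+ n < dl.
    have [n nP] : exists n, (p + q) / dl < n%:R.
      exists (Num.truncn ((p + q) / dl)).+1; exact: truncnS_gt.
    exists n; rewrite ltr_pdivrMr ?exprn_gt0// mulrC -ltr_pdivrMr//.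
    rewrite (lt_le_trans nP)// -natrX ler_nat; exact/ltnW/ltn_expl.
  have := sJ n; rewrite ler_pdivrMr ?exprn_gt0// => h; apply: (le_trans h).
  have B := @boundary_integral_affine_bound g (s n).1 ((s n).1 + p / 2 ^+ n)
    (s n).2 ((s n).2 + q / 2 ^+ n) (g w0 - D * w0) D (e * ((p + q) / 2 ^+ n)) cg.
  have {}B : J n (s n) <= 2 * (p / 2 ^+ n + q / 2 ^+ n) * (e * ((p + q) / 2 ^+ n)).
    rewrite /J (le_trans (B _ _ _)) ?lerDl//; last first.
      by rewrite ![(_ + _ / _) - _]addrAC !subrr !add0r.
    move=> x y /andP[x1 x2] /andP[y1 y2].
    have /andP[x3 x4] := x0P n; have /andP[y3 y4] := y0P n.
    pose h' := (x - x0) +i* (y - y0).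
    have hE : x +i* y = w0 + h'.
      by apply: complexP; rewrite /= addrC subrK.
    have hn : normc h' <= (p + q) / 2 ^+ n.
      rewrite (le_trans (normc_le_ReIm _))//= mulrDl lerD//.
        by rewrite ler_norml; apply/andP; split; lra.
      by rewrite ler_norml; apply/andP; split; lra.
    have := dlP h' (le_lt_trans hn nP); rewrite -hE => hh.
    have -> : g (x +i* y) - (g w0 - D * w0 + D * (x +i* y)) =
        g (x +i* y) - g w0 - D * h' by rewrite hE; ring.
    by rewrite (le_trans hh)// ler_wpM2l// ltW.
  have -> : e * (2 * (p + q) ^+ 2) =
      2 * (p / 2 ^+ n + q / 2 ^+ n) * (e * ((p + q) / 2 ^+ n)) * 4 ^+ n.
    have -> : (4 : R) ^+ n = 2 ^+ n * 2 ^+ n by rewrite -exprMn; congr (_ ^+ _); ring.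
    by field; rewrite expf_neq0.
  by rewrite ler_wpM2r// exprn_ge0.
apply: normc_eq0; apply/eqP; rewrite eq_le normc_ge0 andbT.
have -> : normc (boundary_integral g a b c d) = J 0%N (a, c).
  by rewrite /J/= !expr0 !divr1 /p /q !(addrC _ (_ - _)) !subrK.
apply/ler_addgt0Pl => e e0; rewrite addr0.
(* Adding 1 keeps the divisor positive when the rectangle is a point. *)
have K0 : 0 < 2 * (p + q) ^+ 2 + 1 by rewrite ltr_wpDl// mulr_ge0// sqr_ge0.
rewrite (le_trans (main (e / (2 * (p + q) ^+ 2 + 1)) _)) ?divr_gt0//.
by rewrite mulrAC ler_pdivrMr// ler_wpM2l ?(ltW e0)// lerDl.
Qed.

(** Goursat is applied to f o exp on a rectangle of height 2 pi: by periodicity the horizontal sides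
    cancel, so the integral M a of f over the circle of radius exp a does not depend on a. Letting
    the radius tend to 0 gives 2 pi f(0) by continuity. *)
Theorem circle_mean (f : R[i] -> R[i]) : (forall w, cdiff f w) ->
  cint mu `[0, 2 * pi] (fun t => f (cexp (0 +i* t))) = (2 * pi)%:C * f 0.
Proof.
move=> df; pose g := f \o @cexp R.
have dg w : cdiff g w by apply: cdiff_comp; [exact: cdiff_cexp|exact: df].
have cg w := cdiff_ccont (dg w).
have pi0 : 0 <= 2 * pi :> R by rewrite mulr_ge0// pi_ge0.
pose M a := seg (fun y => g (a +i* y)) 0 (2 * pi).
have M_le a b : a <= b -> M a = M b.
  move=> ab; have := goursat dg ab pi0; rewrite /boundary_integral.
  have -> : (fun x => g (x +i* (2 * pi))) = fun x => g (x +i* 0).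
    apply/funext => x; rewrite /g/=; congr f; rewrite /cexp/=.
    by rewrite mulr_natl cos2pi sin2pi cos0 sin0.
  rewrite subrr add0r => /eqP; rewrite mulf_eq0 => /orP[/eqP/(congr1 (@complex.Im R))/=/eqP|].
    by rewrite oner_eq0.
  by rewrite subr_eq0 => /eqP H; rewrite /M H.
apply/eqP; rewrite -subr_eq0; apply/eqP; apply: normc_eq0.
apply/eqP; rewrite eq_le normc_ge0 andbT.
apply/ler_addgt0Pl => e e0; rewrite addr0.
have K0 : 0 < 2 * pi + 1 :> R by rewrite ltr_wpDl.
have e1 : 0 < e / (2 * pi + 1) by rewrite divr_gt0.
have [d d0 dP] := cdiff_ccont (df 0) e1.
(* a <= 0 makes [M_le] applicable between a and 0, and exp a <= d / 2 puts the whole circle where f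
   is close to f(0). *)
pose a := Num.min 0 (ln (d / 2)).
have -> : cint mu `[0, 2 * pi] (fun t => f (cexp (0 +i* t))) = M a.
  by rewrite (M_le a 0) // /a ge_min lexx.
have -> : (2 * pi)%:C * f 0 = seg (fun=> f 0) 0 (2 * pi).
  by rewrite seg_cst// subr0.
have fc : fcont (fun y => g (a +i* y)) by exact: ccont_imag_line.
have fk : fcont (fun=> f 0) by split => x; exact: cvg_cst.
have mpi := measurable_segment 0 (2 * pi).
rewrite /M /seg -(cintB mpi (fcont_integrable _ _ fc) (fcont_integrable _ _ fk)).
have B x : normc (g (a +i* x) - f 0) <= e / (2 * pi + 1).
  have : normc (cexp (a +i* x)) < d.
    rewrite normc_cexp/= (@le_lt_trans _ _ (d / 2))//; last first.
      by rewrite ltr_pdivrMr// ltr_pMr// ltr1n.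
    rewrite -[leRHS]lnK ?posrE ?divr_gt0// ler_expR /a ge_min lexx orbT//.
  by move=> /dP; rewrite add0r.
have := @seg_bound (fun x => g (a +i* x) - f 0) 0 (2 * pi) (e / (2 * pi + 1)).
rewrite /seg => H; rewrite (le_trans (H _ _ _))//.
  have [cR cI] := fc; split => x.
    rewrite (_ : (fun _ => _) = fun x => Re (g (a +i* x)) - Re (f 0)); last first.
      by apply/funext => y; rewrite ReD ReN.
    by apply: cvgB; [exact: cR|exact: cvg_cst].
  rewrite (_ : (fun _ => _) = fun x => Im (g (a +i* x)) - Im (f 0)); last first.
    by apply/funext => y; rewrite ImD ImN.
  by apply: cvgB; [exact: cI|exact: cvg_cst].
by rewrite subr0 mulrA ler_pdivrMr// mulrC ler_wpM2l ?(ltW e0)// lerDl.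
Qed.

End goursat.

(** * Lebesgue measure on C^n *)

Section preserving_products.
Context d1 d2 (T1 : measurableType d1) (T2 : measurableType d2) (R : realType).

Lemma mpreserving_comp d (T : measurableType d) (mu : {measure set T -> \bar R})
    (f g : T -> T) :
  mpreserving mu f -> mpreserving mu g -> mpreserving mu (f \o g).
Proof.
move=> [mf hf] [mg hg]; split; first exact: measurableT_comp.
move=> A mA; rewrite comp_preimage hg ?hf//.
by rewrite -[_ @^-1` _]setTI; exact: mf.
Qed.

Variables (m1 : {sigma_finite_measure set T1 -> \bar R}).
Variables (m2 : {sigma_finite_measure set T2 -> \bar R}).

Lemma mpreserving_fiber2 (psi : T1 -> T2 -> T2) :
  measurable_fun setT (fun z : T1 * T2 => psi z.1 z.2) ->
  (forall x, mpreserving m2 (psi x)) ->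
  mpreserving (m1 \x m2)%E (fun z => (z.1, psi z.1 z.2)).
Proof.
move=> mpsi psiP.
have mphi : measurable_fun setT (fun z : T1 * T2 => (z.1, psi z.1 z.2)).
  by apply/measurable_fun_pairP; split; [exact: measurable_fst|exact: mpsi].
split => // A mA; rewrite /product_measure1/=; apply: eq_integral => x _ /=.
rewrite -[RHS](psiP x).2; last exact: measurable_xsection.
by congr (m2 _); apply/seteqP; split => y /=; rewrite /xsection/= !inE.
Qed.

(** The product measure is defined by slices over the first factor; uniqueness gives the slices over
    the second, on which [mpreserving_fiber1] works. *)
Lemma product_measure21 A : measurable A -> (m1 \x m2)%E A = (m1 \x^ m2)%E A.
Proof.
move=> mA; apply: product_measure_unique => // X Y mX mY.
by rewrite /= product_measure2E.
Qed.

Lemma mpreserving_fiber1 (psi : T2 -> T1 -> T1) :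
  measurable_fun setT (fun z : T1 * T2 => psi z.2 z.1) ->
  (forall y, mpreserving m1 (psi y)) ->
  mpreserving (m1 \x m2)%E (fun z => (psi z.2 z.1, z.2)).
Proof.
move=> mpsi psiP.
have mphi : measurable_fun setT (fun z : T1 * T2 => (psi z.2 z.1, z.2)).
  by apply/measurable_fun_pairP; split; [exact: mpsi|exact: measurable_snd].
split => // A mA; etransitivity.
  apply: product_measure21; rewrite -[_ @^-1` _]setTI; exact: mphi.
etransitivity; last by apply/esym; exact: product_measure21.
rewrite /product_measure2/=; apply: eq_integral => y _ /=.
rewrite -[RHS](psiP y).2; last exact: measurable_ysection.
by congr (m1 _); apply/seteqP; split => x /=; rewrite /ysection/= !inE.
Qed.

Lemma integral_prodM (f : T1 -> R) (h : T2 -> R) :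
  measurable_fun setT f -> measurable_fun setT h ->
  (forall x, 0 <= f x) -> (forall y, 0 <= h y) ->
  (\int[m1 \x m2]_z (f z.1 * h z.2)%:E =
   (\int[m1]_x (f x)%:E) * (\int[m2]_y (h y)%:E))%E.
Proof.
move=> mf mh f0 h0.
have mE : measurable_fun setT (fun z : T1 * T2 => (f z.1 * h z.2)%:E).
  apply/measurable_EFinP; apply: measurable_funM.
    exact: (measurableT_comp mf measurable_fst).
  exact: (measurableT_comp mh measurable_snd).
rewrite fubini_tonelli1//; last by move=> z; rewrite lee_fin mulr_ge0.
rewrite -ge0_integralZr//; last 3 first.
- exact/measurable_EFinP.
- by move=> x _; rewrite lee_fin.
- by apply: integral_ge0 => y _; rewrite lee_fin.
apply: eq_integral => x _; rewrite /fubini_F/=.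
under eq_integral do rewrite EFinM.
rewrite ge0_integralZl//; first exact/measurable_EFinP.
- by move=> y _; rewrite lee_fin.
- by rewrite lee_fin.
Qed.

End preserving_products.

(** * Translations and rotations of the plane *)

Section plane.
Variable R : realType.
Local Notation mu := (@lebesgue_measure R).
Local Notation RT := (measurableTypeR R).

(** The translated measure gives half-open intervals their length, and this characterizes Lebesgue
    measure. *)
Lemma mpreserving_shift (a : R) : mpreserving mu (fun x : RT => x + a).
Proof.
have ms : measurable_fun setT (fun x : RT => (x + a : RT)).
  by apply: measurable_funD => //; exact: measurable_cst.
split => // A mA.
pose m' : {measure set RT -> \bar R} :=
  measure_function_pushforward__canonical__measure_function_Measure mu ms.
apply/esym; have := @lebesgue_measure_unique R m'; apply => // X.
move=> [[b c] /= _ <-].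
rewrite /m' /= /pushforward.
have -> : (fun x : RT => x + a) @^-1` `]b, c]%classic = `]b - a, c - a]%classic.
  by apply/seteqP; split => x /=; rewrite !in_itv/= ltrBlDr lerBrDr.
by rewrite !lebesgue_measure_itv/= !lte_fin ltrD2r; case: ifPn => // _;
  rewrite -!EFinB opprB addrA subrK.
Qed.

Local Notation P := (@plane_measure R).

Lemma mpreserving_planeD (a b : R) :
  mpreserving P (fun z : RT * RT => (z.1 + a, z.2 + b)).
Proof.
have h1 := @mpreserving_fiber2 _ _ RT RT R mu mu (fun _ y => y + b).
have h2 := @mpreserving_fiber1 _ _ RT RT R mu mu (fun _ x => x + a).
apply: (mpreserving_comp (h2 _ _) (h1 _ _)).
- by apply: measurable_funD; [exact: measurable_fst|exact: measurable_cst].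
- by move=> _; exact: mpreserving_shift.
- by apply: measurable_funD; [exact: measurable_snd|exact: measurable_cst].
- by move=> _; exact: mpreserving_shift.
Qed.

(* A rotation other than the half-turn is a product of three shears. *)
Lemma mpreserving_plane_rot (c s : R) : c ^+ 2 + s ^+ 2 = 1 ->
  mpreserving P (fun z : RT * RT => (c * z.1 - s * z.2, s * z.1 + c * z.2)).
Proof.
wlog c1 : c s / 1 + c != 0 => [H|] cs.
  have [c1|] := eqVneq (1 + c) 0; last by move=> ?; exact: H.
  have cE : c = -1 by apply/eqP; rewrite -addr_eq0 addrC c1.
  have s0 : s = 0.
    apply/eqP; rewrite -sqrf_eq0; apply/eqP.
    by move: cs; rewrite cE sqrrN expr1n; lra.
  (* The half-turn is the square of the quarter-turn (c, s) = (0, 1), for which 1 + c is nonzero. *)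
  have h : mpreserving P (fun z : RT * RT => (0 * z.1 - 1 * z.2, 1 * z.1 + 0 * z.2)).
    by apply: H; rewrite ?addr0 ?oner_eq0// expr0n/= add0r expr1n.
  have := mpreserving_comp h h; congr (mpreserving _ _); apply/funext => -[x y] /=.
  by rewrite cE s0; congr pair; ring.
have sh1 k : mpreserving P (fun z : RT * RT => (z.1 + k * z.2, z.2)).
  apply: (@mpreserving_fiber1 _ _ RT RT R mu mu (fun y x => x + k * y)).
    apply: measurable_funD; first exact: measurable_fst.
    by apply: measurable_funM; [exact: measurable_cst|exact: measurable_snd].
  by move=> y; exact: mpreserving_shift.
have sh2 k : mpreserving P (fun z : RT * RT => (z.1, z.2 + k * z.1)).
  apply: (@mpreserving_fiber2 _ _ RT RT R mu mu (fun x y => y + k * x)).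
    apply: measurable_funD; first exact: measurable_snd.
    by apply: measurable_funM; [exact: measurable_cst|exact: measurable_fst].
  by move=> y; exact: mpreserving_shift.
(* With c = cos t and s = sin t, this is k = - tan(t / 2). *)
pose k := - (s / (1 + c)).
have := mpreserving_comp (sh1 k) (mpreserving_comp (sh2 s) (sh1 k)).
congr (mpreserving _ _); apply/funext => -[x y] /=.
have s2 : s ^+ 2 = (1 + c) * (1 - c) by rewrite -[s ^+ 2](addKr (c ^+ 2)) cs; ring.
have ks : 1 + k * s = c.
  by rewrite /k mulNr mulrAC -expr2 s2 mulrAC divff// mul1r; ring.
have kc : k * (1 + c) = - s by rewrite /k mulNr divfK.
congr pair; last by rewrite -ks; ring.
have -> : x + k * y + k * (y + s * (x + k * y)) =
  (1 + k * s) * x + k * (1 + (1 + k * s)) * y by ring.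
by rewrite ks kc mulNr.
Qed.

End plane.

(** * Invariance of the volume of C^n and Gaussian integrals *)

Section volume_theory.
Variable R : realType.
Local Notation RT := (measurableTypeR R).
Local Notation C2 := (measurableTypeR R * measurableTypeR R)%type.
Local Notation Cn n := 'rV[R[i]]_n.

Lemma cmeas_coord n (j : 'I_n) : cmeas setT (fun z : Cn n => z 0 j).
Proof.
have m := @measurable_ccoord R n j; split.
  exact: (measurableT_comp measurable_fst m).
exact: (measurableT_comp measurable_snd m).
Qed.

Lemma measurable_Cn d (T : measurableType d) n (f : T -> Cn n) :
  (forall j, cmeas setT (fun x => f x 0 j)) -> measurable_fun setT f.
Proof.
move=> mf; apply: measurable_fun_Cn => j; have [mR mI] := mf j.
by apply/measurable_fun_pairP.
Qed.

(** The measure [volumeS m] is a push-forward under the bijection [ccons]; conjugating by it moves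
    the question to the product of a plane and C^n, which is the induction step for translations and
    rotations. *)
Lemma mpreserving_volumeS n (m : {sigma_finite_measure set (Cn n) -> \bar R})
    (phi : Cn n.+1 -> Cn n.+1) (Phi : C2 * Cn n -> C2 * Cn n) :
  (forall x, phi (ccons x) = ccons (Phi x)) ->
  mpreserving (@plane_measure R \x m)%E Phi -> mpreserving (volumeS m) phi.
Proof.
move=> E [mPhi h].
have mphi : measurable_fun setT phi.
  have -> : phi = @ccons R n \o Phi \o @cuncons R n.
    by apply/funext => z; rewrite /= -E cunconsK.
  apply: measurableT_comp; last exact: measurable_cuncons.
  by apply: measurableT_comp; first exact: measurable_ccons.
split => // A mA; rewrite /volumeS /= /pushforward.
rewrite -[RHS]h; last by rewrite -[_ @^-1` _]setTI; exact: measurable_ccons.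
by congr ((@plane_measure R \x m)%E _); apply/seteqP; split => x /=; rewrite E.
Qed.

Lemma mpreserving0 (m : {measure set (Cn 0) -> \bar R}) (phi : Cn 0 -> Cn 0) :
  mpreserving m phi.
Proof.
have -> : phi = id by apply/funext => z; rewrite [LHS]thinmx0 [RHS]thinmx0.
by split => [|A _]; [exact: measurable_id|rewrite preimage_id].
Qed.

Lemma mpreserving_volumeD n (a : Cn n) : mpreserving (volume R n) (fun z => z + a).
Proof.
elim: n a => [|n IH] a; first exact: mpreserving0.
pose a0 := a 0 ord0; pose a' : Cn n := \row_j a 0 (lift ord0 j).
pose Phi (x : C2 * Cn n) : C2 * Cn n :=
  ((x.1.1 + complex.Re a0, x.1.2 + complex.Im a0), x.2 + a').
apply: (@mpreserving_volumeS n (volume R n) _ Phi).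
  move=> [[x y] v]; apply/rowP => i; rewrite !mxE/=.
  case: unliftP => [j ->|->]; first by rewrite !mxE.
  by apply: complexP; rewrite /= ?ReD ?ImD.
have h1 := @mpreserving_fiber2 _ _ _ _ R (@plane_measure R) (volume R n)
  (fun _ v => v + a').
have h2 := @mpreserving_fiber1 _ _ _ _ R (@plane_measure R) (volume R n)
  (fun _ z => (z.1 + complex.Re a0, z.2 + complex.Im a0)).
have mD : measurable_fun setT (fun v : Cn n => v + a').
  exact: (IH a').1.
have [mP _] := mpreserving_planeD (complex.Re a0) (complex.Im a0).
apply: (mpreserving_comp (h2 _ _) (h1 _ _)).
- exact: (measurableT_comp mP measurable_fst).
- by move=> _; exact: mpreserving_planeD.
- exact: (measurableT_comp mD measurable_snd).
- by move=> _; exact: IH.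
Qed.

Lemma mpreserving_volume_rot n (c : R[i]) : normc c = 1 ->
  mpreserving (volume R n) (fun z => c *: z).
Proof.
move=> c1; elim: n => [|n IH]; first exact: mpreserving0.
pose Phi (x : C2 * Cn n) : C2 * Cn n :=
  ((complex.Re c * x.1.1 - complex.Im c * x.1.2,
    complex.Im c * x.1.1 + complex.Re c * x.1.2), c *: x.2).
have cs : complex.Re c ^+ 2 + complex.Im c ^+ 2 = 1 by rewrite -normc_sqr c1 expr1n.
apply: (@mpreserving_volumeS n (volume R n) _ Phi).
  move=> [[x y] v]; apply/rowP => i; rewrite !mxE/=.
  case: unliftP => [j _|_]; first by rewrite !mxE.
  by apply: complexP; rewrite /= ?ReM ?ImM//= addrC.
have h1 := @mpreserving_fiber2 _ _ _ _ R (@plane_measure R) (volume R n)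
  (fun _ v => c *: v).
have h2 := @mpreserving_fiber1 _ _ _ _ R (@plane_measure R) (volume R n)
  (fun _ z => (complex.Re c * z.1 - complex.Im c * z.2,
    complex.Im c * z.1 + complex.Re c * z.2)).
have [mP _] := mpreserving_plane_rot cs.
apply: (mpreserving_comp (h2 _ _) (h1 _ _)).
- exact: (measurableT_comp mP measurable_fst).
- by move=> _; exact: mpreserving_plane_rot.
- exact: (measurableT_comp IH.1 measurable_snd).
- by move=> _; exact: IH.
Qed.

Lemma integrable_gauss1 (a : R) : 0 < a ->
  (@lebesgue_measure R).-integrable setT (fun x => (expR (- (a * x ^+ 2)))%:E).
Proof.
(* s is the standard deviation of the normal law with density proportional to exp(- a x^2), since 1
   / (2 s^2) = a. *)
move=> a0; pose s := Num.sqrt ((2 * a)^-1).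
have s0 : s != 0 by rewrite gt_eqF// sqrtr_gt0 invr_gt0 mulr_gt0.
have := integrable_normal_pdf 0 s; rewrite normal_pdfE// => /(integrableZl measurableT).
move=> /(_ (normal_peak s)^-1%R).
apply: eq_integrable => // x _; rewrite /normal_fun subr0 -EFinM mulKf; last first.
  by rewrite gt_eqF// normal_peak_gt0.
congr (expR _)%:E; rewrite /s sqr_sqrtr ?invr_ge0 ?mulr_ge0 ?(ltW a0)//.
by rewrite mulNr; congr (- _); field; rewrite gt_eqF.
Qed.

Lemma sqcnorm_ge0 n (z : Cn n) : 0 <= sqcnorm z.
Proof. by apply: sumr_ge0 => j _; rewrite sqr_ge0. Qed.

Lemma sqcnorm_ccons n (x : C2 * Cn n) :
  sqcnorm (ccons x) = x.1.1 ^+ 2 + x.1.2 ^+ 2 + sqcnorm x.2.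
Proof.
rewrite /sqcnorm big_ord_recl; congr (_ + _).
  by rewrite mxE unlift_none normc_sqr.
by apply: eq_bigr => j _; rewrite mxE liftK.
Qed.

Lemma measurable_gauss n (a : R) :
  measurable_fun setT (fun z : Cn n => expR (- (a * sqcnorm z))).
Proof.
apply: measurableT_comp => //; apply: measurableT_comp => //.
by apply: measurable_funM; [exact: measurable_cst|exact: measurable_sqcnorm].
Qed.

(** Each complex coordinate contributes g^2. Keeping the one-dimensional value g abstract lets one
    induction serve both a = 1, where g is the square root of pi, and a general a > 0, where only
    finiteness is wanted. *)
Lemma integral_gauss n (a g : R) :
  (\int[@lebesgue_measure R]_x (expR (- (a * x ^+ 2)))%:E = g%:E)%E ->
  (\int[volume R n]_z (expR (- (a * sqcnorm z)))%:E = ((g ^+ 2) ^+ n)%:E)%E.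
Proof.
move=> gE; elim: n => [|n IH].
  have m0 := @measurable_gauss 0 a.
  rewrite integral_dirac//; last exact/measurable_EFinP.
  by rewrite diracT mul1e /sqcnorm big_ord0 mulr0 oppr0 expR0 expr0.
transitivity (\int[@plane_measure R \x volume R n]_x
   (expR (- (a * sqcnorm (@ccons R n x))))%:E)%E.
  have mE : measurable_fun setT (fun z : Cn n.+1 => (expR (- (a * sqcnorm z)))%:E).
    by apply/measurable_EFinP; exact: measurable_gauss.
  exact: (@ge0_integral_pushforward _ _ _ _ R _ (@measurable_ccons R n)
    (@plane_measure R \x volume R n)%E setT _ measurableT mE).
have mg : measurable_fun setT (fun x : RT => expR (- (a * x ^+ 2))).
  do 2 apply: measurableT_comp => //.
  by apply: measurable_funM; [exact: measurable_cst|exact: measurable_funX].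
have mP : measurable_fun setT (fun z : C2 => expR (- (a * z.1 ^+ 2)) * expR (- (a * z.2 ^+ 2))).
  apply: measurable_funM.
    exact: (measurableT_comp mg measurable_fst).
  exact: (measurableT_comp mg measurable_snd).
under eq_integral => x _.
  rewrite sqcnorm_ccons !mulrDr !opprD !expRD.
  over.
have P0 (z : C2) : 0 <= expR (- (a * z.1 ^+ 2)) * expR (- (a * z.2 ^+ 2)).
  by rewrite mulr_ge0 ?expR_ge0.
etransitivity.
  exact: (integral_prodM (@plane_measure R) (volume R n) mP
    (@measurable_gauss n a) P0 (fun z => expR_ge0 _)).
have E := integral_prodM (@lebesgue_measure R) (@lebesgue_measure R) mg mg
  (fun x => expR_ge0 _) (fun x => expR_ge0 _).
transitivity ((g%:E * g%:E) * ((g ^+ 2) ^+ n)%:E)%E; last first.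
  by rewrite -!EFinM (exprS (g ^+ 2) n) (expr2 g).
by congr (_ * _)%E => //; rewrite -gE; exact: E.
Qed.

Lemma integral_gauss_pi n :
  (\int[volume R n]_z (expR (- sqcnorm z))%:E = (pi ^+ n)%:E)%E.
Proof.
rewrite -[in RHS](@sqr_sqrtr R pi) ?pi_ge0// -(@integral_gauss n 1); last first.
  by rewrite -integralT_gauss; apply: eq_integral => x _; rewrite mul1r.
by apply: eq_integral => z _; rewrite mul1r.
Qed.

Lemma integrable_gauss n (a : R) : 0 < a ->
  (volume R n).-integrable setT (fun z => (expR (- (a * sqcnorm z)))%:E).
Proof.
move=> a0; have i1 := integrable_gauss1 a0.
have gE := @integral_gauss n a (fine (\int[@lebesgue_measure R]_x (expR (- (a * x ^+ 2)))%:E)).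
apply/integrableP; split; first by apply/measurable_EFinP; exact: measurable_gauss.
under eq_integral do rewrite /= ger0_norm ?expR_ge0//.
by rewrite gE ?ltry// fineK//; exact: integrable_fin_num i1.
Qed.

End volume_theory.

(** * Holomorphy along complex lines *)

Section complex_differentiability.
Variables (R : realType) (n : nat).
Local Notation C := (R[i]^o).
Local Notation Cn := 'rV[R[i]]_n.

Lemma entire_line (f : Cn -> C) (a z : Cn) (w : R[i]) :
  entire f -> cdiff (fun l => f (a + l *: z)) w.
Proof.
move=> df.
have := derivable_nbhs (@diff_derivable _ _ _ f (a + w *: z) z (df _)).
move=> /eqaddoP h; exists ('D_z f (a + w *: z)) => e e0.
have /h : 0 < e%:C by rewrite ltcR.
rewrite near_simpl => /nbhs_ballP[d /= d0 dP].
(* Radii of balls over the scalar field R[i] are positive elements of R[i], hence real; this and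
   similar lines bring them back to R. *)
have dR : d = (Re d)%:C by rewrite RRe_real ?gtr0_real.
exists (Re d); first by rewrite -ltcR -dR.
move=> k kd; move: (dP k); rewrite -ball_normE/= sub0r normrN normcE {1}dR ltcR.
move=> /(_ kd); rewrite !normcE -rmorphM/= lecR.
rewrite -![(_ + _ : _ -> _) _]/(_ + _) -![(- _ : _ -> _) _]/(- _) /cst/=.
congr (normc _ <= _); rewrite scalerDl opprD addrA.
by congr (f _ - _ - _); [rewrite addrC addrA|exact: mulrC].
Qed.

(** A quadratic remainder is an explicit inequality that can be checked under an integral sign, and
    on the ball of radius min(1, e / (1 + |K|)) it is at most e |h|. *)
Lemma entire_of_expansion (f : Cn -> C) :
  (forall a, exists (c : 'I_n -> R[i]) (K : R), forall h : Cn,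
    `|h| <= 1 -> normc (f (h + a) - f a - \sum_j h 0 j * c j) <= K * Re `|h| ^+ 2) ->
  entire f.
Proof.
move=> H a; have [c [K HK]] := H a.
pose L (h : Cn) : C := \sum_j h 0 j * c j.
have Llin : linear L.
  move=> k u v; rewrite /L scaler_sumr -big_split/=; apply: eq_bigr => j _.
  by rewrite !mxE mulrDl -mulrA.
pose V : normedModType R[i] := Cn.
pose LL : {linear Cn -> C} := HB.pack L (GRing.isLinear.Build _ _ _ _ L Llin).
have cL : continuous (LL : (Cn : normedModType R[i]) -> C).
  suff H1 (r : seq 'I_n) :
      continuous ((fun h : Cn => \sum_(j <- r) h 0 j * c j) : V -> C) by exact: H1.
  elim: r => [|j r IH] x.
    rewrite (_ : (fun _ => _) = cst 0); first exact: cst_continuous.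
    by apply/funext => h; rewrite big_nil.
  rewrite (_ : (fun _ => _) = (fun h : Cn => h 0 j * c j + \sum_(j <- r) h 0 j * c j)).
    apply: continuousD; last exact: IH.
    have cj : {for x, continuous (fun h : V => (h : Cn) 0 j : C)} by exact: coord_continuous.
    have cc : {for x, continuous (fun h : V => c j : C)} by exact: cst_continuous.
    exact: (continuousM cj cc).
  by apply/funext => h; rewrite big_cons.
have e1 : f \o shift a = cst (f a) + LL +o_ (0 : V) id.
  apply/eqaddoP => e e0; rewrite near_simpl; apply/nbhs_ballP.
  have eR : e = (Re e)%:C by rewrite RRe_real ?gtr0_real.
  pose d : R := Num.min 1 (Re e / (1 + `|K|)).
  have K0 : 0 < 1 + `|K| by rewrite ltr_pwDl.
  have Re0 : 0 < Re e by rewrite -ltcR -eR.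
  have d0 : 0 < d by rewrite lt_min ltr01 divr_gt0.
  exists d%:C => /=; first by rewrite ltcR.
  move=> h; rewrite -ball_normE/= sub0r normrN => hd.
  have hR : `|h| = (Re `|h|)%:C by rewrite RRe_real ?normr_real.
  rewrite hR ltcR lt_min ltr_pdivlMr// in hd; move: hd => /andP[h1 h2].
  have h0 : 0 <= Re `|h| by have := normr_ge0 h; rewrite {1}hR ler0c.
  rewrite -![(_ + _ : _ -> _) _]/(_ + _) -![(- _ : _ -> _) _]/(- _) /cst/=.
  rewrite normcE hR {1}eR -rmorphM/= lecR opprD addrA.
  apply: le_trans (HK h _) _; first by rewrite hR lecR ltW.
  rewrite expr2 mulrA ler_wpM2r//.
  rewrite (le_trans _ (ltW h2))// mulrC ler_wpM2l//.
  by rewrite (le_trans (ler_norm _))// lerDr.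
apply/diff_locallyP; have E := diff_unique cL e1.
by rewrite E.
Qed.

End complex_differentiability.

(** * The Gaussian-weighted L^2 space *)

Section hermitian_form.
Variables (R : realType) (n : nat).
Local Notation Cn := 'rV[R[i]]_n.
Implicit Types (z w u v : Cn) (c : R[i]).

Lemma cdotDl u v w : cdot (u + v) w = cdot u w + cdot v w.
Proof.
by rewrite /cdot -big_split; apply: eq_bigr => j _; rewrite mxE mulrDl.
Qed.

Lemma cdotDr u v w : cdot w (u + v) = cdot w u + cdot w v.
Proof.
by rewrite /cdot -big_split; apply: eq_bigr => j _; rewrite mxE conjcD mulrDr.
Qed.

Lemma cdotZl c u w : cdot (c *: u) w = c * cdot u w.
Proof. by rewrite /cdot mulr_sumr; apply: eq_bigr => j _; rewrite mxE mulrA. Qed.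

Lemma cdotZr c u w : cdot u (c *: w) = c^* * cdot u w.
Proof.
by rewrite /cdot mulr_sumr; apply: eq_bigr => j _; rewrite mxE conjcM mulrCA.
Qed.

Lemma cdotJ u w : (cdot u w)^* = cdot w u.
Proof.
rewrite /cdot rmorph_sum; apply: eq_bigr => j _ /=.
by rewrite conjcM conjK mulrC.
Qed.

Lemma cdotNl u w : cdot (- u) w = - cdot u w.
Proof. by rewrite -scaleN1r cdotZl mulN1r. Qed.

Lemma cdotBl u v w : cdot (u - v) w = cdot u w - cdot v w.
Proof. by rewrite cdotDl cdotNl. Qed.

Lemma cdotNr u w : cdot u (- w) = - cdot u w.
Proof. by rewrite -cdotJ cdotNl rmorphN/= cdotJ. Qed.

Lemma cdot0r u : cdot u 0 = 0.
Proof. by rewrite /cdot big1// => j _; rewrite mxE rmorph0 mulr0. Qed.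

Lemma cdot_sqcnorm u : cdot u u = (sqcnorm u)%:C.
Proof.
by rewrite /cdot /sqcnorm rmorph_sum; apply: eq_bigr => j _; rewrite mul_conjc.
Qed.

Lemma sqcnormE u : sqcnorm u = Re (cdot u u).
Proof. by rewrite cdot_sqcnorm. Qed.

Lemma Re_cdotC u v : Re (cdot u v) = Re (cdot v u).
Proof. by rewrite -cdotJ ReJ. Qed.

Lemma Im_cdotC u v : Im (cdot u v) = - Im (cdot v u).
Proof. by rewrite -cdotJ ImJ. Qed.

Lemma sqcnormD u v : sqcnorm (u + v) = sqcnorm u + 2 * Re (cdot u v) + sqcnorm v.
Proof.
rewrite !sqcnormE !(cdotDl, cdotDr) !ReD (Re_cdotC v u); ring.
Qed.

Lemma sqcnormN u : sqcnorm (- u) = sqcnorm u.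
Proof. by apply: eq_bigr => j _; rewrite mxE normcN. Qed.

Lemma sqcnormB u v : sqcnorm (u - v) = sqcnorm u - 2 * Re (cdot u v) + sqcnorm v.
Proof. by rewrite sqcnormD sqcnormN cdotNr ReN mulrN. Qed.

Lemma sqcnormZ c u : sqcnorm (c *: u) = normc c ^+ 2 * sqcnorm u.
Proof.
by rewrite /sqcnorm mulr_sumr; apply: eq_bigr => j _; rewrite mxE normcM exprMn.
Qed.

Lemma sqcnorm_cnorm u : sqcnorm u = cnorm u ^+ 2.
Proof. by rewrite /cnorm sqr_sqrtr// sqcnorm_ge0. Qed.

Lemma cmeas_cdot d (T : measurableType d) (f g : T -> Cn) :
  measurable_fun setT f -> measurable_fun setT g ->
  cmeas setT (fun x => cdot (f x) (g x)).
Proof.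
move=> mf mg; apply: cmeas_sum => j; apply: cmeasM.
  exact: (cmeas_comp (@cmeas_coord R n j) mf).
exact: (cmeasJ (cmeas_comp (@cmeas_coord R n j) mg)).
Qed.

Lemma measurable_CnD d (T : measurableType d) (f g : T -> Cn) :
  measurable_fun setT f -> measurable_fun setT g ->
  measurable_fun setT (fun x => f x + g x).
Proof.
move=> mf mg; apply: measurable_Cn => j.
under eq_fun do rewrite mxE.
by apply: cmeasD; [exact: (cmeas_comp (@cmeas_coord R n j) mf)
                  |exact: (cmeas_comp (@cmeas_coord R n j) mg)].
Qed.

Lemma measurable_CnZ d (T : measurableType d) (f : T -> R[i]) (g : T -> Cn) :
  cmeas setT f -> measurable_fun setT g ->
  measurable_fun setT (fun x => f x *: g x).
Proof.
move=> mf mg; apply: measurable_Cn => j.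
under eq_fun do rewrite mxE.
by apply: cmeasM => //; exact: (cmeas_comp (@cmeas_coord R n j) mg).
Qed.

End hermitian_form.

(* Cauchy-Schwarz; the hypothesis says that the discriminant of the quadratic *)
(* polynomial t^2 p - 2 t r + q is nonpositive at every point.                 *)
Lemma Rintegral_cauchy_schwarz d (T : measurableType d) (R : realType)
    (mu : {measure set T -> \bar R}) (p q r : T -> R) :
  mu.-integrable setT (EFin \o p) -> mu.-integrable setT (EFin \o q) ->
  mu.-integrable setT (EFin \o r) -> (forall x, 0 <= p x) ->
  (forall x t, 2 * t * r x <= t ^+ 2 * p x + q x) ->
  (\int[mu]_x r x) ^+ 2 <= (\int[mu]_x p x) * (\int[mu]_x q x).
Proof.
move=> ip iq ir p0 H.
set P := \int[mu]_x p x; set Q := \int[mu]_x q x; set X := \int[mu]_x r x.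
have K t : 2 * t * X <= t ^+ 2 * P + Q.
  rewrite -!RintegralZl// -RintegralD//; last exact: integrableZR.
  apply: le_Rintegral => //; first exact: integrableZR.
  under [X in integrable _ _ X]eq_fun do rewrite /= EFinD.
  by apply: integrableD => //; exact: integrableZR.
have P0 : 0 <= P by exact: Rintegral_ge0.
have Q0 : 0 <= Q by have := K 0; rewrite expr0n/= !(mulr0, mul0r) add0r.
have [PE|PN] := eqVneq P 0.
  have X0 : X = 0.
    (* If P = 0 then 2 t X <= Q for every t, which t = (Q + 1) / X refutes. *)
    apply/eqP/negPn/negP => XN; have := K ((Q + 1) / X).
    rewrite PE mulr0 add0r -mulrA divfK// => h; lra.
  by rewrite X0 expr0n/= mulr_ge0.
have Pp : 0 < P by rewrite lt_neqAle eq_sym PN.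
(* t = X / P minimizes t^2 P - 2 t X. *)
have := K (X / P); rewrite expr_div_n.
have -> : X ^+ 2 / P ^+ 2 * P = X ^+ 2 / P by field.
have -> : 2 * (X / P) * X = X ^+ 2 / P + X ^+ 2 / P by field.
by rewrite lerD2l ler_pdivrMr// mulrC.
Qed.

Section weighted_L2.
Variables (R : realType) (n : nat).
Local Notation Cn := 'rV[R[i]]_n.
Local Notation V := (volume R n).
Local Notation g := (@gaussian R n).
Implicit Types (f h : Cn -> R[i]) (z w : Cn).

Definition L2 f := cmeas setT f /\
  V.-integrable setT (fun z => (normc (f z) ^+ 2 * g z)%:E).

Definition sqn f : R := \int[V]_z (normc (f z) ^+ 2 * g z).

Definition pint f h : R[i] := cint V setT (fun z => f z * (h z)^* * (g z)%:C).

Lemma innerE f h : inner f h = pint f h. Proof. by []. Qed.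

Lemma gaussianE z : g z = pi ^- n * expR (- sqcnorm z). Proof. by []. Qed.

Lemma pin_gt0 : 0 < pi ^- n :> R.
Proof. by rewrite invr_gt0 exprn_gt0// pi_gt0. Qed.

Lemma cmeas_gaussian : cmeas setT (fun z => (g z)%:C).
Proof. by apply: cmeasR; exact: measurable_gaussian. Qed.

Lemma cmeas_weight f h : cmeas setT f -> cmeas setT h ->
  cmeas setT (fun z => f z * (h z)^* * (g z)%:C).
Proof.
by move=> mf mh; apply: cmeasM (cmeas_gaussian); apply: cmeasM => //; exact: cmeasJ.
Qed.

Lemma normc_weight f h z :
  normc (f z * (h z)^* * (g z)%:C) = normc (f z) * normc (h z) * g z.
Proof. by rewrite !normcM normcJ normcR ger0_norm// gaussian_ge0. Qed.

Lemma L2_weight_integrable f h : L2 f -> L2 h ->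
  cintegrable V setT (fun z => f z * (h z)^* * (g z)%:C).
Proof.
move=> [mf i_f] [mh i_h].
apply: (@le_cintegrable _ _ _ V setT _
  (fun z => normc (f z) ^+ 2 * g z + normc (h z) ^+ 2 * g z)) => //.
- exact: cmeas_weight.
- move=> z _; rewrite normc_weight -mulrDl ler_wpM2r ?gaussian_ge0//.
  have := normc_ge0 (f z); have := normc_ge0 (h z); nra.
- under [X in integrable _ _ X]eq_fun do rewrite /= EFinD.
  exact: integrableD.
Qed.

Lemma sqn_ge0 f : 0 <= sqn f.
Proof. by apply: Rintegral_ge0 => z _; rewrite mulr_ge0 ?sqr_ge0 ?gaussian_ge0. Qed.

Lemma pint_sqn f : pint f f = (sqn f)%:C.
Proof.
rewrite /sqn -cintR; apply: eq_cint => z _.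
by rewrite mul_conjc -rmorphM.
Qed.

Lemma normH2_sqn f : normH2 f = Num.sqrt (sqn f).
Proof. by rewrite /normH2 innerE pint_sqn. Qed.

Lemma normH2_sqr f : normH2 f ^+ 2 = sqn f.
Proof. by rewrite normH2_sqn sqr_sqrtr// sqn_ge0. Qed.

Lemma normH2_ge0 f : 0 <= normH2 f.
Proof. by rewrite normH2_sqn sqrtr_ge0. Qed.

Lemma integrable_normcM f h : L2 f -> L2 h ->
  V.-integrable setT (EFin \o (fun z => normc (f z) * normc (h z) * g z)).
Proof.
move=> Lf Lh; have [_] := L2_weight_integrable Lf Lh.
by apply: eq_integrable => // z _; rewrite normc_weight.
Qed.

Lemma Rintegral_normcM_le f h : L2 f -> L2 h ->
  \int[V]_z (normc (f z) * normc (h z) * g z) <= normH2 f * normH2 h.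
Proof.
move=> Lf Lh; rewrite -(ler_pXn2r (n := 2))//; last 2 first.
- rewrite nnegrE; apply: Rintegral_ge0 => z _.
  by apply: mulr_ge0 (gaussian_ge0 _); apply: mulr_ge0; exact: normc_ge0.
- by rewrite nnegrE mulr_ge0 ?normH2_ge0.
rewrite exprMn !normH2_sqr.
apply: Rintegral_cauchy_schwarz.
- by case: Lf.
- by case: Lh.
- exact: integrable_normcM.
- by move=> z; rewrite mulr_ge0 ?sqr_ge0 ?gaussian_ge0.
- move=> z t; move: (g z) (gaussian_ge0 z) => G G0.
  rewrite !mulrA -mulrDl ler_wpM2r// -subr_ge0.
  rewrite (_ : _ - _ = (t * normc (f z) - normc (h z)) ^+ 2) ?sqr_ge0//; ring.
Qed.

Lemma pint_cauchy_schwarz f h : L2 f -> L2 h ->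
  normc (pint f h) <= normH2 f * normH2 h.
Proof.
move=> Lf Lh; have i := L2_weight_integrable Lf Lh.
rewrite (le_trans (normc_cint_le measurableT i))//.
rewrite (le_trans _ (Rintegral_normcM_le Lf Lh))//.
by under eq_Rintegral do rewrite normc_weight.
Qed.

Lemma L2D f h : L2 f -> L2 h -> L2 (fun z => f z + h z).
Proof.
move=> [mf i_f] [mh i_h]; split; first exact: cmeasD.
have mN : measurable_fun setT (fun z => normc (f z + h z) ^+ 2 * g z).
  apply: measurable_funM; last exact: measurable_gaussian.
  by apply: measurable_funX; apply: measurable_normc; exact: cmeasD.
have i2 : V.-integrable setT (EFin \o (fun z =>
    2 * (normc (f z) ^+ 2 * g z) + 2 * (normc (h z) ^+ 2 * g z))).
  under [X in integrable _ _ X]eq_fun do rewrite /= EFinD !EFinM.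
  by apply: integrableD => //; apply: integrableZl => //.
apply: le_integrable i2 => //; first exact/measurable_EFinP.
move=> z _ /=; rewrite lee_fin !ger0_norm; last 2 first.
- by apply: addr_ge0; apply: mulr_ge0 => //; apply: mulr_ge0 (gaussian_ge0 _); exact: sqr_ge0.
- by rewrite mulr_ge0 ?sqr_ge0 ?gaussian_ge0.
move: (g z) (gaussian_ge0 z) => G G0.
rewrite (mulrA 2 (normc (f z) ^+ 2) G) (mulrA 2 (normc (h z) ^+ 2) G) -mulrDl.
by apply: ler_wpM2r => //; exact: ler_normc_sqrD.
Qed.

Lemma L2Z (c : R[i]) f : L2 f -> L2 (fun z => c * f z).
Proof.
move=> [mf i_f]; split; first by apply: cmeasM => //; exact: cmeas_cst.
under [X in integrable _ _ X]eq_fun do rewrite normcM exprMn -mulrA EFinM.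
exact: integrableZl.
Qed.

Lemma L2N f : L2 f -> L2 (fun z => - f z).
Proof.
move=> Lf; rewrite (_ : (fun _ => _) = fun z => -1 * f z); first exact: L2Z.
by apply/funext => z; rewrite mulN1r.
Qed.

Lemma L2B f h : L2 f -> L2 h -> L2 (fun z => f z - h z).
Proof. by move=> Lf Lh; apply: L2D => //; exact: L2N. Qed.

Lemma pintDl f1 f2 h : L2 f1 -> L2 f2 -> L2 h ->
  pint (fun z => f1 z + f2 z) h = pint f1 h + pint f2 h.
Proof.
move=> L1 L2' Lh; rewrite /pint -cintD//; [|exact: L2_weight_integrable..].
by apply: eq_cint => z _; rewrite !mulrDl.
Qed.

Lemma pintZl (c : R[i]) f h : L2 f -> L2 h ->
  pint (fun z => c * f z) h = c * pint f h.
Proof.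
move=> L1 Lh; rewrite /pint -cintZ//; last exact: L2_weight_integrable.
by apply: eq_cint => z _; rewrite !mulrA.
Qed.

Lemma pintC f h : L2 f -> L2 h -> pint h f = (pint f h)^*.
Proof.
move=> L1 Lh; rewrite /pint -cintJ//; last exact: L2_weight_integrable.
by apply: eq_cint => z _; rewrite !conjcM conjK conjcR [X in X * _]mulrC.
Qed.

Lemma sqintegrableP f : sqintegrable f <-> L2 f.
Proof.
have E : (\int[V]_z `|(normc (f z) ^+ 2 * g z)%:E| =
    \int[V]_z (normc (f z) ^+ 2 * g z)%:E)%E.
  by apply: eq_integral => z _; rewrite gee0_abs// lee_fin mulr_ge0 ?sqr_ge0 ?gaussian_ge0.
split=> [[mR mI foo]|[[mR mI] /integrableP[_ foo]]].
  split => //; apply/integrableP; split.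
    apply/measurable_EFinP; apply: measurable_funM; last exact: measurable_gaussian.
    by apply: measurable_funX; exact: measurable_normc.
  by rewrite E.
by split => //; rewrite -E.
Qed.

Lemma H2_L2 (f : H2 R n) : L2 f.
Proof. by case: f => f /= fP; have /asboolP[_ /sqintegrableP] := fP. Qed.

Lemma H2_entire (f : H2 R n) : entire f.
Proof. by case: f => f /= fP; have /asboolP[] := fP. Qed.

End weighted_L2.

(** * The Gaussian mean value property *)

Section indicator.
Context d (T : measurableType d) (R : realType) (mu : {measure set T -> \bar R}).

Lemma cint_mkcond (D : set T) (f : T -> R[i]) :
  cint mu D f = cint mu setT (fun x => (\1_D x)%:C * f x).
Proof.
apply: complexP; rewrite /= Rintegral_mkcond; apply: eq_Rintegral => x _.
  by rewrite patchE indicE ReM; case: ifPn => xD /=; rewrite ?mul1r !mul0r subr0.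
by rewrite patchE indicE ImM; case: ifPn => xD /=; rewrite ?mul1r !mul0r addr0.
Qed.

End indicator.

Section reproducing.
Variables (R : realType) (n : nat).
Local Notation Cn := 'rV[R[i]]_n.
Local Notation V := (volume R n).
Local Notation g := (@gaussian R n).
Local Notation mu := (@lebesgue_measure R).
Local Notation RT := (measurableTypeR R).
Implicit Types (f h : Cn -> R[i]) (z w u v : Cn).

Lemma integral_gaussian : (\int[V]_z (g z)%:E = 1)%E.
Proof.
under eq_integral do rewrite gaussianE EFinM.
rewrite ge0_integralZl//.
- by rewrite integral_gauss_pi -EFinM mulVf// gt_eqF// exprn_gt0// pi_gt0.
- apply/measurable_EFinP; have := @measurable_gauss R n 1.
  by under eq_fun do rewrite mul1r.
- by rewrite lee_fin ltW// pin_gt0.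
Qed.

Lemma integrable_gaussian : V.-integrable setT (EFin \o g).
Proof.
apply/integrableP; split; first by apply/measurable_EFinP; exact: measurable_gaussian.
under eq_integral do rewrite gee0_abs ?lee_fin ?gaussian_ge0//.
by rewrite integral_gaussian ltry.
Qed.

Lemma gaussian_rot (c : R[i]) z : normc c = 1 -> g (c *: z) = g z.
Proof. by move=> c1; rewrite !gaussianE sqcnormZ c1 expr1n mul1r. Qed.

Lemma normc_circle (t : R) : normc (cexp (0 +i* t)) = 1.
Proof. by rewrite normc_cexp expR0. Qed.

Lemma cmeas_circle : cmeas setT (fun t : RT => cexp (0 +i* t)).
Proof.
apply: cmeas_cexp => //; split => /=; [exact: measurable_cst|exact: measurable_id].
Qed.

(** Volume and Gaussian are invariant under z |-> exp(i t) z, so the integral equals its average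
    over t. By Fubini the average is taken first at fixed z, where it is the circle mean of l |-> G
    (l z), namely G 0. *)
Theorem gaussian_mean (G : Cn -> R[i]) :
  (forall z l, cdiff (fun l => G (l *: z)) l) -> cmeas setT G ->
  cintegrable V setT (fun z => G z * (g z)%:C) ->
  cint V setT (fun z => G z * (g z)%:C) = G 0.
Proof.
move=> dG mG iG; set M := cint _ _ _.
pose I : set RT := `[0, 2 * pi]%classic.
have mI : measurable I by exact: measurable_segment.
have pi2 : 0 < 2 * pi :> R by rewrite mulr_gt0// pi_gt0.
(* The indicator of [0, 2 pi] turns the average over t into an integral over the whole line, as
   Fubini on the product space requires. *)
pose F (x : RT * Cn) : R[i] :=
  (\1_I x.1)%:C * (G (cexp (0 +i* x.1) *: x.2) * (g x.2)%:C).
have m1I : cmeas setT (fun t : RT => (\1_I t)%:C : R[i]).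
  by apply: cmeasR; exact: measurable_indic.
have mrot : measurable_fun setT (fun x : RT * Cn => cexp (0 +i* x.1) *: x.2).
  apply: measurable_CnZ; last exact: measurable_snd.
  exact: (cmeas_comp cmeas_circle measurable_fst).
have mF : cmeas setT F.
  apply: cmeasM; first exact: (cmeas_comp m1I measurable_fst).
  apply: cmeasM; first exact: (cmeas_comp mG mrot).
  exact: (cmeas_comp (@cmeas_gaussian R n) measurable_snd).
have mGg : cmeas setT (fun z => G z * (g z)%:C) by case: iG.
have pr t := @mpreserving_volume_rot R n _ (normc_circle t).
have iF : cintegrable (mu \x V)%E setT F.
  apply: cintegrable_prod => //.
  pose K := \int[V]_z normc (G z * (g z)%:C).
  have KE : (\int[V]_z (normc (G z * (g z)%:C))%:E = K%:E)%E.
    by rewrite /K /Rintegral fineK//; case: iG => _; exact: integrable_fin_num.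
  (* For each t the rotation is undone under the integral sign, so the inner integral of the modulus
     is the same constant K. *)
  apply: (@le_lt_trans _ _ (\int[mu]_t ((\1_I t)%:E * K%:E))%E).
    rewrite le_eqVlt; apply/orP; left; apply/eqP; apply: eq_integral => t _.
    rewrite -KE -ge0_integralZl//; last 2 first.
    - by apply/measurable_EFinP; exact: measurable_normc.
    - by move=> z _; rewrite lee_fin normc_ge0.
    have := ge0_integral_mpreserving (pr t)
      (f := fun z => ((\1_I t)%:E * (normc (G z * (g z)%:C))%:E)%E).
    move=> <-; last 2 first.
    - apply/measurable_EFinP; apply: measurable_funM => //; exact: measurable_normc.
    - by move=> z; rewrite mule_ge0 ?lee_fin ?normc_ge0.
    apply: eq_integral => z _; rewrite /F/= gaussian_rot ?normc_circle//.
    by rewrite normcM normcR ger0_norm// ?EFinM.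
  rewrite ge0_integralZr//; last 2 first.
  - by apply/measurable_EFinP; exact: measurable_indic.
  - by rewrite -KE; apply: integral_ge0 => z _; rewrite lee_fin normc_ge0.
  have muI : mu I = (2 * pi)%:E.
    by rewrite /I lebesgue_measure_itv/= lte_fin pi2 oppr0 adde0.
  have -> : (\int[mu]_x (\1_I x)%:E = (2 * pi)%:E)%E.
    by rewrite integral_indic// setIT; exact: muI.
  by rewrite -EFinM ltry.
have [F1 F2] := cint_fubini iF.
have E1 : cint mu setT (fun t => cint V setT (fun z => F (t, z))) =
    (2 * pi)%:C * M.
  rewrite -[X in X%:C]subr0 -(seg_cst M (ltW pi2)) /seg [RHS]cint_mkcond.
  apply: eq_cint => t _; rewrite /F/= cintZ//.
    congr (_ * _); rewrite /M -(cint_mpreserving (pr t) mGg).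
    by apply: eq_cint => z _; rewrite gaussian_rot// normc_circle.
  split; first exact: (cmeasM (cmeas_comp mG (pr t).1) (@cmeas_gaussian R n)).
  have := integrable_mpreserving (pr t) iG.2.
  by apply: eq_integrable => // z _; rewrite gaussian_rot// normc_circle.
have E2 z : cint mu setT (fun t => F (t, z)) = ((2 * pi)%:C * G 0) * (g z)%:C.
  rewrite /F/= -cint_mkcond -[G 0](congr1 G (scale0r z)).
  have := circle_mean (f := fun l => G (l *: z)) (dG z) => <-.
  rewrite [RHS]mulrC -cintZ//; last first.
    apply: fcont_integrable; apply: (@ccont_imag_line R ((fun l => G (l *: z)) \o @cexp R) 0).
    move=> w; apply: cdiff_ccont; apply: cdiff_comp; [exact: cdiff_cexp|exact: dG].
  by apply: eq_cint => t _; rewrite mulrC.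
have E3 : cint V setT (fun z => cint mu setT (fun t => F (t, z))) = (2 * pi)%:C * G 0.
  transitivity (cint V setT (fun z => ((2 * pi)%:C * G 0) * (g z)%:C)).
    by apply: eq_cint => z _; exact: E2.
  rewrite cintZ//; last by apply: cintegrableR => //; exact: integrable_gaussian.
  by rewrite cintR /Rintegral integral_gaussian mulr1.
move: F1; rewrite E1 -F2 E3 => /mulfI; apply.
by rewrite eq_complex/= negb_and gt_eqF.
Qed.

End reproducing.

(** * The reproducing kernel and the Bergman projection *)

Section fock_space.
Variables (R : realType) (n : nat).
Local Notation Cn := 'rV[R[i]]_n.
Local Notation V := (volume R n).
Local Notation g := (@gaussian R n).
Implicit Types (f h : Cn -> R[i]) (z w u v : Cn).

(** This norm bounds the linear forms <w, z> by the sup norm of w, and exp(c [l1norm] z) is compared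
    with the Gaussian one coordinate at a time. *)
Definition l1norm z : R := \sum_j normc (z 0 j).

Lemma l1norm_ge0 z : 0 <= l1norm z.
Proof. by apply: sumr_ge0 => j _; exact: normc_ge0. Qed.

Lemma measurable_l1norm : measurable_fun setT l1norm.
Proof. by apply: measurable_sum => j; apply: measurable_normc; exact: cmeas_coord. Qed.

Lemma supnorm_coord z j : normc (z 0 j) <= Re `|z|.
Proof.
rewrite -lecR -normcE RRe_real ?normr_real//.
rewrite [leRHS]/Num.norm/= mx_normE -[leLHS]nngE num_le.
exact: (le_bigmax _ (fun i : 'I_1 * 'I_n => `|z i.1 i.2|%:nng%R) (0, j)).
Qed.

Lemma supnorm_ge0 z : 0 <= Re `|z|.
Proof. by rewrite -lecR RRe_real ?normr_real//; exact: normr_ge0. Qed.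

Lemma normc_cdot_l1 w z : normc (cdot w z) <= Re `|w| * l1norm z.
Proof.
rewrite /cdot (le_trans (normc_sum _ _ _))// /l1norm mulr_sumr.
apply: ler_sum => j _; rewrite normcM normcJ ler_wpM2r ?normc_ge0//.
exact: supnorm_coord.
Qed.

(** In each coordinate c x <= c^2 / 2 + x^2 / 2. *)
Lemma l1norm_le (c : R) z : c * l1norm z <= n%:R * c ^+ 2 / 2 + sqcnorm z / 2.
Proof.
rewrite /l1norm /sqcnorm mulr_sumr -mulrA mulr_natl.
have -> : c ^+ 2 / 2 *+ n = \sum_(j < n) c ^+ 2 / 2.
  by rewrite sumr_const card_ord.
rewrite mulr_suml -big_split/=; apply: ler_sum => j _.
have : 0 <= (c - normc (z 0 j)) ^+ 2 by exact: sqr_ge0.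
move: (normc _) => x; lra.
Qed.

(** After squaring, exp(2 c [l1norm] z) is absorbed by half of the Gaussian exponent, by [l1norm_le]
    at 2 c; the other half remains integrable. *)
Lemma L2_exp_growth f (A c : R) : cmeas setT f ->
  (forall z, normc (f z) <= A * expR (c * l1norm z)) -> L2 f.
Proof.
move=> mf fA; split => //.
pose K := A ^+ 2 * (pi ^- n * expR (n%:R * (2 * c) ^+ 2 / 2)).
have iK : V.-integrable setT (EFin \o (fun z : Cn => K * expR (- (2^-1 * sqcnorm z)))).
  by apply: integrableZR => //; apply: integrable_gauss; rewrite invr_gt0.
apply: le_integrable iK => //.
  apply/measurable_EFinP; apply: measurable_funM; last exact: measurable_gaussian.
  by apply: measurable_funX; exact: measurable_normc.
move=> z _ /=; have A0 := fA z.
rewrite lee_fin !ger0_norm; last 2 first.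
- by rewrite /K; apply: mulr_ge0 (expR_ge0 _); apply: mulr_ge0; [exact: sqr_ge0|
    apply: mulr_ge0 (expR_ge0 _); exact/ltW/pin_gt0].
- by rewrite mulr_ge0 ?sqr_ge0 ?gaussian_ge0.
have fA2 : normc (f z) ^+ 2 <= A ^+ 2 * expR (2 * c * l1norm z).
  have -> : expR (2 * c * l1norm z) = expR (c * l1norm z) ^+ 2.
    by rewrite -expRM_natl; congr expR; rewrite mulrA.
  by rewrite -exprMn ler_pXn2r// nnegrE ?normc_ge0// (le_trans (normc_ge0 _) A0).
rewrite (le_trans (ler_wpM2r (gaussian_ge0 z) fA2))// /K -[leLHS]mulrA -[leRHS]mulrA.
rewrite ler_wpM2l ?sqr_ge0// gaussianE -[leRHS]mulrA [leLHS]mulrCA.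
rewrite ler_wpM2l ?(ltW (pin_gt0 _ _))// -!expRD ler_expR.
have := l1norm_le (2 * c) z; lra.
Qed.

Lemma L2J f : L2 f -> L2 (fun z => (f z)^*).
Proof.
move=> [mf i_f]; split; first exact: cmeasJ.
by under [X in integrable _ _ X]eq_fun do rewrite normcJ.
Qed.

Lemma L2M_integrable f h : L2 f -> L2 h ->
  cintegrable V setT (fun z => f z * h z * (g z)%:C).
Proof.
move=> Lf Lh; have := L2_weight_integrable Lf (L2J Lh).
by under [X in cintegrable _ _ X]eq_fun do rewrite conjK.
Qed.

Lemma cmeas_cdotr w : cmeas setT (fun z => cdot w z).
Proof. by apply: cmeas_cdot; [exact: measurable_cst|exact: measurable_id]. Qed.

Lemma cmeas_cdotl w : cmeas setT (fun z => cdot z w).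
Proof. by apply: cmeas_cdot; [exact: measurable_id|exact: measurable_cst]. Qed.

Lemma L2_cexp_cdot w : L2 (fun z => cexp (cdot w z)).
Proof.
apply: (@L2_exp_growth _ 1 (Re `|w|)).
  by apply: cmeas_cexp => //; exact: cmeas_cdotr.
move=> z; rewrite normc_cexp mul1r ler_expR (le_trans (ler_norm _))//.
by rewrite (le_trans (ler_Re_normc _))//
    normc_cdot_l1.
Qed.

Lemma nkernelJ w z : (nkernel w z)^* = cexp (cdot w z) * (expR (- (sqcnorm w / 2)))%:C.
Proof. by rewrite /nkernel conjcM conjc_cexp cdotJ conjcR. Qed.

Lemma L2_nkernel w : L2 (nkernel w).
Proof.
have := L2J (L2Z (expR (- (sqcnorm w / 2)))%:C (L2_cexp_cdot w)).
congr (L2 _); apply/funext => z; rewrite conjcM conjcR conjc_cexp cdotJ mulrC.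
by [].
Qed.

(* The orthogonal projection of L^2 onto the Fock space, in integral form. *)
Definition bergman f w : R[i] := cint V setT (fun z => f z * cexp (cdot w z) * (g z)%:C).

Lemma pint_nkernel f w : L2 f ->
  pint f (nkernel w) = bergman f w * (expR (- (sqcnorm w / 2)))%:C.
Proof.
move=> Lf; rewrite /bergman mulrC -cintZ//; last exact/L2M_integrable/L2_cexp_cdot.
by apply: eq_cint => z _; rewrite nkernelJ; ring.
Qed.

Lemma normc_nkernel_weight w z :
  normc (nkernel w z) ^+ 2 * g z = pi ^- n * expR (- sqcnorm (z - w)).
Proof.
rewrite /nkernel normcM normcR normc_cexp ger0_norm ?expR_ge0// exprMn gaussianE.
rewrite -!expRM_natl mulrCA -!expRD; congr (_ * expR _).
by rewrite sqcnormB; field.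
Qed.

Lemma sqn_nkernel w : sqn (nkernel w) = 1.
Proof.
rewrite /sqn; under eq_Rintegral do rewrite normc_nkernel_weight.
have pr := mpreserving_volumeD (- w).
rewrite /Rintegral (integral_mpreserving pr (f := g)); last exact: measurable_gaussian.
by rewrite integral_gaussian.
Qed.

Lemma normH2_nkernel w : normH2 (nkernel w) = 1.
Proof. by rewrite normH2_sqn sqn_nkernel sqrtr1. Qed.

(** Enough for the mean value property, and checked directly for [nkernel], whose differentiability
    as a function on C^n then follows from [bergman_entire]. *)
Definition line_holomorphic f := forall a z l, cdiff (fun l => f (a + l *: z)) l.

Lemma cdiffM (p q : R[i] -> R[i]) l : cdiff p l -> cdiff q l ->
  cdiff (fun l => p l * q l) l.
Proof.
move=> dp dq; have cq := cdiff_ccont dq.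
move: dp dq => [P dp] [Q dq]; exists (P * q l + p l * Q) => e e0.
(* A bounds the factor that accompanies each small term, |q (l + h)| included once |h| < d4; each of
   the three terms then costs e1 * A = e / 3 times |h|. *)
pose A := 1 + normc (p l) + normc P + normc (q l).
have A0 : 0 < A.
  have := normc_ge0 (p l); have := normc_ge0 P; have := normc_ge0 (q l).
  by rewrite /A => *; lra.
have A1 : normc (p l) <= A /\ normc P <= A /\ normc (q l) + 1 <= A.
  rewrite /A; have := normc_ge0 (p l); have := normc_ge0 P; have := normc_ge0 (q l).
  by move=> *; lra.
pose e1 := e / (3 * A).
have e10 : 0 < e1 by rewrite divr_gt0// mulr_gt0.
have [d1 d10 h1] := dp _ e10; have [d2 d20 h2] := dq _ e10.
have [d3 d30 h3] := cq _ (Order.POrderTheory.lt_le_trans e10 (lexx e1)).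
have [d4 d40 h4] := cq _ ltr01.
exists (Num.min (Num.min d1 d2) (Num.min d3 d4)); first by rewrite !lt_min d10 d20 d30.
move=> h; rewrite !lt_min => /andP[/andP[hd1 hd2] /andP[hd3 hd4]].
have -> : p (l + h) * q (l + h) - p l * q l - (P * q l + p l * Q) * h =
   (p (l + h) - p l - P * h) * q (l + h) + p l * (q (l + h) - q l - Q * h)
   + P * h * (q (l + h) - q l) by ring.
have N0 := normc_ge0 h.
have qb : normc (q (l + h)) <= A.
  have -> : q (l + h) = (q (l + h) - q l) + q l by rewrite subrK.
  rewrite (le_trans (normcD _ _))// (le_trans _ A1.2.2)// addrC lerD2l.
  exact: h4.
have eA : e1 * A = e / 3 by rewrite /e1; field; rewrite gt_eqF.
have B1 : normc ((p (l + h) - p l - P * h) * q (l + h)) <= e / 3 * normc h.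
  rewrite normcM -eA mulrAC; apply: ler_pM => //; rewrite ?normc_ge0//; exact: h1.
have B2 : normc (p l * (q (l + h) - q l - Q * h)) <= e / 3 * normc h.
  rewrite normcM -eA [e1 * A]mulrC -mulrA; apply: ler_pM; rewrite ?normc_ge0//.
    by case: A1.
  exact: h2.
have B3 : normc (P * h * (q (l + h) - q l)) <= e / 3 * normc h.
  rewrite normcM normcM -eA mulrAC [e1 * A]mulrC ler_wpM2r//.
  apply: ler_pM; rewrite ?normc_ge0//; [by case: A1 => _ []|exact: h3].
rewrite (le_trans (normcD _ _))// (le_trans (lerD (normcD _ _) (lexx _)))//.
have -> : e * normc h = e / 3 * normc h + e / 3 * normc h + e / 3 * normc h by field.
by rewrite !lerD.
Qed.

Lemma cdiff_linear (a b : R[i]) l : cdiff (fun l => a + l * b) l.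
Proof.
exists b => e e0; exists 1 => // h _.
rewrite (_ : _ - _ = 0) ?ComplexField.Normc.normc0 ?mulr_ge0 ?normc_ge0 ?ltW//; ring.
Qed.

Lemma cdiff_cexp_linear (a b : R[i]) l : cdiff (fun l => cexp (a + l * b)) l.
Proof. by apply: (cdiff_comp (g := @cexp R)); [exact: cdiff_linear|exact: cdiff_cexp]. Qed.

(* The mean value property at 0 of zeta |-> f (zeta + w) exp(-<zeta, w>). *)
Theorem bergman_line_holomorphic f w : line_holomorphic f -> L2 f -> bergman f w = f w.
Proof.
move=> df Lf.
pose G z := f (w + z) * cexp (- cdot z w).
pose H z := f z * cexp (cdot w z) * (g z)%:C.
(* Completing the square: |z + w|^2 - <w, z + w> = |z|^2 + <z, w>. *)
have GH z : G z * (g z)%:C = H (z + w).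
  have gE u : (g u)%:C = (pi ^- n)%:C * cexp (- sqcnorm u)%:C.
    by rewrite gaussianE rmorphM cexpR.
  rewrite /G /H [z + w]addrC -[LHS]mulrA -[RHS]mulrA; congr (_ * _).
  rewrite !gE [LHS]mulrCA [RHS]mulrCA; congr (_ * _).
  rewrite -!cexpD; congr cexp.
  rewrite cdotDr cdot_sqcnorm -(cdotJ z w) sqcnormD.
  by apply: complexP; rewrite !(ReD, ImD, ReN, ImN, ReJ, ImJ)/=
    ?(Re_cdotC w z) ?(Im_cdotC w z); ring.
have iH : cintegrable V setT H by exact/L2M_integrable/L2_cexp_cdot.
have pr := mpreserving_volumeD w.
have mG : cmeas setT G.
  apply: cmeasM.
    by apply: (cmeas_comp Lf.1); apply: measurable_CnD => //; exact: measurable_id.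
  by apply: cmeas_cexp => //; apply: cmeasN; exact: cmeas_cdotl.
have iG : cintegrable V setT (fun z => G z * (g z)%:C).
  split; first by apply: cmeasM => //; exact: cmeas_gaussian.
  have := integrable_mpreserving pr iH.2.
  by apply: eq_integrable => // z _; rewrite -GH.
have -> : bergman f w = cint V setT (fun z => G z * (g z)%:C).
  rewrite /bergman -(cint_mpreserving pr iH.1).
  by apply: eq_cint => z _; rewrite -GH.
rewrite gaussian_mean//; last first.
  move=> z l; apply: cdiffM; first exact: df.
  rewrite (_ : (fun l => cexp _) = fun l => cexp (0 + l * - cdot z w)).
    exact: cdiff_cexp_linear.
  by apply/funext => k; rewrite cdotZl add0r mulrN.
by rewrite /G addr0 (_ : cdot 0 w = 0) ?oppr0 ?cexp0 ?mulr1// -cdotJ cdot0r rmorph0.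
Qed.

(** The function of z that dominates the quadratic remainder in [bergman_entire]. The 3 in the
    exponent comes from s^2 exp s <= exp(3 s). *)
Lemma L2_remainder w : L2 (fun z : Cn =>
  (4 * l1norm z ^+ 2 * expR (l1norm z) * expR (Re `|w| * l1norm z))%:C).
Proof.
apply: (@L2_exp_growth _ 4 (3 + Re `|w|)).
  apply: cmeasR; have m := measurable_l1norm.
  apply: measurable_funM; last first.
    by apply: measurableT_comp => //; apply: measurable_funM => //; exact: measurable_cst.
  apply: measurable_funM; last exact: measurableT_comp.
  by apply: measurable_funM; [exact: measurable_cst|exact: measurable_funX].
move=> z; have s0 := l1norm_ge0 z; rewrite normcR ger0_norm; last first.
  by rewrite !mulr_ge0 ?expR_ge0.
have -> : (3 + Re `|w|) * l1norm z =
  l1norm z + l1norm z + l1norm z + Re `|w| * l1norm z by ring.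
rewrite !expRD -!mulrA ler_wpM2l//.
have s1 : l1norm z <= expR (l1norm z) by have := expR_ge1Dx (l1norm z); lra.
apply: ler_pM => //.
  by rewrite !mulr_ge0 ?expR_ge0.
by apply: ler_pM => //; rewrite !mulr_ge0 ?expR_ge0.
Qed.

(** The exponential exp<w, z> is expanded to first order in w; its remainder is at most |h|^2 times
    a function of z in L^2, which Cauchy-Schwarz pairs with f. *)
Theorem bergman_entire f : L2 f -> entire (bergman f).
Proof.
move=> Lf; apply: entire_of_expansion => a.
(* The partial derivatives at a: differentiating exp<w, z> in the j-th coordinate of w brings down
   the conjugate of z_j. *)
pose c j := cint V setT (fun z => f z * ((z 0 j)^* * cexp (cdot a z)) * (g z)%:C).
pose m z : R := 4 * l1norm z ^+ 2 * expR (l1norm z) * expR (Re `|a| * l1norm z).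
have Lm : L2 (fun z => (m z)%:C) by exact: L2_remainder.
exists c, (\int[V]_z (normc (f z) * m z * g z)) => h h1.
have hR : Re `|h| <= 1 by rewrite -lecR RRe_real ?normr_real.
have h0 := supnorm_ge0 h.
have Lj j : L2 (fun z => (z 0 j)^* * cexp (cdot a z)).
  apply: (@L2_exp_growth _ 1 (1 + Re `|a|)).
    apply: cmeasM; first exact/cmeasJ/cmeas_coord.
    by apply: cmeas_cexp => //; exact: cmeas_cdotr.
  move=> z; rewrite mul1r normcM normcJ mulrDl mul1r expRD.
  apply: ler_pM; rewrite ?normc_ge0//.
    have : normc (z 0 j) <= l1norm z.
      rewrite /l1norm (bigD1 j)//= lerDl sumr_ge0// => i _; exact: normc_ge0.
    by have := expR_ge1Dx (l1norm z); lra.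
  by rewrite normc_cexp ler_expR (le_trans (ler_norm _))// (le_trans (ler_Re_normc _))//
    normc_cdot_l1.
have ij j : cintegrable V setT (fun z => f z * ((z 0 j)^* * cexp (cdot a z)) * (g z)%:C).
  exact: L2M_integrable.
have ihj j : cintegrable V setT
    (fun z => h 0 j * (f z * ((z 0 j)^* * cexp (cdot a z)) * (g z)%:C)).
  exact: cintegrableZ.
have [iS ES] := cint_sum (index_enum 'I_n) measurableT ihj.
have -> : \sum_j h 0 j * c j = cint V setT (fun z => \sum_j h 0 j *
    (f z * ((z 0 j)^* * cexp (cdot a z)) * (g z)%:C)).
  by rewrite ES; apply: eq_bigr => j _; rewrite /c cintZ.
have iB w : cintegrable V setT (fun z => f z * cexp (cdot w z) * (g z)%:C).
  exact/L2M_integrable/L2_cexp_cdot.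
rewrite /bergman -cintB// -cintB//; last exact: cintegrableB.
have iD : cintegrable V setT (fun z => f z * cexp (cdot (h + a) z) * (g z)%:C -
    f z * cexp (cdot a z) * (g z)%:C - \sum_j h 0 j *
    (f z * ((z 0 j)^* * cexp (cdot a z)) * (g z)%:C)).
  by apply: cintegrableB => //; exact: cintegrableB.
rewrite (le_trans (normc_cint_le measurableT iD))// mulrC.
have iM : V.-integrable setT (EFin \o (fun z => normc (f z) * m z * g z)).
  have := integrable_normcM Lf Lm; apply: eq_integrable => // z _ /=.
  by rewrite normcR ger0_norm// /m !mulr_ge0 ?expR_ge0 ?sqr_ge0 ?l1norm_ge0.
rewrite -RintegralZl//; apply: le_Rintegral => //.
- by case: iD.
- exact: integrableZR.
move=> z _.
have -> : f z * cexp (cdot (h + a) z) * (g z)%:C - f z * cexp (cdot a z) * (g z)%:C -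
    (\sum_j h 0 j * (f z * ((z 0 j)^* * cexp (cdot a z)) * (g z)%:C)) =
    f z * (g z)%:C * cexp (cdot a z) * (cexp (cdot h z) - 1 - cdot h z).
  have -> : \sum_j h 0 j * (f z * ((z 0 j)^* * cexp (cdot a z)) * (g z)%:C) =
      cdot h z * (f z * (g z)%:C * cexp (cdot a z)).
    by rewrite /cdot mulr_suml; apply: eq_bigr => j _; ring.
  by rewrite cdotDl cexpD; ring.
rewrite (normcM (f z * (g z)%:C * cexp (cdot a z))) (normcM (f z * (g z)%:C)).
rewrite (normcM (f z)) normcR (ger0_norm (gaussian_ge0 z)).
have s0 := l1norm_ge0 z.
have e1 : normc (cexp (cdot a z)) <= expR (Re `|a| * l1norm z).
  by rewrite normc_cexp ler_expR (le_trans (ler_norm _))// (le_trans (ler_Re_normc _))//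
    normc_cdot_l1.
have hs := normc_cdot_l1 h z.
have e2 : normc (cexp (cdot h z) - 1 - cdot h z) <=
    Re `|h| ^+ 2 * (4 * l1norm z ^+ 2 * expR (l1norm z)).
  rewrite (le_trans (cexp_bound _))//.
  have -> : Re `|h| ^+ 2 * (4 * l1norm z ^+ 2 * expR (l1norm z)) =
    4 * (Re `|h| * l1norm z) ^+ 2 * expR (l1norm z) by ring.
  apply: ler_pM; [by apply: mulr_ge0 => //; exact: sqr_ge0|exact: expR_ge0| |].
    apply: ler_wpM2l => //; rewrite ler_pXn2r// nnegrE ?normc_ge0//; exact: mulr_ge0.
  by rewrite ler_expR (le_trans hs)// ler_piMl.
have -> : Re `|h| ^+ 2 * (normc (f z) * m z * g z) =
   normc (f z) * g z * expR (Re `|a| * l1norm z) *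
   (Re `|h| ^+ 2 * (4 * l1norm z ^+ 2 * expR (l1norm z))) by rewrite /m; ring.
have fg : 0 <= normc (f z) * g z by apply: mulr_ge0 (gaussian_ge0 _); exact: normc_ge0.
apply: ler_pM; rewrite ?normc_ge0//.
  by rewrite mulr_ge0 ?normc_ge0.
by rewrite ler_wpM2l.
Qed.

Lemma line_holomorphic_nkernel w : line_holomorphic (nkernel w).
Proof.
move=> a z l; apply: cdiffM; last first.
  by exists 0 => e e0; exists 1 => // h _; rewrite subrr mul0r subr0
    ComplexField.Normc.normc0 mulr_ge0 ?normc_ge0 ?ltW.
rewrite (_ : (fun l => cexp _) = fun l => cexp (cdot a w + l * cdot z w)).
  exact: cdiff_cexp_linear.
by apply/funext => k; rewrite cdotDl cdotZl.
Qed.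

(** The membership test used for the kernels, for [ext f] and for pointwise limits of bounded
    sequences. *)
Lemma fock_bergman f : L2 f -> (forall w, bergman f w = f w) -> f \in @fock R n.
Proof.
move=> Lf Ef; apply/asboolP; split; last exact/sqintegrableP.
have -> : f = bergman f by apply/funext => w; rewrite Ef.
exact: bergman_entire.
Qed.

Lemma nkernel_fock w : nkernel w \in @fock R n.
Proof.
apply: fock_bergman; first exact: L2_nkernel.
by move=> z; apply: bergman_line_holomorphic; [exact: line_holomorphic_nkernel|exact: L2_nkernel].
Qed.

Definition kH2 w : H2 R n := MkH2 (nkernel_fock w).

Lemma H2_bergman (f : H2 R n) w : bergman f w = f w.
Proof.
apply: bergman_line_holomorphic; last exact: H2_L2.
by move=> a z l; apply: entire_line; exact: H2_entire.
Qed.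

Lemma H2_reproducing (f : H2 R n) w :
  pint f (nkernel w) = f w * (expR (- (sqcnorm w / 2)))%:C.
Proof. by rewrite pint_nkernel ?H2_bergman//; exact: H2_L2. Qed.

Lemma H2_pointwise_le (f : H2 R n) w :
  normc (f w) * expR (- (sqcnorm w / 2)) <= normH2 f.
Proof.
have := pint_cauchy_schwarz (H2_L2 f) (L2_nkernel w).
by rewrite H2_reproducing normcM normcR ger0_norm ?expR_ge0// normH2_nkernel mulr1.
Qed.

End fock_space.

(** * Joint measurability and Schur's test *)

Section separate_to_joint.
Variables (R : realType) (n : nat).
Local Notation Cn := 'rV[R[i]]_n.
Implicit Types (z w : Cn).

Lemma supnorm_le z (e : R) : 0 <= e -> (forall j, normc (z 0 j) <= e) -> Re `|z| <= e.
Proof.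
move=> e0 ze; rewrite -lecR RRe_real ?normr_real//.
have e0' : (0 : R[i]) <= e%:C by rewrite ler0c.
have zeC j : `|z 0 j| <= e%:C by rewrite normcE lecR.
rewrite [leLHS]/Num.norm/= mx_normE.
move: (e%:C) e0' zeC => E E0; case/nonnegP: E0 => {}E zeC.
rewrite num_le; apply/bigmax_leP; split=> [|[i j] _ /=]; first by rewrite -num_le/=.
by rewrite -num_le/= (ord1 i).
Qed.

Lemma entire_cvg (f : Cn -> R[i]^o) (u : nat -> Cn) z : entire f ->
  Re `|u k - z| @[k --> \oo] --> (0 : R) ->
  normc (f (u k) - f z) @[k --> \oo] --> (0 : R).
Proof.
move=> df uz; have cf := differentiable_continuous (df z).
apply/cvgrPdist_lt => e e0.
have eC : 0 < e%:C :> R[i] by rewrite ltcR.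
move/cvgrPdist_lt: (cf) => /(_ _ eC) /nbhs_ballP[d /= d0 dP].
have dR : d = (Re d)%:C by rewrite RRe_real ?gtr0_real.
have Rd0 : 0 < Re d by rewrite -ltcR -dR.
move/cvgrPdist_lt: uz => /(_ _ Rd0).
apply: filterS => k; rewrite sub0r normrN ger0_norm ?supnorm_ge0// => ukd.
have /= := dP (u k).
rewrite -ball_normE/= distrC {1}dR -[X in X < _]RRe_real ?normr_real// ltcR => /(_ ukd).
by rewrite normcE ltcR sub0r normrN ger0_norm ?normc_ge0// normcB.
Qed.

(** Keys are integer vectors, so there are countably many: this makes preimages countable unions in
    [cmeas_joint] and lets [H2_subsequence] enumerate all grid points. *)
Definition grid_key (N : nat) z : 'rV[int * int]_n :=
  \row_j (Num.floor (N.+1%:R * Re (z 0 j)), Num.floor (N.+1%:R * Im (z 0 j))).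

Definition grid_point (N : nat) (k : 'rV[int * int]_n) : Cn :=
  \row_j (((k 0 j).1)%:~R / N.+1%:R +i* (((k 0 j).2)%:~R / N.+1%:R)).

Lemma measurable_grid_key N k : measurable [set z : Cn | grid_key N z = k].
Proof.
have mfl (h : Cn -> R) (a : int) : measurable_fun setT h ->
    measurable [set z | Num.floor (N.+1%:R * h z) = a].
  move=> mh; rewrite (_ : [set _ | _] =
      (fun z => N.+1%:R * h z) @^-1` `[a%:~R, (a + 1)%:~R[%classic); last first.
    apply/seteqP; split => z /=; rewrite in_itv/=.
      by move=> /eqP; rewrite floor_eq.
    by rewrite -floor_eq => /eqP.
  rewrite -[_ @^-1` _]setTI.
  have mNh : measurable_fun setT (fun z => N.+1%:R * h z).
    by apply: measurable_funM => //; exact: measurable_cst.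
  exact: (mNh measurableT _ (measurable_itv _)).
rewrite (_ : [set z | _] = \bigcap_(j in [set: 'I_n])
    ([set z : Cn | Num.floor (N.+1%:R * Re (z 0 j)) = (k 0 j).1] `&`
     [set z | Num.floor (N.+1%:R * Im (z 0 j)) = (k 0 j).2])); last first.
  apply/seteqP; split => z /=; first by move=> <- j _; rewrite mxE.
  move=> H; apply/rowP => j; rewrite mxE; have [/= -> ->] := H j I.
  by case: (k 0 j).
apply: fin_bigcap_measurable; first exact: finite_finset.
move=> j _; have [mR mI] := @cmeas_coord R n j.
by apply: measurableI; exact: mfl.
Qed.

Lemma grid_approx N z : Re `|grid_point N (grid_key N z) - z| <= 2 / N.+1%:R.
Proof.
have N0 : 0 < N.+1%:R :> R by rewrite ltr0n.
apply: supnorm_le; first by rewrite divr_ge0.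
move=> j; rewrite !mxE/= (le_trans (normc_le_ReIm _))//.
have H (x : R) : `|(Num.floor (N.+1%:R * x))%:~R / N.+1%:R - x| <= 1 / N.+1%:R.
  have -> : (Num.floor (N.+1%:R * x))%:~R / N.+1%:R - x =
      ((Num.floor (N.+1%:R * x))%:~R - N.+1%:R * x) / N.+1%:R.
    by field; rewrite gt_eqF.
  rewrite normrM (@gtr0_norm _ (_^-1)) ?invr_gt0//.
  apply: ler_wpM2r; first by rewrite invr_ge0 ltW.
  have /andP[] := floor_itv (N.+1%:R * x); rewrite intrD => f1 f2.
  by rewrite ler_norml; apply/andP; split; lra.
rewrite ReD ReN ImD ImN/= (le_trans (lerD (H _) (H _)))//.
by rewrite -mulrDl.
Qed.

(* A function that is continuous in one variable and measurable in the other  *)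
(* is a limit of jointly measurable ones: round the first variable to a grid. *)
Lemma cmeas_joint (f : Cn -> Cn -> R[i]^o) :
  (forall w, entire (f ^~ w)) -> (forall z, cmeas setT (f z)) ->
  cmeas setT (fun x : Cn * Cn => f x.1 x.2).
Proof.
move=> cf mf.
pose q N z := grid_point N (grid_key N z).
have qz z : Re `|q N z - z| @[N --> \oo] --> (0 : R).
  have h2 : (2 : R) * harmonic N @[N --> \oo] --> (0 : R).
    by rewrite -[X in _ --> X](mulr0 2); apply: cvgMr; exact: cvg_harmonic.
  apply: (squeeze_cvgr _ (cvg_cst 0) h2).
  by apply: nearW => N; rewrite supnorm_ge0 grid_approx.
have lim z w : normc (f (q N z) w - f z w) @[N --> \oo] --> (0 : R).
  by apply: (@entire_cvg (f ^~ w) (fun N => q N z)) => //; exact: qz.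
have mq (h : R[i] -> R) N : (forall z, measurable_fun setT (fun w => h (f z w))) ->
    measurable_fun setT (fun x : Cn * Cn => h (f (q N x.1) x.2)).
  move=> mh _ Y mY; rewrite setTI.
  (* On each cell of the grid the rounded function depends on the second variable alone, so the
     preimage is a countable union of measurable rectangles. *)
  rewrite (_ : _ @^-1` _ = \bigcup_k ([set z | grid_key N z = k] `*`
      ((fun w => h (f (grid_point N k) w)) @^-1` Y))); last first.
    apply/seteqP; split => [[z w] /= Yzw|[z w] [k _ [/= <- //]]].
    by exists (grid_key N z).
  apply: countable_bigcupT_measurable; first exact: countableP.
  move=> k; apply: measurableX; first exact: measurable_grid_key.
  by rewrite -[_ @^-1` _]setTI; exact: mh.
split.
  apply: (@measurable_fun_cvg _ _ _ _ (fun N (x : Cn * Cn) => Re (f (q N x.1) x.2))).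
    by move=> N; apply: mq => z; case: (mf z).
  move=> [z w] _ /=; apply/cvgrPdist_le => e e0.
  move/cvgrPdist_le: (lim z w) => /(_ _ e0).
  apply: filterS => k; rewrite sub0r normrN ger0_norm ?normc_ge0//.
  by apply: le_trans; rewrite distrC -ReN -ReD ler_Re_normc.
apply: (@measurable_fun_cvg _ _ _ _ (fun N (x : Cn * Cn) => Im (f (q N x.1) x.2))).
  by move=> N; apply: mq => z; case: (mf z).
move=> [z w] _ /=; apply/cvgrPdist_le => e e0.
move/cvgrPdist_le: (lim z w) => /(_ _ e0).
apply: filterS => k; rewrite sub0r normrN ger0_norm ?normc_ge0//.
by apply: le_trans; rewrite distrC -ImN -ImD ler_Im_normc.
Qed.

End separate_to_joint.

(** * Schur's test for nonnegative kernels *)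

Section schur_test.
Context d1 d2 (T1 : measurableType d1) (T2 : measurableType d2) (R : realType).
Variables (m1 : {sigma_finite_measure set T1 -> \bar R}).
Variables (m2 : {sigma_finite_measure set T2 -> \bar R}).
Variables (k : T1 -> T2 -> R) (C : R).
Hypothesis mk : measurable_fun setT (fun x : T1 * T2 => k x.1 x.2).
Hypothesis C0 : 0 < C.
Hypothesis k0 : forall x y, 0 <= k x y.
Hypothesis k1 : forall x, (\int[m2]_y (k x y)%:E <= C%:E)%E.
Hypothesis k2 : forall y, (\int[m1]_x (k x y)%:E <= C%:E)%E.

Let A x := \int[m2]_y k x y.

Let mk1 x : measurable_fun setT (k x).
Proof. exact: (measurableT_comp mk (measurable_pair1 x)). Qed.

Let mk2 y : measurable_fun setT (k ^~ y).
Proof. exact: (measurableT_comp mk (measurable_pair2 y)). Qed.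

Lemma schur_integrable_r x : m2.-integrable setT (EFin \o k x).
Proof.
apply/integrableP; split; first exact/measurable_EFinP.
under eq_integral do rewrite gee0_abs ?lee_fin//.
exact: (le_lt_trans (k1 x) (ltry _)).
Qed.

Lemma schur_integrable_l y : m1.-integrable setT (EFin \o k ^~ y).
Proof.
apply/integrableP; split; first exact/measurable_EFinP.
under eq_integral do rewrite gee0_abs ?lee_fin//.
exact: (le_lt_trans (k2 y) (ltry _)).
Qed.

Lemma schur_rowE x : (\int[m2]_y (k x y)%:E = (A x)%:E)%E.
Proof. by rewrite /A /Rintegral fineK//; exact: integrable_fin_num (schur_integrable_r x). Qed.

Lemma schur_row_ge0 x : 0 <= A x.
Proof. exact: Rintegral_ge0. Qed.

Lemma schur_row_le x : A x <= C.
Proof. by rewrite -lee_fin -schur_rowE. Qed.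

Lemma measurable_schur_row : measurable_fun setT A.
Proof. exact: (measurable_Rintegral_r m2 mk). Qed.

Lemma schur_weighted (p : T1 -> R) : measurable_fun setT p -> (forall x, 0 <= p x) ->
  (\int[m2]_y \int[m1]_x (p x * k x y)%:E = \int[m1]_x (p x * A x)%:E)%E.
Proof.
move=> mp p0.
have mpk : measurable_fun setT (fun x : T1 * T2 => (p x.1 * k x.1 x.2)%:E).
  apply/measurable_EFinP; apply: measurable_funM => //.
  exact: (measurableT_comp mp measurable_fst).
have pk0 (x : T1 * T2) : (0 <= (p x.1 * k x.1 x.2)%:E)%E.
  by rewrite lee_fin mulr_ge0.
rewrite -(@fubini_tonelli _ _ T1 T2 R m1 m2 _ mpk pk0)/=.
apply: eq_integral => x _.
under eq_integral do rewrite EFinM.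
rewrite ge0_integralZl//; first by rewrite schur_rowE.
- exact/measurable_EFinP.
- by move=> y _; rewrite lee_fin.
- by rewrite lee_fin.
Qed.

(** p k q <= p^2 k + q^2 k: the row bound controls the first term, the column bound the second. This
    is the absolute convergence behind the use of Fubini in [bergman_ext]. *)
Lemma schur_product_lty (p : T1 -> R) (q : T2 -> R) :
  measurable_fun setT p -> measurable_fun setT q ->
  (forall x, 0 <= p x) -> (forall y, 0 <= q y) ->
  m1.-integrable setT (fun x => (p x ^+ 2)%:E) ->
  m2.-integrable setT (fun y => (q y ^+ 2)%:E) ->
  (\int[m1]_x \int[m2]_y (p x * k x y * q y)%:E < +oo)%E.
Proof.
move=> mp mq p0 q0 ip iq.
have mpk : measurable_fun setT (fun x : T1 * T2 => p x.1 ^+ 2 * k x.1 x.2).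
  apply: measurable_funM => //; apply: measurable_funX.
  exact: (measurableT_comp mp measurable_fst).
have mqk : measurable_fun setT (fun x : T1 * T2 => q x.2 ^+ 2 * k x.1 x.2).
  apply: measurable_funM => //; apply: measurable_funX.
  exact: (measurableT_comp mq measurable_snd).
have mpkq : measurable_fun setT (fun x : T1 * T2 => p x.1 * k x.1 x.2 * q x.2).
  apply: measurable_funM; last exact: (measurableT_comp mq measurable_snd).
  by apply: measurable_funM => //; exact: (measurableT_comp mp measurable_fst).
have F (f : T1 * T2 -> R) : measurable_fun setT f -> (forall x, 0 <= f x) ->
    (\int[m1]_x \int[m2]_y (f (x, y))%:E = \int[(m1 \x m2)%E]_z (f z)%:E)%E.
  move=> mf f0; rewrite (@fubini_tonelli1 _ _ T1 T2 R m1 m2 (EFin \o f))//;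
    first exact/measurable_EFinP.
have P0 (x : T1 * T2) : 0 <= p x.1 ^+ 2 * k x.1 x.2 by rewrite mulr_ge0 ?sqr_ge0.
have Q0 (x : T1 * T2) : 0 <= q x.2 ^+ 2 * k x.1 x.2 by rewrite mulr_ge0 ?sqr_ge0.
have PQ0 (x : T1 * T2) : 0 <= p x.1 * k x.1 x.2 * q x.2 by rewrite !mulr_ge0.
rewrite (F _ mpkq PQ0).
apply: (@le_lt_trans _ _ (\int[(m1 \x m2)%E]_z
  ((p z.1 ^+ 2 * k z.1 z.2)%:E + (q z.2 ^+ 2 * k z.1 z.2)%:E))%E).
  apply: ge0_le_integral => //.
  - by move=> z _; rewrite lee_fin.
  - exact/measurable_EFinP.
  - by apply: emeasurable_funD; exact/measurable_EFinP.
  - move=> z _; rewrite -EFinD lee_fin -mulrDl mulrAC ler_wpM2r//.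
    have := p0 z.1; have := q0 z.2; nra.
rewrite ge0_integralD//; last 4 first.
- by move=> z _; rewrite lee_fin.
- exact/measurable_EFinP.
- by move=> z _; rewrite lee_fin.
- exact/measurable_EFinP.
apply: lte_add_pinfty.
  rewrite -(F _ mpk P0)/=; apply: (@le_lt_trans _ _ (\int[m1]_x (C%:E * (p x ^+ 2)%:E))%E).
    apply: ge0_le_integral => //.
    - by move=> x _; apply: integral_ge0 => y _; rewrite lee_fin (P0 (x, y)).
    - have := @measurable_fun_fubini_tonelli_F _ _ T1 T2 R m2 _ ((measurable_EFinP _ _).2 mpk).
      by apply => z; rewrite lee_fin.
    - by apply: measurable_funeM; apply/measurable_EFinP; exact: measurable_funX.
    - move=> x _; under eq_integral do rewrite EFinM.
      rewrite ge0_integralZl//; last 3 first.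
      + exact/measurable_EFinP.
      + by move=> y _; rewrite lee_fin.
      + by rewrite lee_fin sqr_ge0.
      by rewrite muleC; apply: lee_wpmul2r => //; rewrite lee_fin sqr_ge0.
  exact: (integrable_lty measurableT (integrableZl measurableT C ip)).
rewrite -(F _ mqk Q0)/= (@fubini_tonelli _ _ T1 T2 R m1 m2 _ ((measurable_EFinP _ _).2 mqk))//=.
apply: (@le_lt_trans _ _ (\int[m2]_y (C%:E * (q y ^+ 2)%:E))%E).
  apply: ge0_le_integral => //.
  - by move=> y _; apply: integral_ge0 => x _; rewrite lee_fin (Q0 (x, y)).
  - have := @measurable_fun_fubini_tonelli_G _ _ T1 T2 R m1 _ ((measurable_EFinP _ _).2 mqk).
    by apply => z; rewrite lee_fin.
  - by apply: measurable_funeM; apply/measurable_EFinP; exact: measurable_funX.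
  - move=> y _; under eq_integral do rewrite EFinM.
    rewrite ge0_integralZl//; last 3 first.
    + exact/measurable_EFinP.
    + by move=> x _; rewrite lee_fin.
    + by rewrite lee_fin sqr_ge0.
    by rewrite muleC; apply: lee_wpmul2r => //; rewrite lee_fin sqr_ge0.
exact: (integrable_lty measurableT (integrableZl measurableT C iq)).
Qed.

(* Weighted Cauchy-Schwarz in the inner integral, then Tonelli. *)
Lemma schur_test (p : T1 -> R) : measurable_fun setT p -> (forall x, 0 <= p x) ->
  m1.-integrable setT (fun x => (p x ^+ 2)%:E) ->
  (\int[m2]_y ((\int[m1]_x (p x * k x y)) ^+ 2)%:E <=
   C%:E * \int[m1]_x (p x ^+ 2 * A x)%:E)%E.
Proof.
move=> mp p0 ip.
have mpk : measurable_fun setT (fun x : T1 * T2 => p x.1 ^+ 2 * k x.1 x.2).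
  apply: measurable_funM => //; apply: measurable_funX.
  exact: (measurableT_comp mp measurable_fst).
have P0 x y : 0 <= p x ^+ 2 * k x y by rewrite mulr_ge0 ?sqr_ge0.
have mp2 : measurable_fun setT (fun x => p x ^+ 2) by exact: measurable_funX.
have mpky y : measurable_fun setT (fun x => (p x ^+ 2 * k x y)%:E).
  by apply/measurable_EFinP; exact: measurable_funM.
have mG : measurable_fun setT (fun y => \int[m1]_x (p x ^+ 2 * k x y)%:E)%E.
  have := @measurable_fun_fubini_tonelli_G _ _ T1 T2 R m1 _ ((measurable_EFinP _ _).2 mpk).
  by apply => z; rewrite lee_fin.
rewrite -schur_weighted//; last by move=> x; rewrite sqr_ge0.
rewrite -ge0_integralZl//; last 2 first.
- by move=> y _; apply: integral_ge0 => x _; rewrite lee_fin.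
- by rewrite lee_fin ltW.
apply: ge0_le_integral => //.
- by move=> y _; rewrite lee_fin sqr_ge0.
- apply/measurable_EFinP; apply: measurable_funX.
  have mpk' : measurable_fun setT (fun x : T2 * T1 => p x.2 * k x.2 x.1).
    apply: measurable_funM; first exact: (measurableT_comp mp measurable_snd).
    exact: (measurableT_comp mk (@measurable_swap _ _ T2 T1)).
  exact: (measurable_Rintegral_r m1 mpk').
- exact: measurable_funeM.
move=> y _.
(* Where the weighted inner integral diverges, the right-hand side is +oo because C > 0. *)
have [oo|fin] := eqVneq (\int[m1]_x (p x ^+ 2 * k x y)%:E)%E +oo%E.
  by rewrite oo gt0_muley ?lte_fin// leey.
have iy : m1.-integrable setT (EFin \o (fun x => p x ^+ 2 * k x y)).
  apply/integrableP; split; first exact: mpky.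
  under eq_integral do rewrite gee0_abs ?lee_fin//.
  by rewrite ltey.
have ik := schur_integrable_l y.
have ipk : m1.-integrable setT (EFin \o (fun x => p x * k x y)).
  (* p <= p^2 + 1 makes p k integrable. *)
  have i2 : m1.-integrable setT (EFin \o (fun x => p x ^+ 2 * k x y + k x y)).
    by under [X in integrable _ _ X]eq_fun do rewrite /= EFinD; exact: integrableD.
  apply: le_integrable i2 => //.
    by apply/measurable_EFinP; exact: measurable_funM.
  move=> x _ /=; rewrite lee_fin !ger0_norm ?mulr_ge0 ?addr_ge0//.
  have := p0 x; have := k0 x y; move: (p x) (k x y) => u v v0 u0.
  rewrite -{3}[v]mul1r -mulrDl ler_wpM2r//; nra.
have CS := @Rintegral_cauchy_schwarz _ _ R m1 (fun x => p x ^+ 2 * k x y) (k ^~ y)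
  (fun x => p x * k x y) iy ik ipk (P0 ^~ y).
have -> : (\int[m1]_x (p x ^+ 2 * k x y)%:E = (\int[m1]_x (p x ^+ 2 * k x y))%:E)%E.
  by rewrite /Rintegral fineK//; exact: integrable_fin_num iy.
rewrite -EFinM lee_fin (le_trans (CS _))//.
  move=> x t; rewrite -subr_ge0.
  rewrite (_ : _ - _ = (t * p x - 1) ^+ 2 * k x y); last by ring.
  by rewrite mulr_ge0 ?sqr_ge0.
rewrite mulrC ler_wpM2r//.
  by apply: Rintegral_ge0 => x _.
rewrite -lee_fin; have := k2 y; rewrite /Rintegral fineK//.
exact: integrable_fin_num ik.
Qed.

End schur_test.

(** * The bounded extension of a weakly localized operator *)

Section weighted_modulus.
Variables (R : realType) (n : nat).
Local Notation Cn := 'rV[R[i]]_n.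
Local Notation V := (volume R n).
Local Notation g := (@gaussian R n).
Local Notation e2 z := (expR (- (sqcnorm z / 2))).
Implicit Types (f h : Cn -> R[i]) (z w u v : Cn).

(** Half of the Gaussian exponent is put into the function: L^2(dmu) becomes L^2(dV) up to the
    factor pi^n, and the operator is dominated by the one with kernel pi^-n |b|, to which Schur's
    test applies. *)
Definition wmod f z : R := normc (f z) * expR (- (sqcnorm z / 2)).

Lemma wmod_ge0 f z : 0 <= wmod f z.
Proof. by apply: mulr_ge0; [exact: normc_ge0|exact: expR_ge0]. Qed.

Lemma gaussian_half z :
  g z = pi ^- n * expR (- (sqcnorm z / 2)) * expR (- (sqcnorm z / 2)).
Proof. by rewrite gaussianE -mulrA -expRD -opprD -splitr. Qed.

Lemma wmod_sqr f z : wmod f z ^+ 2 = pi ^+ n * (normc (f z) ^+ 2 * g z).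
Proof.
rewrite gaussian_half /wmod; field.
by rewrite expf_neq0// gt_eqF// pi_gt0.
Qed.

Lemma measurable_e2 : measurable_fun setT (fun z : Cn => e2 z).
Proof. by have := @measurable_gauss R n 2^-1; under eq_fun do rewrite mulrC. Qed.

Lemma measurable_wmod f : cmeas setT f -> measurable_fun setT (wmod f).
Proof.
by move=> mf; apply: measurable_funM; [exact: measurable_normc|exact: measurable_e2].
Qed.

Lemma wmod_integrable f : L2 f -> V.-integrable setT (fun z => (wmod f z ^+ 2)%:E).
Proof.
move=> [_ i_f]; under [X in integrable _ _ X]eq_fun do rewrite wmod_sqr EFinM.
exact: integrableZl.
Qed.

Lemma cmeas_e2 : cmeas setT (fun z : Cn => (e2 z)%:C).
Proof. by apply: cmeasR; exact: measurable_e2. Qed.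

Lemma cmeas_E2 : cmeas setT (fun z : Cn => (expR (sqcnorm z / 2))%:C).
Proof.
apply: cmeasR; apply: measurableT_comp => //.
by apply: measurable_funM; [exact: measurable_sqcnorm|exact: measurable_cst].
Qed.

Lemma integrable_l1_e2 (c : R) :
  V.-integrable setT (EFin \o (fun z : Cn => expR (c * l1norm z) * e2 z)).
Proof.
pose K := expR (n%:R * c ^+ 2) : R.
have iK : V.-integrable setT (EFin \o (fun z : Cn => K * expR (- (4^-1 * sqcnorm z)))).
  by apply: integrableZR => //; apply: integrable_gauss; rewrite invr_gt0.
apply: le_integrable iK => //.
  apply/measurable_EFinP; apply: measurable_funM; last exact: measurable_e2.
  apply: measurableT_comp => //; apply: measurable_funM => //.
  exact: measurable_l1norm.
move=> z _ /=; rewrite lee_fin !ger0_norm ?mulr_ge0 ?expR_ge0//.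
rewrite /K -!expRD ler_expR.
have := @l1norm_le R n (2 * c) z; rewrite exprMn; lra.
Qed.

End weighted_modulus.

(** * The extension, its Schur bound and its values in the Fock space *)

Section bounded_extension.
Variables (R : realType) (n : nat).
Local Notation Cn := 'rV[R[i]]_n.
Local Notation V := (volume R n).
Local Notation g := (@gaussian R n).
Local Notation e2 z := (expR (- (sqcnorm z / 2))).
Local Notation E2 z := (expR (sqcnorm z / 2)).
Implicit Types (f h : Cn -> R[i]) (z w u v : Cn).

Variables (B B' : {linear kspan R n -> H2 R n}) (C : R).
Hypothesis BB' : adjoint_on_span B B'.

Definition kernel_of z w : R[i] := inner (B (k_ z)) (k_ w).
Local Notation b := kernel_of.

Hypothesis C0 : 0 < C.
Hypothesis b1 : forall z, (\int[V]_w (normc (b z w))%:E <= C%:E)%E.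
Hypothesis b2 : forall w, (\int[V]_z (normc (b z w))%:E <= C%:E)%E.

Lemma kernel_ofE z w : b z w = B (k_ z) w * (e2 w)%:C.
Proof. by rewrite /b innerE H2_reproducing. Qed.

Lemma kernel_ofE' z w : b z w = (B' (k_ w) z)^* * (e2 z)%:C.
Proof.
rewrite /b BB' innerE -[LHS]conjK -pintC; [|exact: L2_nkernel|exact: H2_L2].
by rewrite H2_reproducing conjcM conjcR.
Qed.

Lemma E2e2 z : E2 z * e2 z = 1 :> R.
Proof. by rewrite -expRD subrr expR0. Qed.

Lemma E2e2C z : (E2 z)%:C * (e2 z)%:C = 1 :> R[i].
Proof. by rewrite -rmorphM E2e2. Qed.

(** Both sides are <B K_z, K_w>, with K_z = exp(|z|^2 / 2) k_z. *)
Lemma adjoint_swap z w : (B' (k_ w) z)^* * (E2 w)%:C = B (k_ z) w * (E2 z)%:C.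
Proof.
have h : (B' (k_ w) z)^* * (e2 z)%:C = B (k_ z) w * (e2 w)%:C.
  by rewrite -kernel_ofE' kernel_ofE.
have := E2e2C z; have := E2e2C w; move: h.
move: (_^*) (B _ _) (E2 z)%:C (e2 z)%:C (E2 w)%:C (e2 w)%:C => x y a c a' c' h h' h1.
by rewrite -[x]mulr1 -h1 (mulrC a) mulrA h -[RHS]mulr1 -h'; ring.
Qed.

(** The delicate variable is the parameter w of the kernel, in which linearity of [B'] gives no
    regularity. The adjoint relation settles it: at fixed z the function of w is, up to explicit
    factors, the conjugate of [B (k_ z)], which is measurable. *)
Lemma cmeas_adjoint : cmeas setT (fun x : Cn * Cn => B' (k_ x.2) x.1).
Proof.
apply: (@cmeas_joint R n (fun z w => B' (k_ w) z)).
  by move=> w; exact: H2_entire.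
move=> z.
have -> : (fun w => B' (k_ w) z) =
    fun w => (B (k_ z) w * (e2 w)%:C * (E2 z)%:C)^*.
  apply/funext => w; rewrite -kernel_ofE kernel_ofE'.
  by rewrite -mulrA (mulrC (e2 z)%:C) E2e2C mulr1 conjK.
apply: cmeasJ; apply: cmeasM; last exact: cmeas_cst.
by apply: cmeasM; [case: (H2_L2 (B (k_ z)))|exact: cmeas_e2].
Qed.

Lemma cmeas_adjoint_swap : cmeas setT (fun x : Cn * Cn => B' (k_ x.1) x.2).
Proof. exact: (cmeas_comp cmeas_adjoint (@measurable_swap _ _ Cn Cn)). Qed.

Lemma cmeas_kernel_of : cmeas setT (fun x : Cn * Cn => b x.1 x.2).
Proof.
under eq_fun do rewrite kernel_ofE'.
apply: cmeasM; first exact: (cmeasJ cmeas_adjoint).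
exact: (cmeas_comp (@cmeas_e2 R n) (@measurable_fst _ _ Cn Cn)).
Qed.

Lemma measurable_kernel_of :
  measurable_fun setT (fun x : Cn * Cn => normc (b x.1 x.2)).
Proof. exact: measurable_normc cmeas_kernel_of. Qed.

Lemma normc_adjoint z w : normc (B' (k_ w) z) = normc (b z w) * E2 z.
Proof.
rewrite kernel_ofE' normcM normcJ normcR ger0_norm ?expR_ge0//.
by rewrite -mulrA (mulrC (e2 z)) E2e2 mulr1.
Qed.

Definition ext f w : R[i] := pint f (B' (k_ w)) * (E2 w)%:C.

Lemma normc_ext_le f w : L2 f ->
  normc (ext f w) * e2 w <= pi ^- n * \int[V]_z (wmod f z * normc (b z w)).
Proof.
move=> Lf; have i := L2_weight_integrable Lf (H2_L2 (B' (k_ w))).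
rewrite /ext normcM normcR ger0_norm ?expR_ge0// -mulrA E2e2 mulr1.
rewrite (le_trans (normc_cint_le measurableT i))//.
have E z : normc (f z * (B' (k_ w) z)^* * (g z)%:C) =
    pi ^- n * (wmod f z * normc (b z w)).
  rewrite normc_weight normc_adjoint gaussian_half /wmod.
  have := E2e2 z; move: (E2 z) (e2 z) (normc _) (normc _) (pi ^- n) => a c x y p ac.
  by rewrite -[RHS]mulr1 -ac; ring.
under eq_Rintegral do rewrite E.
rewrite RintegralZl//.
have [_] := i; under [X in integrable _ _ X -> _]eq_fun do rewrite E EFinM.
move=> /(integrableZl measurableT (pi ^+ n)).
apply: eq_integrable => // z _; rewrite muleA -EFinM mulfV ?mul1r//=.
by rewrite expf_neq0// gt_eqF// pi_gt0.
Qed.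

Lemma cmeas_ext f : cmeas setT f -> cmeas setT (ext f).
Proof.
move=> mf; apply: cmeasM; last exact: cmeas_E2.
apply: (@cmeas_cint_r _ _ Cn Cn R V (fun x => f x.2 * (B' (k_ x.1) x.2)^* * (g x.2)%:C)).
have m2 := @measurable_snd _ _ Cn Cn.
apply: cmeasM; last exact: (cmeas_comp (@cmeas_gaussian R n) m2).
by apply: cmeasM; [exact: (cmeas_comp mf m2)|exact: cmeasJ cmeas_adjoint_swap].
Qed.

Let kn0 z w : 0 <= normc (b z w). Proof. exact: normc_ge0. Qed.

Definition row_mass z : R := \int[V]_w normc (b z w).

Lemma row_mass_ge0 z : 0 <= row_mass z.
Proof. exact: (schur_row_ge0 V kn0). Qed.

Lemma row_mass_le z : row_mass z <= C.
Proof.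
exact: (@schur_row_le _ _ Cn Cn R V (fun z w => normc (b z w)) C measurable_kernel_of kn0 b1).
Qed.

Lemma measurable_row_mass : measurable_fun setT row_mass.
Proof.
exact: (@measurable_schur_row _ _ Cn Cn R V (fun z w => normc (b z w)) measurable_kernel_of).
Qed.

Lemma weighted_mass_integrable f : L2 f ->
  V.-integrable setT (fun z => (normc (f z) ^+ 2 * g z * row_mass z)%:E).
Proof.
move=> [mf i_f].
have : V.-integrable setT (fun z => (C%:E * (normc (f z) ^+ 2 * g z)%:E)%E).
  exact: integrableZl.
apply: le_integrable => //.
  apply/measurable_EFinP; apply: measurable_funM measurable_row_mass.
  by apply/measurable_EFinP; exact: (measurable_int V).
move=> z _; rewrite -EFinM !abse_EFin lee_fin.
have f0 : 0 <= normc (f z) ^+ 2 * g z by rewrite mulr_ge0 ?sqr_ge0 ?gaussian_ge0.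
move: f0; move: (_ * g z) (row_mass z) (row_mass_ge0 z) (row_mass_le z) => x y y0 yC x0.
by rewrite !ger0_norm ?mulr_ge0 ?(ltW C0)// mulrC ler_wpM2r.
Qed.

(** The C is the column bound in Schur's test. Of three factors pi^-n, two from squaring
    [normc_ext_le] and one from the Gaussian, one cancels against the pi^n of [wmod_sqr]. *)
Definition ext_cst : R := (pi ^- n) ^+ 2 * C.

Lemma ext_cst_ge0 : 0 <= ext_cst.
Proof. by rewrite mulr_ge0 ?sqr_ge0 ?ltW. Qed.

Lemma L2_ext_sqn f : L2 f -> L2 (ext f) /\
  sqn (ext f) <= ext_cst * \int[V]_z (normc (f z) ^+ 2 * g z * row_mass z).
Proof.
move=> Lf; have mf := Lf.1; have mE := cmeas_ext mf.
have pn0 := pin_gt0 R n.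
have S := @schur_test _ _ Cn Cn R V V (fun z w => normc (b z w)) C
  measurable_kernel_of C0 kn0 b1 b2 _ (measurable_wmod mf) (wmod_ge0 f) (wmod_integrable Lf).
have iW := weighted_mass_integrable Lf.
have mS : measurable_fun setT (fun w => \int[V]_z (wmod f z * normc (b z w))).
  apply: (@measurable_Rintegral_r _ _ Cn Cn R V (fun x => wmod f x.2 * normc (b x.2 x.1))).
  apply: measurable_funM; first exact: (measurableT_comp (measurable_wmod mf) measurable_snd).
  exact: (measurableT_comp measurable_kernel_of (@measurable_swap _ _ Cn Cn)).
have le : (\int[V]_w (normc (ext f w) ^+ 2 * g w)%:E <=
    (ext_cst * \int[V]_z (normc (f z) ^+ 2 * g z * row_mass z))%:E)%E.
  apply: (@le_trans _ _ (((pi ^- n) ^+ 3)%:E *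
    \int[V]_w ((\int[V]_z (wmod f z * normc (b z w))) ^+ 2)%:E)%E).
    rewrite -ge0_integralZl//; last 3 first.
    - by apply/measurable_EFinP; exact: measurable_funX.
    - by move=> w _; rewrite lee_fin sqr_ge0.
    - by rewrite lee_fin exprn_ge0// ltW.
    apply: ge0_le_integral => //.
    - by move=> w _; rewrite lee_fin mulr_ge0 ?sqr_ge0 ?gaussian_ge0.
    - apply/measurable_EFinP; apply: measurable_funM; last exact: measurable_gaussian.
      by apply: measurable_funX; exact: measurable_normc.
    - by apply: measurable_funeM; apply/measurable_EFinP; exact: measurable_funX.
    move=> w _; rewrite -EFinM lee_fin.
    have := normc_ext_le w Lf; rewrite gaussian_half.
    set I := \int[V]_z _; set x := normc _; set e := e2 w => h.
    have x0 : 0 <= x * e by rewrite mulr_ge0 ?normc_ge0 ?expR_ge0.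
    rewrite (_ : x ^+ 2 * _ = pi ^- n * (x * e) ^+ 2); last by ring.
    rewrite (_ : _ ^+ 3 * _ = pi ^- n * (pi ^- n * I) ^+ 2); last by ring.
    by rewrite ler_pM2l// ler_pXn2r ?nnegrE// (le_trans x0).
  apply: le_trans (lee_wpmul2l _ S) _; first by rewrite lee_fin exprn_ge0// ltW.
  under eq_integral do rewrite wmod_sqr -mulrA EFinM.
  rewrite integralZl//.
  have -> : (\int[V]_z (normc (f z) ^+ 2 * g z * row_mass z)%:E =
      (\int[V]_z (normc (f z) ^+ 2 * g z * row_mass z))%:E)%E.
    by rewrite /Rintegral fineK//; exact: integrable_fin_num iW.
  rewrite -!EFinM lee_fin le_eqVlt; apply/orP; left; apply/eqP.
  rewrite /ext_cst; field.
  by rewrite expf_neq0// gt_eqF// pi_gt0.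
have Le : L2 (ext f).
  by apply/sqintegrableP; case: mE => mR mI; split => //; exact: le_lt_trans le (ltry _).
split => //; rewrite -lee_fin; apply: le_trans le.
by rewrite /sqn /Rintegral fineK//; exact: integrable_fin_num Le.2.
Qed.

(** With the integral over w taken first, [adjoint_swap] replaces the conjugate of B' k_w (z) by B
    k_z (w), which is reproduced by the Bergman integral at u; a second swap returns to B' k_u. *)
Lemma bergman_ext f u : L2 f -> bergman (ext f) u = ext f u.
Proof.
move=> Lf; have mf := Lf.1; have pn0 := pin_gt0 R n.
pose G (x : Cn * Cn) : R[i] :=
  f x.1 * (B' (k_ x.2) x.1)^* * (g x.1)%:C * (E2 x.2)%:C * (cexp (cdot u x.2) * (g x.2)%:C).
have mG : cmeas setT G.
  have [m1 m2] := (@measurable_fst _ _ Cn Cn, @measurable_snd _ _ Cn Cn).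
  apply: cmeasM; last first.
    apply: cmeasM; last exact: (cmeas_comp (@cmeas_gaussian R n) m2).
    exact: (cmeas_comp (L2_cexp_cdot u).1 m2).
  apply: cmeasM; last first.
    exact: (cmeas_comp (@cmeas_E2 R n) m2).
  apply: cmeasM; last exact: (cmeas_comp (@cmeas_gaussian R n) m1).
  by apply: cmeasM; [exact: (cmeas_comp mf m1)|exact: cmeasJ cmeas_adjoint].
have iG : cintegrable (V \x V)%E setT G.
  (* |G| is at most a constant times [wmod f] |b| q with both outer factors in L^2(dV), the
     situation of [schur_product_lty]. *)
  pose q := wmod (fun w => cexp (cdot u w)).
  have mq : measurable_fun setT q by exact: measurable_wmod (L2_cexp_cdot u).1.
  have q0 w : 0 <= q w by exact: wmod_ge0.
  have W0 := wmod_ge0 f.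
  have lt := @schur_product_lty _ _ Cn Cn R V V (fun z w => normc (b z w)) C
    measurable_kernel_of kn0 b1 b2 _ _ (measurable_wmod mf) mq W0 q0
    (wmod_integrable Lf) (wmod_integrable (L2_cexp_cdot u)).
  pose H (x : Cn * Cn) := wmod f x.1 * normc (b x.1 x.2) * q x.2.
  have H0 x : 0 <= H x by apply: mulr_ge0 (q0 _); apply: mulr_ge0 (W0 _) (kn0 _ _).
  have [_ iH] : cintegrable (V \x V)%E setT (fun x => (H x)%:C).
    apply: cintegrable_prod; last first.
      rewrite (eq_integral (fun z => \int[V]_w (H (z, w))%:E)%E) => [//|z _].
      by apply: eq_integral => w _; rewrite normcR ger0_norm.
    apply: cmeasR; apply: measurable_funM; last exact: (measurableT_comp mq measurable_snd).
    apply: measurable_funM measurable_kernel_of.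
    exact: (measurableT_comp (measurable_wmod mf) measurable_fst).
  apply: (@le_cintegrable _ _ _ _ _ _ (fun x => (pi ^- n) ^+ 2 * H x)) => //.
    move=> [z w] _; rewrite /G /H /q /wmod /= !normcM normcJ !normcR normc_adjoint.
    rewrite !ger0_norm ?expR_ge0 ?gaussian_ge0// !gaussian_half.
    have := E2e2 z; have := E2e2 w.
    move: (E2 z) (e2 z) (E2 w) (e2 w) (normc (f z)) (normc (b z w)) (normc _) (pi ^- n).
    move=> a c a' c' x y s p h h'.
    by rewrite -[leRHS]mulr1 -h -[leRHS]mulr1 -h' le_eqVlt; apply/orP; left; apply/eqP; ring.
  under [X in integrable _ _ X]eq_fun do rewrite /= EFinM.
  apply: integrableZl => //; move: iH.
  by under [X in integrable _ _ X -> _]eq_fun do rewrite normcR ger0_norm//.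
have iB z := L2M_integrable (H2_L2 (B (k_ z))) (L2_cexp_cdot u).
have iB' w := L2_weight_integrable Lf (H2_L2 (B' (k_ w))).
have [F1 F2] := cint_fubini iG; rewrite -F2 in F1.
have -> : bergman (ext f) u = cint V setT (fun w => cint V setT (fun z => G (z, w))).
  apply: eq_cint => w _.
  rewrite (@eq_cint _ _ _ _ _ (fun z => G (z, w)) (fun z =>
    ((E2 w)%:C * (cexp (cdot u w) * (g w)%:C)) * (f z * (B' (k_ w) z)^* * (g z)%:C))).
    rewrite (cintZ _ measurableT (iB' w)) /ext /pint.
    by move: (cint _ _ _) (E2 w)%:C (cexp _) (g w)%:C => x y x' y'; ring.
  by move=> z _; rewrite /G /=; ring.
rewrite -F1 /ext /pint mulrC -(cintZ _ measurableT (iB' u)).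
apply: eq_cint => z _.
rewrite (@eq_cint _ _ _ _ _ (fun w => G (z, w)) (fun w =>
  (f z * (g z)%:C * (E2 z)%:C) * (B (k_ z) w * cexp (cdot u w) * (g w)%:C))).
  rewrite (cintZ _ measurableT (iB z)) -[cint _ _ _]/(bergman (B (k_ z)) u) H2_bergman.
  transitivity (f z * (g z)%:C * (B (k_ z) u * (E2 z)%:C)); first by ring.
  by rewrite -adjoint_swap; ring.
move=> w _; rewrite /G /=.
transitivity (f z * (g z)%:C * ((B' (k_ w) z)^* * (E2 w)%:C) * (cexp (cdot u w) * (g w)%:C)).
  by ring.
by rewrite adjoint_swap; ring.
Qed.

Lemma ext_fock (f : H2 R n) : ext f \in @fock R n.
Proof.
have Lf := H2_L2 f.
by apply: fock_bergman => [|u]; [exact: (L2_ext_sqn Lf).1|exact: bergman_ext].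
Qed.

Definition extH2 (f : H2 R n) : H2 R n := MkH2 (ext_fock f).

Lemma extH2_linear : linear extH2.
Proof.
move=> a f h; apply: val_inj; apply/funext => w /=.
have L1 := H2_L2 (B' (k_ w)).
change (ext (fun z => a * f z + h z) w = a * ext f w + ext h w).
rewrite /ext pintDl//; [|exact: L2Z (H2_L2 f)|exact: H2_L2].
by rewrite pintZl//; [ring|exact: H2_L2].
Qed.

HB.instance Definition _ := GRing.isLinear.Build R[i] (H2 R n) (H2 R n) _ extH2 extH2_linear.

Lemma kspan_sum (s : kspan R n) :
  exists t : seq (R[i] * Cn), s = \sum_(az <- t) az.1 *: k_ az.2.
Proof.
have /asboolP[t st] := valP s; exists t; apply: val_inj.
by rewrite st; elim/big_rec2: _ => // az x y _ ->.
Qed.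

Lemma extH2_kernel z (f : H2 R n) : f = k_ z :> (Cn -> R[i]^o) -> extH2 f = B (k_ z).
Proof.
move=> fz; apply: val_inj; apply/funext => w /=; rewrite /ext fz.
rewrite -innerE -BB' -/(b z w) kernel_ofE -mulrA (mulrC (e2 w)%:C) E2e2C.
exact: mulr1.
Qed.

Lemma extH2_extends (s : kspan R n) (f : H2 R n) : f = s :> (Cn -> R[i]^o) -> extH2 f = B s.
Proof.
have [t ->] := kspan_sum s => fs.
(* The same function written as a sum in [H2] instead of [kspan]; linearity then reduces the claim
   to single kernels. *)
have -> : f = \sum_(az <- t) az.1 *: kH2 az.2.
  apply: val_inj; rewrite -[val f]/(H2val f) fs.
  elim/big_rec2: _ => // az x y _ xy.
  change (az.1 *: nkernel az.2 + (y : Cn -> R[i]^o) = az.1 *: nkernel az.2 + (x : Cn -> R[i]^o)).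
  by rewrite xy.
rewrite !linear_sum; apply: eq_bigr => az _.
by rewrite !linearZ/= (@extH2_kernel az.2).
Qed.

Lemma extH2_bounded_extension : bounded_extension B extH2.
Proof.
split; last exact: extH2_extends.
exists (Num.sqrt (ext_cst * C)) => f; have Lf := H2_L2 f.
have [_ h] := L2_ext_sqn Lf.
have D0 : 0 <= ext_cst * C by rewrite mulr_ge0 ?ext_cst_ge0// ltW.
rewrite !normH2_sqn -sqrtrM//.
apply: ler_wsqrtr; apply: le_trans h _.
rewrite -[leRHS]mulrA; apply: ler_wpM2l; first exact: ext_cst_ge0.
rewrite -RintegralZl//; last by case: Lf.
apply: le_Rintegral => //; first exact: weighted_mass_integrable.
  by apply: integrableZR => //; case: Lf.
move=> z _; rewrite mulrC ler_wpM2r ?row_mass_le//.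
by rewrite mulr_ge0 ?sqr_ge0 ?gaussian_ge0.
Qed.

End bounded_extension.

(** * A Vitali-type lemma for exponential integrals *)

Section exponential_family.
Context d (T : measurableType d) (R : realType) (mu : {measure set T -> \bar R}).
Variables (be : nat -> T -> R[i]) (l : T -> R[i]) (L rho : T -> R) (M : R).
Hypothesis mbe : forall k, cmeas setT (be k).
Hypothesis ml : cmeas setT l.
Hypothesis mrho : measurable_fun setT rho.
Hypothesis beM : forall k x, normc (be k x) <= M.
Hypothesis lL : forall x, normc (l x) <= L x.
Hypothesis rho0 : forall x, 0 <= rho x.
Hypothesis irho : forall c, 0 <= c ->
  mu.-integrable setT (EFin \o (fun x => expR (c * L x) * rho x)).

Let M0 : T -> 0 <= M. Proof. by move=> x; exact: le_trans (normc_ge0 _) (beM 0 x). Qed.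
Let L0 x : 0 <= L x. Proof. exact: le_trans (normc_ge0 _) (lL x). Qed.

Let I (g : T -> R[i]) k := cint mu setT (fun x => be k x * g x * (rho x)%:C).
Let J c := \int[mu]_x (expR (c * L x) * rho x).

(** Exponential type relative to L with explicit constants: stable under sums and products, and
    integrable against rho with a bound that does not depend on k. *)
Let domby (g : T -> R[i]) (A c : R) := [/\ cmeas setT g, 0 <= A, 0 <= c &
  forall x, normc (g x) <= A * expR (c * L x)].

Lemma expfam_integrable g A c k : domby g A c ->
  cintegrable mu setT (fun x => be k x * g x * (rho x)%:C) /\
  normc (I g k) <= M * A * J c.
Proof.
move=> [mg A0 c0 gA].
have le x : normc (be k x * g x * (rho x)%:C) <= M * A * (expR (c * L x) * rho x).
  rewrite !normcM normcR ger0_norm// mulrA ler_wpM2r// -mulrA.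
  by apply: ler_pM (gA x) => //; exact: normc_ge0.
have iM : mu.-integrable setT (EFin \o (fun x => M * A * (expR (c * L x) * rho x))).
  by apply: integrableZR => //; exact: irho.
have i : cintegrable mu setT (fun x => be k x * g x * (rho x)%:C).
  apply: (le_cintegrable measurableT _ (fun x _ => le x) iM).
  by apply: cmeasM; [exact: cmeasM|exact: cmeasR].
split => //; rewrite (le_trans (normc_cint_le measurableT i))//.
rewrite /J -RintegralZl//; last exact: irho.
by apply: le_Rintegral => //; case: i.
Qed.

Let domD g1 g2 A1 A2 c1 c2 : domby g1 A1 c1 -> domby g2 A2 c2 ->
  domby (fun x => g1 x + g2 x) (A1 + A2) (c1 + c2).
Proof.
move=> [m1 A10 c10 h1] [m2 A20 c20 h2]; split; rewrite ?addr_ge0//; first exact: cmeasD.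
move=> x; rewrite (le_trans (normcD _ _))// mulrDl lerD//.
  rewrite (le_trans (h1 x))// ler_wpM2l// ler_expR ler_wpM2r// lerDl//.
rewrite (le_trans (h2 x))// ler_wpM2l// ler_expR ler_wpM2r// lerDr//.
Qed.

Let domM g1 g2 A1 A2 c1 c2 : domby g1 A1 c1 -> domby g2 A2 c2 ->
  domby (fun x => g1 x * g2 x) (A1 * A2) (c1 + c2).
Proof.
move=> [m1 A10 c10 h1] [m2 A20 c20 h2].
split; rewrite ?addr_ge0 ?mulr_ge0//; first exact: cmeasM.
move=> x; rewrite normcM mulrDl expRD mulrACA.
by apply: ler_pM (h1 x) (h2 x); exact: normc_ge0.
Qed.

Let dom_cst a : domby (fun=> a) (normc a) 0.
Proof.
split; [exact: cmeas_cst|exact: normc_ge0|by []|].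
by move=> x; rewrite mul0r expR0 mulr1.
Qed.

Let dom_exp (t : R) : domby (fun x => cexp (t%:C * l x)) 1 `|t|.
Proof.
split => //; first by apply: cmeas_cexp => //; apply: cmeasM => //; exact: cmeas_cst.
move=> x; rewrite normc_cexp mul1r ler_expR ReM/= mul0r subr0.
rewrite (le_trans (ler_norm _))// normrM ler_wpM2l//.
by rewrite (le_trans (ler_Re_normc _)).
Qed.

Let leL (x : R) : x <= expR x.
Proof. by rewrite (le_trans _ (expR_ge1Dx x))// lerDr. Qed.

Let dom_l : domby l 1 1.
Proof. by split => // x; rewrite !mul1r (le_trans (lL x)). Qed.

(** The exponentials exp(t l), t real, are built into the class so that a derivative in t becomes
    multiplication by l without leaving it. *)
Let null (g : T -> R[i]) := (exists A c, domby g A c) /\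
  forall (t e : R), 0 < e ->
    \forall k \near \oo, normc (I (fun x => g x * cexp (t%:C * l x)) k) < e.

Let ID g1 g2 k : (exists A c, domby g1 A c) -> (exists A c, domby g2 A c) ->
  I (fun x => g1 x + g2 x) k = I g1 k + I g2 k.
Proof.
move=> [A1 [c1 h1]] [A2 [c2 h2]].
have [[i1 _] [i2 _]] := (expfam_integrable k h1, expfam_integrable k h2).
by rewrite /I -cintD//; apply: eq_cint => x _; ring.
Qed.

Let IZ a g k : (exists A c, domby g A c) -> I (fun x => a * g x) k = a * I g k.
Proof.
move=> [A [c h]]; have [i _] := expfam_integrable k h.
by rewrite /I -(cintZ _ measurableT i); apply: eq_cint => x _; ring.
Qed.

(* Difference quotients of t |-> I (g e^(tl)). *)
Let null_l g : null g -> null (fun x => l x * g x).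
Proof.
move=> [[A [c gA]] gN]; split; first by exists (1 * A), (1 + c); exact: domM.
move=> t e e0; have [_ A0 c0 gle] := gA.
(* In the exponent, c comes from g, |t| from the exponential and 3 from the remainder, as (h L)^2
   exp(h L) <= h^2 exp(3 L) for h <= 1. *)
pose K := M * (4 * A) * J (c + `|t| + 3).
(* h is fixed before k. The remainder costs h (h K) <= h e / 2 for all k, the values at t + h and t
   are eventually below h e / 8 each, and dividing by h leaves less than e. *)
pose h : R := Num.min 1 (e / (2 * (`|K| + 1))).
have K1 : 0 < 2 * (`|K| + 1) by rewrite mulr_gt0// ltr_wpDl.
have h0 : 0 < h by rewrite lt_min ltr01 divr_gt0.
have h1 : h <= 1 by rewrite ge_min lexx.
have hK : h * K <= e / 2.
  rewrite (@le_trans _ _ (h * `|K|)) ?ler_wpM2l ?ler_norm ?(ltW h0)//.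
  rewrite (@le_trans _ _ (e / (2 * (`|K| + 1)) * `|K|))//.
    by rewrite ler_wpM2r// ge_min lexx orbT.
  rewrite mulrAC ler_pdivrMr//.
  by have := normr_ge0 K; move: `|K| => k k0; nra.
have eh : 0 < h * e / 8 by rewrite divr_gt0// mulr_gt0.
have fin (X1 X2 X3 Y : R[i]) : normc X1 < h * e / 8 -> normc X2 < h * e / 8 ->
    normc X3 <= M * (h ^+ 2 * (4 * A)) * J (c + `|t| + 3) ->
    X3 = X1 + (-1) * X2 + (- h%:C) * Y -> normc Y < e.
  move=> n1 n2 n3 E.
  have n4 : normc X3 <= h * (e / 2).
    rewrite (le_trans n3)// (_ : _ * J _ = h * (h * K)); last by rewrite /K; ring.
    by apply: ler_wpM2l hK; exact: ltW.
  have : h * normc Y <= h * e / 8 + h * e / 8 + h * (e / 2).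
    have -> : h * normc Y = normc (h%:C * Y) by rewrite normcM normcR gtr0_norm.
    have -> : h%:C * Y = X1 + (- X2) + (- X3) by rewrite E; ring.
    rewrite (le_trans (normcD _ _))// normcN; apply: lerD n4.
    by rewrite (le_trans (normcD _ _))// normcN; apply: lerD; exact: ltW.
  move=> H; have : h * normc Y < h * e.
    rewrite (le_lt_trans H)//; have : 0 < h * e by rewrite mulr_gt0.
    rewrite mulrA; move: (h * e) => x x0; lra.
  by rewrite ltr_pM2l.
apply: filterS (filterI (gN (t + h) _ eh) (gN t _ eh)) => k [I1 I2].
pose r x := g x * cexp (t%:C * l x) * (cexp (h%:C * l x) - 1 - h%:C * l x).
have dE s : exists A c, domby (fun x => g x * cexp (s%:C * l x)) A c.
  by exists (A * 1), (c + `|s|); exact: domM.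
have dr : domby r (h ^+ 2 * (4 * A)) (c + `|t| + 3).
  split.
  - have [m1 _ _ _] := dom_exp t; have [m2 _ _ _] := dom_exp h; have [m3 _ _ _] := gA.
    apply: cmeasM; first exact: cmeasM.
    apply: cmeasB; first by apply: cmeasB => //; exact: cmeas_cst.
    by apply: cmeasM => //; exact: cmeas_cst.
  - by rewrite mulr_ge0 ?sqr_ge0// mulr_ge0.
  - by rewrite !addr_ge0.
  move=> x; rewrite /r (normcM (_ * _)) (normcM (g x)).
  have E1 := gle x; have [_ _ _ /(_ x) E2] := dom_exp t; rewrite mul1r in E2.
  have E3 := cexp_bound (h%:C * l x).
  have E4 : normc (h%:C * l x) <= h * L x.
    by rewrite normcM normcR gtr0_norm// ler_wpM2l// ltW.
  have E5 : normc (cexp (h%:C * l x) - 1 - h%:C * l x) <= h ^+ 2 * 4 * expR (3 * L x).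
    rewrite (le_trans E3)//.
    have -> : expR (3 * L x) = expR (L x) ^+ 2 * expR (L x).
      by rewrite -exprSr -expRM_natl.
    have E6 : normc (h%:C * l x) ^+ 2 <= h ^+ 2 * expR (L x) ^+ 2.
      rewrite -exprMn ler_pXn2r ?nnegrE ?normc_ge0 ?mulr_ge0 ?expR_ge0 ?(ltW h0)//.
      by rewrite (le_trans E4)// ler_wpM2l// ltW.
    have E7 : expR (normc (h%:C * l x)) <= expR (L x).
      by rewrite ler_expR (le_trans E4)// ler_piMl.
    rewrite [leRHS](_ : _ = (4 * (h ^+ 2 * expR (L x) ^+ 2)) * expR (L x)); last by ring.
    apply: ler_pM => //.
    - by apply: mulr_ge0 => //; exact: sqr_ge0.
    - by rewrite ler_wpM2l.
  rewrite (_ : expR ((c + _ + _) * _) = expR (c * L x) * expR (`|t| * L x) * expR (3 * L x));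
    last by rewrite -!expRD; congr expR; ring.
  rewrite [leRHS](_ : _ = (A * expR (c * L x)) * expR (`|t| * L x) *
    (h ^+ 2 * 4 * expR (3 * L x))); last by ring.
  apply: ler_pM E5; [|exact: normc_ge0|].
    by apply: mulr_ge0; exact: normc_ge0.
  by apply: ler_pM E1 E2; exact: normc_ge0.
have [_ Ir] := expfam_integrable k dr.
have E : I r k = I (fun x => g x * cexp ((t + h)%:C * l x)) k +
   (-1) * I (fun x => g x * cexp (t%:C * l x)) k +
   (- h%:C) * I (fun x => l x * g x * cexp (t%:C * l x)) k.
  have dl : exists A c, domby (fun x => l x * g x * cexp (t%:C * l x)) A c.
    by exists (1 * A * 1), (1 + c + `|t|); do 2 apply: domM => //.
  have dZ a f : (exists A c, domby f A c) -> exists A c, domby (fun x => a * f x) A c.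
    by move=> [A' [c' h']]; exists (normc a * A'), (0 + c'); exact: domM.
  have dD f1 f2 : (exists A c, domby f1 A c) -> (exists A c, domby f2 A c) ->
      exists A c, domby (fun x => f1 x + f2 x) A c.
    by move=> [A1 [c1 h1']] [A2 [c2 h2']]; exists (A1 + A2), (c1 + c2); exact: domD.
  rewrite -IZ// -IZ// -ID//; last exact: dZ.
  rewrite -ID; [|by apply: dD => //; exact: dZ|exact: dZ].
  apply: eq_cint => x _; congr (_ * _ * _).
  by rewrite /r rmorphD/= mulrDl cexpD; ring.
exact: fin I1 I2 Ir E.
Qed.

Let null_affine g a : null g -> null (fun x => (1 + a * l x) * g x).
Proof.
move=> Ng; have [[A [c gA]] gN] := Ng; have [[A' [c' gA']] gN'] := null_l Ng.
have dZ f : (exists A c, domby f A c) -> exists A c, domby (fun x => a * f x) A c.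
  by move=> [A1 [c1 h']]; exists (normc a * A1), (0 + c1); exact: domM.
have E x : (1 + a * l x) * g x = g x + a * (l x * g x) by ring.
have [A1 [c1 d1]] : exists A c, domby (fun x => a * (l x * g x)) A c.
  by apply: dZ; exists A', c'.
rewrite (funext E); split; first by exists (A + A1), (c + c1); exact: domD.
move=> t e e0.
have a0 : 0 < 2 * (normc a + 1) by rewrite mulr_gt0// ltr_wpDl// normc_ge0.
have ea : 0 < e / (2 * (normc a + 1)) by rewrite divr_gt0.
near=> k.
have I1 : normc (I (fun x => g x * cexp (t%:C * l x)) k) < e / 2.
  by near: k; apply: gN; rewrite divr_gt0.
have I2 : normc (I (fun x => l x * g x * cexp (t%:C * l x)) k) < e / (2 * (normc a + 1)).
  by near: k; exact: (gN' t _ ea).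
have -> : I (fun x => (g x + a * (l x * g x)) * cexp (t%:C * l x)) k =
    I (fun x => g x * cexp (t%:C * l x)) k + a * I (fun x => l x * g x * cexp (t%:C * l x)) k.
  have dl : exists A c, domby (fun x => l x * g x * cexp (t%:C * l x)) A c.
    by exists (A' * 1), (c' + `|t|); exact: domM.
  rewrite -IZ// -ID; [|by exists (A * 1), (c + `|t|); exact: domM|exact: dZ].
  by apply: eq_cint => x _; congr (_ * _ * _); ring.
rewrite (le_lt_trans (normcD _ _))// normcM [e]splitr ltr_leD//.
rewrite (@le_trans _ _ (normc a * (e / (2 * (normc a + 1)))))//.
  by rewrite ler_wpM2l ?normc_ge0// ltW.
rewrite mulrA ler_pdivrMr//; have := normc_ge0 a; move: (normc a) => s s0; nra.
Unshelve. all: by end_near.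
Qed.

(** Telescoping. It is used with a = exp y and b = 1 + y, both bounded by m = exp(L / (N + 1)). *)
Let normc_subX (a b : R[i]) (m : R) N : normc a <= m -> normc b <= m ->
  normc (a ^+ N.+1 - b ^+ N.+1) <= N.+1%:R * m ^+ N * normc (a - b).
Proof.
move=> am bm; have m0 : 0 <= m by exact: le_trans (normc_ge0 a) am.
elim: N => [|N IH]; first by rewrite !expr1 expr0 !mul1r.
have -> : a ^+ N.+2 - b ^+ N.+2 = a * (a ^+ N.+1 - b ^+ N.+1) + (a - b) * b ^+ N.+1.
  by rewrite !exprS; ring.
rewrite (le_trans (normcD _ _))// !normcM normcX.
have H1 : normc a * normc (a ^+ N.+1 - b ^+ N.+1) <= m * (N.+1%:R * m ^+ N * normc (a - b)).
  by apply: ler_pM => //; exact: normc_ge0.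
have H2 : normc (a - b) * normc b ^+ N.+1 <= normc (a - b) * m ^+ N.+1.
  rewrite ler_wpM2l ?normc_ge0// ler_pXn2r ?nnegrE ?normc_ge0//.
rewrite (le_trans (lerD H1 H2))// -[N.+2]addn1 natrD exprS le_eqVlt; apply/orP; left; apply/eqP.
by ring.
Qed.

(* exp(i l) is approximated by (1 + i l / N)^N, which belongs to the class of  *)
(* functions stable under multiplication by l.                                 *)
Lemma expfam_cvg :
  (forall (t e : R), 0 < e -> \forall k \near \oo, normc (I (fun x => cexp (t%:C * l x)) k) < e) ->
  forall e, 0 < e -> \forall k \near \oo, normc (I (fun x => cexp ('i%C * l x)) k) < e.
Proof.
move=> H0 e e0.
pose a N : R[i] := 'i%C * (N.+1%:R^-1)%:C.
pose p N x := (1 + a N * l x) ^+ N.+1.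
have Np N : null (p N).
  rewrite /p; elim: N.+1 => [|m IH].
    split; first by exists (normc 1), 0; under eq_fun do rewrite expr0; exact: dom_cst.
    move=> t e1 e10; have := H0 t e1 e10; apply: filterS => k.
    by congr (normc _ < _); apply: eq_cint => x _; rewrite expr0 mul1r.
  by have := null_affine (a N) IH; under eq_fun do rewrite -exprS.
(* K / (N + 1) bounds, for all k at once, the error of replacing exp(i l) by [p N]; N is chosen
   first and k grows afterwards. *)
pose K := M * 4 * J 4.
have na N : normc (a N) = N.+1%:R^-1.
  by rewrite /a normcM normc_i mul1r normcR ger0_norm.
have [N NN] : exists N : nat, 2 * `|K| / e < N.+1%:R.
  by exists (Num.truncn (2 * `|K| / e)); exact: truncnS_gt.
have NK : N.+1%:R^-1 * K < e / 2.
  have N0 : 0 < N.+1%:R :> R by rewrite ltr0n.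
  rewrite mulrC ltr_pdivrMr// (le_lt_trans (ler_norm _))//.
  move: NN; rewrite ltr_pdivrMr// => h.
  by rewrite mulrAC ltr_pdivlMr// mulrC mulrC (mulrC e); move: h; lra.
pose r x := cexp ('i%C * l x) + (-1) * p N x.
have dp : exists A c, domby (p N) A c by case: (Np N).
have mexp : cmeas setT (fun x => cexp ('i%C * l x)).
  by apply: cmeas_cexp => //; apply: cmeasM => //; exact: cmeas_cst.
have dexp : domby (fun x => cexp ('i%C * l x)) 1 1.
  split => // x; rewrite normc_cexp !mul1r ler_expR.
  by rewrite (le_trans (ler_norm _))// (le_trans (ler_Re_normc _))// normcM normc_i mul1r.
have dr : domby r (N.+1%:R^-1 * 4) 4.
  have [A [c [mp _ _ _]]] := dp.
  split => //; first by apply: cmeasD => //; apply: cmeasM => //; exact: cmeas_cst.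
  move=> x; rewrite /r mulN1r.
  have N0 : 0 < N.+1%:R :> R by rewrite ltr0n.
  have -> : cexp ('i%C * l x) = cexp (a N * l x) ^+ N.+1.
    have cX m y : cexp y ^+ m = cexp (y *+ m) :> R[i].
      by elim: m => [|m IH]; rewrite ?mulr0n ?cexp0// exprS IH mulrS cexpD.
    rewrite cX; congr cexp; rewrite -mulr_natl /a.
    rewrite mulrA (mulrCA _ 'i%C) -(rmorph_nat (@real_complex R)) -rmorphM.
    by rewrite divff ?mulr1// gt_eqF.
  set y := a N * l x.
  have ny : normc y <= L x / N.+1%:R.
    rewrite /y normcM na mulrC; apply: ler_wpM2r (lL x).
    by rewrite invr_ge0 ltW.
  set m := expR (L x / N.+1%:R).
  have m1 : normc (cexp y) <= m.
    by rewrite normc_cexp ler_expR (le_trans (ler_norm _))// (le_trans (ler_Re_normc _)).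
  have m2 : normc (1 + y) <= m.
    rewrite (le_trans (normcD _ _))// ComplexField.Normc.normc1.
    by rewrite (le_trans _ (expR_ge1Dx _))// lerD2l.
  rewrite (le_trans (normc_subX N m1 m2))//.
  have E3 : normc (cexp y - (1 + y)) <= 4 * (L x / N.+1%:R) ^+ 2 * m.
    rewrite opprD addrA (le_trans (cexp_bound y))//.
    apply: ler_pM; rewrite ?expR_ge0 ?ler_expR//.
    - by apply: mulr_ge0 => //; exact: sqr_ge0.
    - by rewrite ler_wpM2l// ler_pXn2r ?nnegrE ?normc_ge0// divr_ge0.
  have m0 : 0 < m by exact: expR_gt0.
  rewrite (@le_trans _ _ (N.+1%:R * m ^+ N * (4 * (L x / N.+1%:R) ^+ 2 * m)))//.
    by rewrite ler_wpM2l// mulr_ge0// exprn_ge0// ltW.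
  (* The squared 1 / (N + 1) of the remainder beats the N + 1 terms of the telescoping sum, and m^(N
     + 1) is exactly exp(L x). *)
  have -> : N.+1%:R * m ^+ N * (4 * (L x / N.+1%:R) ^+ 2 * m) =
      N.+1%:R^-1 * 4 * (L x ^+ 2 * m ^+ N.+1).
    rewrite (exprSr m); move: (m ^+ N) => q; clearbody m; move: (L x) (N.+1%:R) N0 => s S S0.
    by field; rewrite gt_eqF.
  rewrite ler_wpM2l ?mulr_ge0 ?invr_ge0 ?(ltW N0)//.
  have -> : m ^+ N.+1 = expR (L x).
    rewrite /m -expRM_natl; congr expR; by field; rewrite gt_eqF.
  have e1 : 1 <= expR (L x) by rewrite -expR0 ler_expR.
  rewrite (expRM_natl 4); move: (expR _) (leL (L x)) (L0 x) e1 => E LE E0 e1.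
  have E1 : 0 <= E by exact: le_trans e1.
  apply: (@le_trans _ _ (E ^+ 2 * E)).
    by apply: ler_pM => //; rewrite ?sqr_ge0// ler_pXn2r ?nnegrE.
  by rewrite -exprSr [leRHS]exprSr ler_peMr// exprn_ge0.
have e2 : 0 < e / 2 by rewrite divr_gt0.
(* The value t = 0 of the null property concerns [p N] itself. *)
have := (Np N).2 0 (e / 2) e2; apply: filterS => k hk.
have [_ Ir] := expfam_integrable k dr.
have -> : I (fun x => cexp ('i%C * l x)) k = I r k + I (p N) k.
  rewrite -ID//; last by exists (N.+1%:R^-1 * 4), 4.
  by apply: eq_cint => x _; rewrite /r; congr (_ * _ * _); ring.
rewrite (le_lt_trans (normcD _ _))// [e]splitr ltrD//.
  rewrite (le_lt_trans Ir)// (_ : _ * J _ = N.+1%:R^-1 * K)//; rewrite /K; ring.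
move: hk; congr (normc _ < _); apply: eq_cint => x _.
by rewrite mul0r cexp0 mulr1.
Qed.

End exponential_family.

(** * Off-diagonal decay of the matrix coefficients *)

Lemma integrable_prodM d1 d2 (T1 : measurableType d1) (T2 : measurableType d2) (R : realType)
    (m1 : {sigma_finite_measure set T1 -> \bar R})
    (m2 : {sigma_finite_measure set T2 -> \bar R}) (f : T1 -> R) (h : T2 -> R) :
  (forall x, 0 <= f x) -> (forall y, 0 <= h y) ->
  m1.-integrable setT (EFin \o f) -> m2.-integrable setT (EFin \o h) ->
  (m1 \x m2)%E.-integrable setT (EFin \o (fun z : T1 * T2 => f z.1 * h z.2)).
Proof.
move=> f0 h0 i1 i2.
have mf : measurable_fun setT f by apply/measurable_EFinP; exact: (measurable_int m1).
have mh : measurable_fun setT h by apply/measurable_EFinP; exact: (measurable_int m2).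
apply/integrableP; split.
  apply/measurable_EFinP; apply: measurable_funM.
    exact: (measurableT_comp mf measurable_fst).
  exact: (measurableT_comp mh measurable_snd).
under eq_integral do rewrite /= ger0_norm ?mulr_ge0//.
rewrite integral_prodM//; have := integrable_lty measurableT i1.
have := integrable_lty measurableT i2; rewrite /= => l2 l1.
have e1 : (0 <= \int[m1]_x (f x)%:E)%E by apply: integral_ge0 => x _; rewrite lee_fin.
have e2 : (0 <= \int[m2]_x (h x)%:E)%E by apply: integral_ge0 => x _; rewrite lee_fin.
by rewrite lte_mul_pinfty// ge0_fin_numE.
Qed.

Section off_diagonal.
Variables (R : realType) (n : nat).
Local Notation Cn := 'rV[R[i]]_n.
Local Notation V := (volume R n).
Local Notation g := (@gaussian R n).
Local Notation e2 z := (expR (- (sqcnorm z / 2))).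
Implicit Types (z w u v x a c p q y : Cn).

Lemma sqcnorm_le2 z w : sqcnorm z <= 2 * sqcnorm (z + w) + 2 * sqcnorm w.
Proof.
have := sqcnorm_ge0 (z + w + w); rewrite sqcnormD => h.
have -> : sqcnorm z = sqcnorm (z + w - w) by rewrite addrK.
by rewrite sqcnormB; lra.
Qed.

(** The unimodular cocycle of the Weyl translations of the Fock space. *)
Definition phase z w : R[i] := cexp (0 +i* Im (cdot z w)).

Lemma normc_phase z w : normc (phase z w) = 1.
Proof. by rewrite normc_cexp expR0. Qed.

Lemma cmeas_phase w : cmeas setT (phase^~ w).
Proof.
apply: cmeas_cexp => //; split => /=; first exact: measurable_cst.
by case: (@cmeas_cdotl R n w).
Qed.

(** Translating both points of a normalized kernel by z multiplies it by two phases. One is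
    independent of x and leaves the integral; the other is independent of a and is absorbed into
    [tkernel]. *)
Lemma gauss_shift x a z :
  cexp (cdot (x + z) (z + a)) * (e2 (x + z))%:C * (e2 (z + a))%:C =
  phase z a * phase x z * cexp (cdot x a) * (e2 x)%:C * (e2 a)%:C.
Proof.
rewrite /phase -!cexpR -!cexpD; congr cexp.
rewrite !sqcnormD !cdotDl !cdotDr cdot_sqcnorm.
apply: complexP; rewrite !(ReD, ImD)/=; last by ring.
by field.
Qed.

Lemma gauss_shiftJ w c z :
  cexp (cdot (z + c) (w + z)) * (e2 (w + z))%:C * (e2 (z + c))%:C =
  (phase z c)^* * (phase w z)^* * cexp (cdot c w) * (e2 w)%:C * (e2 c)%:C.
Proof.
rewrite /phase !conjc_cexp -!cexpR -!cexpD; congr cexp.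
rewrite !sqcnormD !cdotDl !cdotDr cdot_sqcnorm.
rewrite -(cdotJ w z) -(cdotJ w c) -(cdotJ z c).
apply: complexP; rewrite !(ReD, ImD, ReJ, ImJ)/=; last by ring.
by field.
Qed.

Variables (B B' : {linear kspan R n -> H2 R n}) (C : R).
Hypothesis BB' : adjoint_on_span B B'.
Hypothesis C0 : 0 < C.
Local Notation b := (kernel_of B).
Hypothesis b1 : forall z, (\int[V]_w (normc (b z w))%:E <= C%:E)%E.
Hypothesis b2 : forall w, (\int[V]_z (normc (b z w))%:E <= C%:E)%E.

Lemma kernel_of_bounded : exists M, forall z w, normc (b z w) <= M.
Proof.
have [[M MT] Text] := extH2_bounded_extension BB' C0 b1 b2.
exists M => z w; rewrite /kernel_of innerE.
rewrite (le_trans (pint_cauchy_schwarz (H2_L2 _) (L2_nkernel w)))//.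
rewrite normH2_nkernel mulr1 -(Text (k_ z) (kH2 z))//.
by rewrite (le_trans (MT _))// -[H2val (kH2 z)]/(nkernel z) normH2_nkernel mulr1.
Qed.

(** The conjugated reproducing formula for [B' (k_ w)] at p, with the Gaussian distributed so that
    the bounded function b stands under the integral. *)
Lemma kernel_repr1 p w :
  let F x := b x w * (cexp (cdot x p) * (e2 x)%:C * (e2 p)%:C) * (pi ^- n)%:C in
  cintegrable V setT F /\ b p w = cint V setT F.
Proof.
move=> F; have i := L2M_integrable (H2_L2 (B' (k_ w))) (L2_cexp_cdot p).
have iJ := cintegrableJ i.
have -> : F = fun x => (e2 p)%:C * (B' (k_ w) x * cexp (cdot p x) * (g x)%:C)^*.
  apply/funext => x; rewrite /F (kernel_ofE' BB') gaussian_half.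
  rewrite (conjcM (_ * _)) (conjcM (B' _ _)) conjcR conjc_cexp cdotJ.
  by rewrite (rmorphM _ (_ * _)) rmorphM; ring.
split; first exact: cintegrableZ.
by rewrite (cintZ _ measurableT iJ) cintJ// (kernel_ofE' BB') mulrC -(H2_bergman (B' (k_ w)) p).
Qed.

Lemma kernel_repr2 p q :
  b p q = cint V setT (fun w =>
    b p w * (cexp (cdot q w) * (e2 w)%:C * (e2 q)%:C) * (pi ^- n)%:C).
Proof.
rewrite kernel_ofE -(H2_bergman (B (k_ p)) q) /bergman.
have i := L2M_integrable (H2_L2 (B (k_ p))) (L2_cexp_cdot q).
rewrite mulrC -(cintZ _ measurableT i).
by apply: eq_cint => w _; rewrite kernel_ofE gaussian_half !rmorphM; ring.
Qed.

(** All dependence on the base point is collected here, and the modulus is bounded uniformly in z: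
    these are the functions [be k] of the exponential family. *)
Definition tkernel z (X : Cn * Cn) : R[i] :=
  b (X.1 + z) (X.2 + z) * phase X.1 z * (phase X.2 z)^*.

(** Half of the Gaussian exponent has gone into normalizing b; the remaining half still absorbs
    every exp(c [l1norm]). *)
Definition tweight (X : Cn * Cn) : R := (pi ^- n * e2 X.1) * (pi ^- n * e2 X.2).

Lemma cmeas_tkernel z : cmeas setT (tkernel z).
Proof.
have [m1 m2] := (@measurable_fst _ _ Cn Cn, @measurable_snd _ _ Cn Cn).
apply: cmeasM; last exact: (cmeasJ (cmeas_comp (cmeas_phase z) m2)).
apply: cmeasM; last exact: (cmeas_comp (cmeas_phase z) m1).
have ms : measurable_fun setT (fun X : Cn * Cn => (X.1 + z, X.2 + z)).
  by apply/measurable_fun_pairP; split; apply: measurable_CnD => //; exact: measurable_cst.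
exact: (cmeas_comp (cmeas_kernel_of BB') ms).
Qed.

Lemma normc_tkernel z X : normc (tkernel z X) = normc (b (X.1 + z) (X.2 + z)).
Proof. by rewrite /tkernel (normcM (_ * _)) (normcM (b _ _)) normcJ !normc_phase !mulr1. Qed.

Lemma tweight_ge0 X : 0 <= tweight X.
Proof.
have pn0 := pin_gt0 R n.
by rewrite /tweight !mulr_ge0 ?expR_ge0// ltW.
Qed.

Lemma measurable_tweight : measurable_fun setT tweight.
Proof.
by apply: measurable_funM; apply: measurable_funM => //;
  [exact: (measurableT_comp (@measurable_e2 R n) measurable_fst)
  |exact: (measurableT_comp (@measurable_e2 R n) measurable_snd)].
Qed.

Lemma tweight_integrable (c : R) :
  (V \x V)%E.-integrable setT (EFin \o (fun X : Cn * Cn =>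
    expR (c * (l1norm X.1 + l1norm X.2)) * tweight X)).
Proof.
pose f (z : Cn) : R := expR (c * l1norm z) * e2 z.
have f0 z : 0 <= f z by rewrite mulr_ge0 ?expR_ge0.
have i_f : V.-integrable setT (EFin \o f) by exact: integrable_l1_e2.
have := integrableZR (pi ^- n * pi ^- n) measurableT (integrable_prodM f0 f0 i_f i_f).
apply: eq_integrable => // X _ /=.
by rewrite /f /tweight mulrDr expRD; congr EFin; ring.
Qed.

(** Reproducing in both variables and translating by z leaves the displacements a and c only in
    fixed Gaussian factors and in the exponential of a form linear in a^* and c, whose complex
    parameter can then be varied. *)
Lemma kernel_shift a c z :
  normc (b (z + a) (z + c)) = e2 a * e2 c * normc (cint (V \x V)%E setT (fun X =>
    tkernel z X * cexp (cdot X.1 a + cdot c X.2) * (tweight X)%:C)).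
Proof.
have [M bM] := kernel_of_bounded.
have [m1 m2] := (@measurable_fst _ _ Cn Cn, @measurable_snd _ _ Cn Cn).
pose G (X : Cn * Cn) := tkernel z X * cexp (cdot X.1 a + cdot c X.2) * (tweight X)%:C.
have mG : cmeas setT G.
  apply: cmeasM; last by apply: cmeasR; exact: measurable_tweight.
  apply: cmeasM; first exact: cmeas_tkernel.
  apply: cmeas_cexp => //; apply: cmeasD.
    exact: (cmeas_comp (cmeas_cdotl a) m1).
  exact: (cmeas_comp (cmeas_cdotr c) m2).
have iG : cintegrable (V \x V)%E setT G.
  pose s := Re `|a| + Re `|c|.
  have M0 : 0 <= M by exact: le_trans (normc_ge0 _) (bM 0 0).
  apply: (@le_cintegrable _ _ _ _ _ _ (fun X =>
    M * (expR (s * (l1norm X.1 + l1norm X.2)) * tweight X))) => //.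
    move=> X _; rewrite /G (normcM (_ * _)) (normcM (tkernel _ _)) normcR ger0_norm ?tweight_ge0//.
    rewrite normc_cexp normc_tkernel [leRHS]mulrA; apply: ler_wpM2r; first exact: tweight_ge0.
    apply: ler_pM (bM _ _) _; rewrite ?normc_ge0 ?expR_ge0// ler_expR.
    have := normc_cdot_l1 a X.1; have := normc_cdot_l1 c X.2.
    have := le_trans (ler_norm _) (ler_Re_normc (cdot X.1 a)).
    have := le_trans (ler_norm _) (ler_Re_normc (cdot c X.2)).
    rewrite -(normcJ (cdot X.1 a)) cdotJ ReD /s.
    have := supnorm_ge0 a; have := supnorm_ge0 c; have := l1norm_ge0 X.1; have := l1norm_ge0 X.2.
    move: (Re _) (Re _) (normc _) (normc _) (Re _) (Re _) (l1norm _) (l1norm _) => *; nra.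
  by apply: integrableZR => //; exact: tweight_integrable.
have [_ F2] := cint_fubini iG.
suff -> : b (z + a) (z + c) = phase z a * (phase z c)^* * ((e2 a)%:C * (e2 c)%:C) *
    cint (V \x V)%E setT G.
  have nph (p q X : R[i]) (x y : R) : normc p = 1 -> normc q = 1 -> 0 <= x -> 0 <= y ->
      normc (p * q^* * (x%:C * y%:C) * X) = x * y * normc X.
    by move=> p1 q1 x0 y0; rewrite !normcM normcJ !normcR p1 q1 !ger0_norm// !mul1r.
  by apply: nph; [exact: normc_phase|exact: normc_phase|exact: expR_ge0|exact: expR_ge0].
set K := _ * (_ * _); have [_ F3] := cint_fubini (cintegrableZ K measurableT iG).
rewrite -(cintZ K measurableT iG) -F3 kernel_repr2.
have mw : cmeas setT (fun w => b (z + a) w).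
  exact: (cmeas_comp (cmeas_kernel_of BB') (measurable_pair1 (z + a))).
have mh : cmeas setT (fun w : Cn => (e2 w)%:C) by exact: cmeas_e2.
rewrite -(cint_mpreserving (mpreserving_volumeD z)); last first.
  apply: cmeasM; last exact: cmeas_cst.
  apply: cmeasM => //; apply: cmeasM; last exact: cmeas_cst.
  apply: cmeasM => //; apply: cmeas_cexp => //; exact: cmeas_cdotr.
apply: eq_cint => w _.
have [[mF iF] ->] := kernel_repr1 (z + a) (w + z).
rewrite -(cint_mpreserving (mpreserving_volumeD z) mF) -[LHS]mulrA mulrC.
have iF' : cintegrable V setT (fun x => b (x + z) (w + z) *
    (cexp (cdot (x + z) (z + a)) * (e2 (x + z))%:C * (e2 (z + a))%:C) * (pi ^- n)%:C).
  split; first exact: (cmeas_comp mF (mpreserving_volumeD z).1).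
  exact: (integrable_mpreserving (mpreserving_volumeD z) iF).
rewrite -(cintZ _ measurableT iF'); apply: eq_cint => x _.
rewrite gauss_shift gauss_shiftJ /G /tkernel /tweight /K cexpD /=.
by rewrite !rmorphM; ring.
Qed.

Lemma sqcnorm_infty (z : nat -> Cn) w :
  (forall A, \forall k \near \oo, A <= sqcnorm (z k)) ->
  forall A, \forall k \near \oo, A <= sqcnorm (z k + w).
Proof.
move=> zoo A; apply: filterS (zoo (2 * A + 2 * sqcnorm w)) => k h.
by have := sqcnorm_le2 (z k) w; lra.
Qed.

Lemma berezin_sequence (z : nat -> Cn) : vanishes_at_infinity (berezin B) ->
  (forall A, \forall k \near \oo, A <= sqcnorm (z k)) ->
  forall e, 0 < e -> \forall k \near \oo, normc (b (z k) (z k)) < e.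
Proof.
move=> Bv zoo e e0; have [A hA] := Bv e e0.
apply: filterS (zoo (A ^+ 2)) => k h; apply: hA.
by rewrite (le_trans (ler_norm _))// -sqrtr_sqr ler_wsqrtr.
Qed.

(* For real t, X_k(t) := \int tkernel (z k) exp(t l) dtweight is controlled by *)
(* the diagonal values b(p, p) with p = z k + t y, while X_k(i) is the         *)
(* off-diagonal value b(z k - i y, z k + i y).                                 *)
Lemma off_diagonal_decay (z : nat -> Cn) u : vanishes_at_infinity (berezin B) ->
  (forall A, \forall k \near \oo, A <= sqcnorm (z k)) ->
  forall e, 0 < e -> \forall k \near \oo, normc (b (z k) (z k + u)) < e.
Proof.
move=> Bv zoo e e0.
(* Chosen so that i y = u / 2 = v: around the base point z k + v, the displacements -v and v give
   the pair z k, z k + u, and they are l^* y and l y at l = i. *)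
pose y : Cn := (- 'i%C / 2) *: u.
pose v : Cn := (2^-1 : R[i]) *: u.
pose L (X : Cn * Cn) := Re `|y| * (l1norm X.1 + l1norm X.2).
have lL X : normc (cdot X.1 y + cdot y X.2) <= L X.
  rewrite (le_trans (normcD _ _))// /L mulrDr lerD ?normc_cdot_l1//.
  by rewrite -normcJ cdotJ normc_cdot_l1.
have ml : cmeas setT (fun X : Cn * Cn => cdot X.1 y + cdot y X.2).
  apply: cmeasD.
    exact: (cmeas_comp (cmeas_cdotl y) (@measurable_fst _ _ Cn Cn)).
  exact: (cmeas_comp (cmeas_cdotr y) (@measurable_snd _ _ Cn Cn)).
have [M bM] := kernel_of_bounded.
have bM' k X : normc (tkernel (z k + v) X) <= M by rewrite normc_tkernel.
have iw (c : R) : 0 <= c -> (V \x V)%E.-integrable setT (EFin \o (fun X =>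
    expR (c * L X) * tweight X)).
  move=> _; have := tweight_integrable (c * Re `|y|).
  by under [X in integrable _ _ X -> _]eq_fun do rewrite -mulrA.
have zv := sqcnorm_infty v zoo.
have zvt (t : R) := sqcnorm_infty (t%:C *: y) zv.
have Hexp := @expfam_cvg _ _ R (V \x V)%E (fun k => tkernel (z k + v)) _ L tweight M
  (fun k => cmeas_tkernel (z k + v)) ml measurable_tweight bM' lL tweight_ge0 iw.
have iy : v = 'i%C *: y.
  rewrite /y /v scalerA; congr (_ *: _); apply: complexP.
    by rewrite !(ReM, ImM)/=; field.
  by rewrite !(ReM, ImM)/=; field.
have iy' : - v = (- 'i%C) *: y by rewrite scaleNr -iy.
have e2le (x : Cn) : e2 x <= 1.
  by rewrite -[leRHS]expR0 ler_expR oppr_le0 divr_ge0// sqcnorm_ge0.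
have H := Hexp _ e e0; apply: filterS (H _) => [k|t d d0]; last first.
  (* For fixed t the Gaussian factors of [kernel_shift] are positive constants, so the tolerance is
     rescaled by them. *)
  have ed : 0 < d * (e2 (t%:C *: y) * e2 (t%:C *: y)) by rewrite !mulr_gt0 ?expR_gt0.
  apply: filterS (berezin_sequence Bv (zvt t) ed) => k.
  rewrite kernel_shift mulrC ltr_pM2r ?mulr_gt0 ?expR_gt0//.
  congr (normc _ < _); apply: eq_cint => X _.
  by rewrite cdotZl cdotZr conjcR -mulrDr.
apply: le_lt_trans.
have -> : z k + u = z k + v + v.
  have h2 : 2^-1 + 2^-1 = 1 :> R[i] by field.
  by rewrite -addrA /v -scalerDl h2 scale1r.
have {1}-> : z k = z k + v + (- v) by rewrite addrK.
rewrite kernel_shift -[leRHS]mul1r; apply: ler_pM; rewrite ?normc_ge0 ?mulr_ge0 ?expR_ge0//.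
  by rewrite -[leRHS]mul1r; apply: ler_pM; rewrite ?expR_ge0.
rewrite le_eqVlt; apply/orP; left; apply/eqP; congr normc.
apply: eq_cint => X _.
have iJ : (- 'i%C : R[i])^* = 'i%C by apply: complexP; rewrite /= ?oppr0 ?opprK.
by rewrite iy' iy cdotZl cdotZr iJ -mulrDr.
Qed.

End off_diagonal.

(** * Decay of the row masses *)

Section mass_decay.
Variables (R : realType) (n : nat).
Local Notation Cn := 'rV[R[i]]_n.
Local Notation V := (volume R n).
Implicit Types (z w u : Cn).

(** Column integrals of |b| are row integrals for B', because <B' k_w, k_z> is the conjugate of <B
    k_z, k_w>. The sum of the two bounds serves for both. *)
Lemma localized_bounds (B B' : {linear kspan R n -> H2 R n}) :
  adjoint_on_span B B' -> localized B -> localized B' ->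
  exists C : R, [/\ 0 < C,
    forall z, (\int[V]_w (normc (kernel_of B z w))%:E <= C%:E)%E &
    forall w, (\int[V]_z (normc (kernel_of B z w))%:E <= C%:E)%E].
Proof.
move=> BB' [S _] [S' _].
have sup_le (D : {linear kspan R n -> H2 R n}) :
    (ereal_sup (range (fun z : Cn =>
      \int[V]_w (normc (inner (D (k_ z)) (k_ w)))%:E)) < +oo)%E ->
    exists2 C : R, 0 < C &
      forall z, (\int[V]_w (normc (inner (D (k_ z)) (k_ w)))%:E <= C%:E)%E.
  set s := ereal_sup _ => soo.
  have le z : (\int[V]_w (normc (inner (D (k_ z)) (k_ w)))%:E <= s)%E.
    by apply: ereal_sup_ubound; exists z.
  have s0 : (0 <= s)%E.
    by apply: le_trans (le 0); apply: integral_ge0 => w _; rewrite lee_fin normc_ge0.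
  have sf : s \is a fin_num by rewrite ge0_fin_numE.
  exists (fine s + 1); first by rewrite ltr_wpDl// fine_ge0.
  move=> z; rewrite (le_trans (le z))// -[leLHS]fineK// lee_fin lerDl//.
have [C1 C10 h1] := sup_le _ S; have [C2 C20 h2] := sup_le _ S'.
exists (C1 + C2); split; first by rewrite addr_gt0.
  by move=> z; rewrite (le_trans (h1 z))// lee_fin lerDl ltW.
move=> w; rewrite (@le_trans _ _ C2%:E)//; last by rewrite lee_fin lerDr ltW.
apply: le_trans (h2 w).
rewrite le_eqVlt; apply/orP; left; apply/eqP; apply: eq_integral => z _.
rewrite /kernel_of BB' !innerE pintC; [|exact: H2_L2|exact: L2_nkernel].
by rewrite normcJ.
Qed.

Variables (B B' : {linear kspan R n -> H2 R n}) (C : R).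
Hypothesis BB' : adjoint_on_span B B'.
Hypothesis C0 : 0 < C.
Local Notation b := (kernel_of B).
Hypothesis b1 : forall z, (\int[V]_w (normc (b z w))%:E <= C%:E)%E.
Hypothesis b2 : forall w, (\int[V]_z (normc (b z w))%:E <= C%:E)%E.
Hypothesis tailB : tail_sup B r @[r --> +oo%R] --> (0 : \bar R)%E.

Lemma measurable_kernel_row z : measurable_fun setT (fun w => normc (b z w)).
Proof.
apply: measurable_normc.
exact: (cmeas_comp (cmeas_kernel_of BB') (measurable_pair1 z)).
Qed.

(** On |w - z| < r the indicator is at most exp(r^2 - |w - z|^2); recentring at z gives an integral
    over all of C^n with a fixed integrable weight, ready for dominated convergence as z moves. *)
Lemma row_mass_split z r : 0 <= r -> ((row_mass B z)%:E <=
  tail_sup B r + (expR (r ^+ 2) *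
    \int[V]_u (expR (- (1 * sqcnorm u)) * normc (b z (z + u))))%:E)%E.
Proof.
move=> r0; have [M bM] := kernel_of_bounded BB' C0 b1 b2.
have mu : measurable_fun setT (fun u => normc (b z (z + u))).
  apply: (measurableT_comp (measurable_kernel_row z)).
  by apply: measurable_CnD => //; exact: measurable_cst.
have me := @measurable_gauss R n 1.
have iu : V.-integrable setT (EFin \o (fun u => expR (- (1 * sqcnorm u)) * normc (b z (z + u)))).
  have ig : V.-integrable setT (fun u : Cn => (M%:E * (expR (- (1 * sqcnorm u)))%:E)%E).
    by apply: integrableZl => //; exact: integrable_gauss.
  apply: le_integrable ig => //.
    by apply/measurable_EFinP; exact: measurable_funM.
  move=> u _ /=; rewrite lee_fin ger0_norm; last first.
    by apply: mulr_ge0; [exact: expR_ge0|exact: normc_ge0].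
  rewrite ger0_norm ?mulr_ge0 ?expR_ge0//; last exact: le_trans (normc_ge0 _) (bM 0 0).
  by rewrite mulrC ler_wpM2r ?expR_ge0.
set D := [set w : Cn | (r <= cnorm (z - w))%R].
have DE w : D w <-> r ^+ 2 <= sqcnorm (w - z).
  rewrite -opprB sqcnormN sqcnorm_cnorm ler_pXn2r ?nnegrE ?sqrtr_ge0//.
have ms : measurable_fun setT (fun w : Cn => sqcnorm (w - z)).
  apply: (measurableT_comp (@measurable_sqcnorm R n)).
  by apply: measurable_CnD => //; exact: measurable_cst.
have mD : measurable D.
  rewrite (_ : D = (fun w => sqcnorm (w - z)) @^-1` `[r ^+ 2, +oo[%classic).
    by rewrite -[_ @^-1` _]setTI; exact: ms.
  by apply/seteqP; split => w /=; rewrite in_itv/= andbT => /DE.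
have mk := measurable_kernel_row z.
have -> : ((row_mass B z)%:E = \int[V]_w (normc (b z w))%:E)%E.
  have := @schur_rowE _ _ Cn Cn R V (fun z w => normc (b z w)) C
    (measurable_kernel_of BB') (fun _ _ => normc_ge0 _) b1 z.
  by [].
have k0 w : 0 <= normc (b z w) by exact: normc_ge0.
pose H w := expR (r ^+ 2) * (expR (- (1 * sqcnorm (w - z))) * normc (b z w)).
have H0 w : 0 <= H w by rewrite /H mulr_ge0 ?mulr_ge0 ?expR_ge0.
have mH : measurable_fun setT H.
  apply: measurable_funM => //; apply: measurable_funM => //.
  apply: measurableT_comp => //; apply: measurableT_comp => //.
  by apply: measurable_funM => //; exact: measurable_cst.
have mDk : measurable_fun setT ((fun w => (normc (b z w))%:E) \_ D).
  apply/(measurable_restrictT _ mD)/measurable_EFinP.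
  exact: measurable_funS mk.
have Dk0 w : (0 <= ((fun w => (normc (b z w))%:E) \_ D) w)%E.
  by rewrite patchE; case: ifP => // _; rewrite lee_fin.
apply: (@le_trans _ _ (\int[V]_w (((fun w => (normc (b z w))%:E) \_ D) w + (H w)%:E))%E).
  apply: ge0_le_integral => //.
  - by move=> w _; rewrite lee_fin.
  - exact/measurable_EFinP.
  - by apply: emeasurable_funD => //; exact/measurable_EFinP.
  move=> w _; rewrite patchE; case: ifPn => [_|/negP wD].
    by rewrite -EFinD lee_fin lerDl.
  rewrite add0e lee_fin /H mulrA -expRD mul1r -[leLHS]mul1r; apply: ler_wpM2r => //.
  rewrite -[leLHS]expR0 ler_expR subr_ge0 leNgt; apply/negP => h; apply: wD; rewrite inE.
  by apply/DE; exact: ltW.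
rewrite ge0_integralD//; last 2 first.
- by move=> w _; rewrite lee_fin.
- exact/measurable_EFinP.
apply: leeD.
  by rewrite -integral_mkcond; apply: ereal_sup_ubound; exists z.
rewrite -(integral_mpreserving (mpreserving_volumeD z) mH).
under eq_integral => u _ do rewrite /H addrK (addrC u) EFinM.
rewrite integralZl// EFinM /Rintegral fineK//; exact: integrable_fin_num iu.
Qed.

(** A failure would give points z_k going to infinity with row mass at least e. First r is fixed to
    make the tail at most e / 2 for every z; then the near part tends to 0, because
    [off_diagonal_decay] holds at each displacement u. *)
Lemma row_mass_vanishes : vanishes_at_infinity (berezin B) ->
  forall e, 0 < e -> exists A, forall z, A <= sqcnorm z -> row_mass B z < e.
Proof.
move=> Bv e e0; apply: contrapT => H.
have /choice[z zP] : forall k : nat, exists z, k%:R <= sqcnorm z /\ e <= row_mass B z.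
  move=> k; apply: contrapT => Hk; apply: H; exists k%:R => z kz.
  by rewrite ltNge; apply/negP => ez; apply: Hk; exists z.
have zoo A : \forall k \near \oo, A <= sqcnorm (z k).
  near=> k; rewrite (le_trans _ (zP k).1)//; near: k; exact: nbhs_infty_ger.
have e2 : (0 < (e / 2)%:E)%E by rewrite lte_fin divr_gt0.
have [r r0 rt] : exists2 r, 0 <= r & (tail_sup B r <= (e / 2)%:E)%E.
  have lt2 : nbhs (0 : \bar R)%E [set x | (x < (e / 2)%:E)%E].
    by apply: open_nbhs_nbhs; split => //; exact: open_ereal_lt_ereal.
  have [r [r1 r2]] := filter_ex (filterI (nbhs_pinfty_ge (real0 R)) (tailB lt2)).
  by exists r => //; exact: ltW.
have [M bM] := kernel_of_bounded BB' C0 b1 b2.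
have cv : \int[V]_u (expR (- (1 * sqcnorm u)) * normc (b (z k) (z k + u)))
    @[k --> \oo] --> (0 : R).
  apply: (Rintegral_cvg0 (g := fun u : Cn => M * expR (- (1 * sqcnorm u)))) => //.
  - move=> k; apply: measurable_funM; first exact: measurable_gauss.
    apply: (measurableT_comp (measurable_kernel_row (z k))).
    by apply: measurable_CnD => //; exact: measurable_cst.
  - move=> k u _; rewrite normrM !ger0_norm ?normc_ge0 ?expR_ge0// mulrC.
    by rewrite ler_wpM2r ?expR_ge0.
  - by apply: integrableZR => //; exact: integrable_gauss.
  move=> u _; apply/cvgrPdist_lt => d d0.
  apply: filterS (off_diagonal_decay BB' C0 b1 b2 u Bv zoo d0) => k.
  rewrite sub0r normrN normrM !ger0_norm ?normc_ge0 ?expR_ge0//.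
  apply: le_lt_trans; rewrite -[leRHS]mul1r ler_wpM2r ?normc_ge0//.
  by rewrite -[leRHS]expR0 ler_expR mul1r oppr_le0 sqcnorm_ge0.
have d0 : 0 < e / 2 / expR (r ^+ 2) by rewrite !divr_gt0// expR_gt0.
move/cvgrPdist_lt: cv => /(_ _ d0) [N _ /(_ N (leqnn N))] /=.
rewrite sub0r normrN => cN.
have := row_mass_split (z N) r0; apply/negP; rewrite -ltNge.
apply: lt_le_trans (_ : e%:E <= _)%E; last by rewrite lee_fin; exact: (zP N).2.
apply: (@le_lt_trans _ _ ((e / 2)%:E + (expR (r ^+ 2) *
    \int[V]_u (expR (- (1 * sqcnorm u)) * normc (b (z N) (z N + u))))%:E)%E).
  exact: leeD2r.
rewrite -EFinD lte_fin [e in ltRHS]splitr ltrD2l mulrC -ltr_pdivlMr ?expR_gt0//.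
exact: le_lt_trans (ler_norm _) cN.
Unshelve. all: by end_near.
Qed.

End mass_decay.

(** * Pointwise convergent subsequences *)

(** Every P k and every tail belong to F, so they always meet, and indices can be picked one after
    the other. *)
Lemma ultra_subsequence (F : set_system nat) (P : nat -> set nat) :
  UltraFilter F -> (\oo `<=` F) -> (forall k, F (P k)) ->
  exists2 phi : nat -> nat, {homo phi : i j / (i < j)%N} & forall k, P k (phi k).
Proof.
move=> FU sF FP; have Fp : ProperFilter F by case: FU.
have /choice[nxt nxtP] : forall Nk : nat * nat, exists m, (Nk.1 < m)%N /\ P Nk.2 m.
  move=> [N k] /=; have FN : F [set m | (N < m)%N] by apply: sF; exact: nbhs_infty_gt.
  by have [m [? ?]] := filter_ex (filterI FN (FP k)); exists m.
pose phi := fix phi k := if k is k'.+1 then nxt (phi k', k) else nxt (0, 0)%N.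
exists phi; last by case=> [|k]; [exact: (nxtP (0, 0)%N).2|exact: (nxtP (phi k, k.+1)).2].
by apply: homo_ltn => [|k]; [exact: ltn_trans|exact: (nxtP (phi k, k.+1)).1].
Qed.

(** * Limits of bounded sequences along an ultrafilter *)

Section ultrafilter_limits.
Variables (R : realType) (F : set_system nat).
Hypothesis FU : UltraFilter F.

Lemma ultra_bounded_cvg (x : nat -> R) (M : R) : (forall j, `|x j| <= M) ->
  exists l, forall e, 0 < e -> F [set j | `|x j - l| < e].
Proof.
move=> xM; have Fp : ProperFilter F by case: FU.
have := @segment_compact R (- M) M (x @ F) _.
case=> [|l [_ cl]].
  by rewrite /fmap/=; apply: filterS filterT => j _ /=; rewrite in_itv/= -ler_norml.
exists l => e e0; have [//|nF] := in_ultra_setVsetC [set j | `|x j - l| < e] FU.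
have nb : nbhs l (ball l e) by exact: nbhsx_ballx.
have nF' : F (x @^-1` (~` ball l e)).
  apply: (@filterS _ F _ (~` [set j | `|x j - l| < e])) nF => j nj lj; apply: nj.
  by rewrite /= distrC.
by have [y [h1 h2]] := cl _ _ nF' nb; case: (h1 h2).
Qed.

Lemma ultra_bounded_ccvg (x : nat -> R[i]) (M : R) : (forall j, normc (x j) <= M) ->
  exists l, forall e, 0 < e -> F [set j | normc (x j - l) < e].
Proof.
move=> xM; have Fp : ProperFilter F by case: FU.
have [a aP] := ultra_bounded_cvg (fun j => le_trans (ler_Re_normc _) (xM j)).
have [b bP] := ultra_bounded_cvg (fun j => le_trans (ler_Im_normc _) (xM j)).
exists (a +i* b) => e e0; have e2 : 0 < e / 2 by rewrite divr_gt0.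
apply: filterS (filterI (aP _ e2) (bP _ e2)) => j [/= ha hb].
rewrite (le_lt_trans (normc_le_ReIm _))// [e]splitr ReD ReN ImD ImN/=.
exact: ltrD.
Qed.

End ultrafilter_limits.

Section weak_compactness.
Variables (R : realType) (n : nat).
Local Notation Cn := 'rV[R[i]]_n.
Local Notation V := (volume R n).
Local Notation g := (@gaussian R n).
Local Notation e2 z := (expR (- (sqcnorm z / 2))).
Implicit Types (z w : Cn).

Lemma cmeas_l1exp (c : R) : cmeas setT (fun v : Cn => (expR (c * l1norm v))%:C).
Proof.
apply: cmeasR; apply: measurableT_comp => //; apply: measurable_funM => //.
exact: measurable_l1norm.
Qed.

Lemma L2_l1exp (c : R) : L2 (fun v : Cn => (expR (c * l1norm v))%:C).
Proof.
apply: (@L2_exp_growth _ _ _ 1 c); first exact: cmeas_l1exp.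
by move=> z; rewrite normcR ger0_norm ?expR_ge0// mul1r.
Qed.

(** Equicontinuity of norm-bounded sets, from the reproducing integral: it carries convergence from
    grid points to every point in [H2_subsequence]. *)
Lemma H2_lipschitz z : exists2 K : R, 0 <= K & forall (f : H2 R n) w,
  Re `|w - z| <= 1 -> normc (f w - f z) <= K * normH2 f * Re `|w - z|.
Proof.
(* The 3 is 1 + 2: s <= exp s for the linear factor of [cexpB1_bound], and exp(2 s) from its
   exponential. *)
pose c := Re `|z| + 3; pose h v : R[i] := (expR (c * l1norm (v : Cn)))%:C.
have Lh : L2 h by exact: L2_l1exp.
exists (5 * normH2 h); first by rewrite mulr_ge0 ?normH2_ge0.
move=> f w; set d := Re `|w - z| => d1; have d0 : 0 <= d by exact: supnorm_ge0.
have Lf := H2_L2 f.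
have i1 := L2M_integrable Lf (L2_cexp_cdot w); have i2 := L2M_integrable Lf (L2_cexp_cdot z).
rewrite -(H2_bergman f w) -(H2_bergman f z) /bergman -cintB//.
have i3 := cintegrableB measurableT i1 i2.
rewrite (le_trans (normc_cint_le measurableT i3))//.
have le v : normc (f v * cexp (cdot w v) * (g v)%:C - f v * cexp (cdot z v) * (g v)%:C) <=
    5 * d * (normc (f v) * normc (h v) * g v).
  rewrite -mulrBl -mulrBr (normcM (_ * _)) (normcM (f v)) normcR (ger0_norm (gaussian_ge0 v)).
  rewrite [leRHS]mulrA; apply: ler_wpM2r; first exact: gaussian_ge0.
  rewrite [leRHS](_ : _ = normc (f v) * (5 * d * normc (h v))); last by ring.
  rewrite ler_wpM2l ?normc_ge0//.
  have -> : cexp (cdot w v) - cexp (cdot z v) = cexp (cdot z v) * (cexp (cdot (w - z) v) - 1).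
    by rewrite mulrBr mulr1 -cexpD cdotBl subrKC.
  rewrite normcM /h normcR ger0_norm ?expR_ge0// normc_cexp.
  have l0 := l1norm_ge0 v; have n1 := normc_cdot_l1 (w - z) v; rewrite -/d in n1.
  have n2 := le_trans (le_trans (ler_norm _) (ler_Re_normc _)) (normc_cdot_l1 z v).
  have n3 : normc (cexp (cdot (w - z) v) - 1) <= 5 * d * expR (3 * l1norm v).
    rewrite (le_trans (cexpB1_bound _))// -!mulrA ler_wpM2l//.
    have -> : expR (3 * l1norm v) = expR (l1norm v) * expR (2 * l1norm v).
      by rewrite -expRD; congr expR; ring.
    rewrite mulrA; apply: ler_pM; rewrite ?normc_ge0 ?expR_ge0//.
      rewrite (le_trans n1)// ler_wpM2l// (le_trans _ (expR_ge1Dx _))// lerDr//.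
    rewrite ler_expR ler_wpM2l// (le_trans n1)// ler_piMl//.
  have -> : expR (c * l1norm v) = expR (Re `|z| * l1norm v) * expR (3 * l1norm v).
    by rewrite -expRD -mulrDl.
  rewrite [leRHS]mulrCA; apply: ler_pM; rewrite ?expR_ge0 ?normc_ge0//.
  by rewrite ler_expR.
have ii := integrable_normcM Lf Lh.
apply: (@le_trans _ _ (\int[V]_v (5 * d * (normc (f v) * normc (h v) * g v)))).
  apply: le_Rintegral => //; first by case: i3.
  exact: integrableZR.
rewrite RintegralZl// [leRHS](_ : _ = 5 * d * (normH2 f * normH2 h)); last by ring.
by rewrite ler_wpM2l ?mulr_ge0//; exact: Rintegral_normcM_le.
Qed.

Lemma H2_growth (f : H2 R n) z : normc (f z) <= normH2 f * expR (sqcnorm z / 2).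
Proof.
have := H2_pointwise_le f z.
by rewrite expRN ler_pdivrMr ?expR_gt0.
Qed.

(** The ultrafilter gives a candidate limit at all points at once, whereas a subsequence can be
    tuned only to countably many; the union of the grids is used, and [H2_lipschitz] reaches the
    other points. *)
Lemma H2_subsequence (u : nat -> H2 R n) (M : R) : (forall j, normH2 (u j) <= M) ->
  exists2 phi : nat -> nat, {homo phi : i j / (i < j)%N} &
    exists f : Cn -> R[i], forall z, normc (u (phi j) z - f z) @[j --> \oo] --> (0 : R).
Proof.
move=> uM; have M0 : 0 <= M by exact: le_trans (normH2_ge0 _) (uM 0%N).
have [F [FU sF]] := ultraFilterLemma (@eventually_filter).
have Fp : ProperFilter F by case: FU.
have /choice[f fP] : forall z, exists l, forall e, 0 < e -> F [set j | normc (u j z - l) < e].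
  move=> z; apply: (ultra_bounded_ccvg FU (M := M * expR (sqcnorm z / 2))) => j.
  by rewrite (le_trans (H2_growth _ _))// ler_wpM2r ?expR_ge0.
(* Enumeration of all grid points of all meshes; indices that decode to nothing are sent to 0. *)
pose d i : Cn := if (unpickle i : option (nat * 'rV[int * int]_n)) is Some Nk
  then grid_point R Nk.1 Nk.2 else 0.
pose P k : set nat := [set j | forall i, (i <= k)%N -> normc (u j (d i) - f (d i)) < k.+1%:R^-1].
have FP k : F (P k).
  have H m : F [set j | forall i, (i < m)%N -> normc (u j (d i) - f (d i)) < k.+1%:R^-1].
    elim: m => [|m IH]; first by apply: filterS filterT.
    have fm : F [set j | normc (u j (d m) - f (d m)) < k.+1%:R^-1].
      by apply: fP; rewrite invr_gt0.
    apply: filterS (filterI IH fm) => j [/= h1 h2] i.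
    by rewrite ltnS leq_eqVlt => /predU1P[->//|]; exact: h1.
  by apply: filterS (H k.+1).
have [phi phiS phiP] := ultra_subsequence FU sF FP.
exists phi => //; exists f => z.
have [K K0 KP] := H2_lipschitz z.
have KM1 : 0 < 4 * (K * M + 1) by rewrite mulr_gt0// ltr_wpDl// mulr_ge0.
apply/cvgrPdist_lt => e e0.
have [N NP] : exists N : nat, 2 / N.+1%:R <= Num.min 1 (e / (4 * (K * M + 1))).
  have m0 : 0 < Num.min 1 (e / (4 * (K * M + 1))) / 2.
    by rewrite divr_gt0// lt_min ltr01 divr_gt0.
  have [N _ /(_ N (leqnn N))/= h] := near_infty_natSinv_lt (PosNum m0).
  by exists N; rewrite mulrC -ler_pdivlMr// ltW.
pose w := grid_point R N (grid_key N z).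
have wz : Re `|w - z| <= Num.min 1 (e / (4 * (K * M + 1))).
  exact: le_trans (grid_approx N z) NP.
have lip j : normc (u j w - u j z) <= e / 4.
  rewrite (le_trans (KP (u j) w _))//; first by rewrite (le_trans wz)// ge_min lexx.
  apply: (@le_trans _ _ (K * M * (e / (4 * (K * M + 1))))).
    apply: ler_pM; rewrite ?mulr_ge0 ?normH2_ge0 ?supnorm_ge0//.
      by rewrite ler_wpM2l.
    by rewrite (le_trans wz)// ge_min lexx orbT.
  rewrite mulrA ler_pdivrMr//; have := mulr_ge0 K0 M0; move: (K * M) => s s0; nra.
have e4 : 0 < e / 4 by rewrite divr_gt0.
(* The limit inherits the estimate at w and z from a single term of the sequence, close to f at both
   points. *)
have flip : normc (f w - f z) <= e / 2.
  have e8 := divr_gt0 e4 (ltr0n R 2).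
  have [j [/= h1 h2]] := filter_ex (filterI (fP w _ e8) (fP z _ e8)).
  have -> : f w - f z = - (u j w - f w) + (u j w - u j z) + (u j z - f z) by ring.
  rewrite (le_trans (normcD _ _))// (_ : e / 2 = e / 4 / 2 + e / 4 + e / 4 / 2); last by field.
  apply: lerD; last exact: ltW.
  rewrite (le_trans (normcD _ _))// normcN; apply: lerD => //; exact: ltW.
pose i := pickle (N, grid_key N z).
have di : d i = w by rewrite /d /i pickleK.
near=> k.
have ik : (i <= k)%N by near: k; exact: nbhs_infty_ge.
have ke : k.+1%:R^-1 < e / 4 by near: k; exact: near_infty_natSinv_lt (PosNum e4).
rewrite sub0r normrN ger0_norm ?normc_ge0//.
have -> : u (phi k) z - f z = - (u (phi k) w - u (phi k) z) + (u (phi k) w - f w) + (f w - f z).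
  by ring.
rewrite (le_lt_trans (normcD _ _))// (_ : e = e / 4 + e / 4 + e / 2); last by field.
apply: ltr_leD => //.
rewrite (le_lt_trans (normcD _ _))// normcN; apply: ler_ltD => //.
apply: lt_trans ke; rewrite -di; exact: phiP.
Unshelve. all: by end_near.
Qed.

End weak_compactness.

(** * Compactness *)

Section limits.
Variables (R : realType) (n : nat).
Local Notation Cn := 'rV[R[i]]_n.
Local Notation V := (volume R n).
Local Notation g := (@gaussian R n).
Local Notation e2 z := (expR (- (sqcnorm z / 2))).
Implicit Types (z w : Cn).

Lemma ler_dist_normc (x y : R[i]) : `|normc x - normc y| <= normc (x - y).
Proof.
have := normcD (x - y) y; have := normcD (y - x) x; rewrite !subrK (normcB y x) => h1 h2.
by rewrite ler_norml; apply/andP; split; lra.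
Qed.

Lemma limn_einf_le (x : (\bar R)^nat) (c : \bar R) : (forall k, (x k <= c)%E) ->
  (limn_einf x <= c)%E.
Proof.
move=> xc; rewrite limn_einf_lim; apply: lime_le; first exact: is_cvg_einfs.
apply: nearW => k; apply: le_trans (xc k).
by apply: ereal_inf_lbound; exists k => /=.
Qed.

(** Fatou gives square integrability. The bound |u_j z| <= M exp(|z|^2 / 2) allows dominated
    convergence in the reproducing formula, so the limit equals its own Bergman projection. *)
Lemma H2_limit (u : nat -> H2 R n) (M : R) (f : Cn -> R[i]) :
  (forall j, normH2 (u j) <= M) ->
  (forall z, normc (u j z - f z) @[j --> \oo] --> (0 : R)) -> f \in @fock R n.
Proof.
move=> uM uf; have M0 : 0 <= M by exact: le_trans (normH2_ge0 _) (uM 0%N).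
have cvg_of (h : nat -> R) (l : R) z : (forall j, `|h j - l| <= normc (u j z - f z)) ->
    h j @[j --> \oo] --> l.
  move=> hl; apply/cvgrPdist_lt => e e0; move/cvgrPdist_lt: (uf z) => /(_ _ e0).
  apply: filterS => j; rewrite sub0r normrN ger0_norm ?normc_ge0// distrC.
  exact: le_lt_trans.
have mf : cmeas setT f.
  split.
    apply: (@measurable_fun_cvg _ _ _ _ (fun j z => Re (u j z))).
      by move=> j; case: (H2_L2 (u j)) => -[].
    by move=> z _; apply: (cvg_of _ _ z) => j; rewrite -ReN -ReD ler_Re_normc.
  apply: (@measurable_fun_cvg _ _ _ _ (fun j z => Im (u j z))).
    by move=> j; case: (H2_L2 (u j)) => -[].
  by move=> z _; apply: (cvg_of _ _ z) => j; rewrite -ImN -ImD ler_Im_normc.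
have bu j z : normc (u j z) <= M * expR (sqcnorm z / 2).
  by rewrite (le_trans (H2_growth _ _))// ler_wpM2r ?expR_ge0.
have bf z : normc (f z) <= M * expR (sqcnorm z / 2).
  have c := cvg_of (fun j => normc (u j z)) _ z (fun j => ler_dist_normc _ _).
  rewrite -(cvg_lim _ c)//; apply: limr_le; first by apply/cvg_ex; exists (normc (f z)).
  exact: nearW.
have Lf : L2 f.
  apply/sqintegrableP; case: (mf) => mR mI; split => //.
  have F0 j z : (0 <= (normc (u j z) ^+ 2 * g z)%:E)%E.
    by rewrite lee_fin mulr_ge0 ?sqr_ge0 ?gaussian_ge0.
  have mF j : measurable_fun setT (fun z => (normc (u j z) ^+ 2 * g z)%:E).
    by case: (H2_L2 (u j)) => _ /(measurable_int V).
  have := fatou V measurableT mF (fun j z _ => F0 j z).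
  have -> : (\int[V]_z limn_einf (fun j => (normc (u j z) ^+ 2 * g z)%:E) =
      \int[V]_z (normc (f z) ^+ 2 * g z)%:E)%E.
    apply: eq_integral => z _; apply: (cvg_limn_einf_sup _).1.
    apply: cvg_EFin; first exact: nearW.
    have c := cvg_of (fun j => normc (u j z)) _ z (fun j => ler_dist_normc _ _).
    by apply: cvgMl; exact: (cvgM c c).
  move=> le; apply: (le_lt_trans le); apply: (@le_lt_trans _ _ (M ^+ 2)%:E); last exact: ltry.
  apply: limn_einf_le => j.
  have -> : (\int[V]_z (normc (u j z) ^+ 2 * g z)%:E = (sqn (u j))%:E)%E.
    by rewrite /sqn /Rintegral fineK//; exact: integrable_fin_num (H2_L2 (u j)).2.
  by rewrite lee_fin -normH2_sqr ler_pXn2r ?nnegrE ?normH2_ge0.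
apply: fock_bergman => // w.
pose G z := M * pi ^- n * (expR (Re `|w| * l1norm z) * e2 z).
have iG : V.-integrable setT (EFin \o G).
  by apply: integrableZR => //; exact: integrable_l1_e2.
have bound (h : Cn -> R[i]) z : normc (h z) <= M * expR (sqcnorm z / 2) ->
    normc (h z * cexp (cdot w z) * (g z)%:C) <= G z.
  move=> hz; rewrite (normcM (_ * _)) (normcM (h z)) normcR (ger0_norm (gaussian_ge0 z)).
  rewrite normc_cexp gaussian_half.
  have n2 := le_trans (le_trans (ler_norm _) (ler_Re_normc _)) (normc_cdot_l1 w z).
  have := E2e2 z; rewrite /G -ler_expR in n2 *.
  move: (expR (sqcnorm z / 2)) (e2 z) (expR_ge0 (- (sqcnorm z / 2))) hz n2 => a c c0 hz n2 ac.
  rewrite [leRHS](_ : _ = (M * a * expR (Re `|w| * l1norm z)) * (pi ^- n * c * c)).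
    apply: ler_wpM2r; first by rewrite !mulr_ge0// ltW// pin_gt0.
    by apply: ler_pM; rewrite ?normc_ge0 ?expR_ge0.
  by rewrite -[LHS]mulr1 -ac; ring.
have c1 : normc (u j w - bergman f w) @[j --> \oo] --> (0 : R).
  under eq_fun do rewrite -(H2_bergman (u _) w).
  apply: (cint_cvg (g := G)) => //.
  - move=> j; have := L2M_integrable (H2_L2 (u j)) (L2_cexp_cdot w); by case.
  - by have := L2M_integrable Lf (L2_cexp_cdot w); case.
  - by move=> j z _; exact: bound.
  - by move=> z _; exact: bound.
  - move=> z _.
    have E j : normc (u j z * cexp (cdot w z) * (g z)%:C - f z * cexp (cdot w z) * (g z)%:C) =
        normc (u j z - f z) * normc (cexp (cdot w z) * (g z)%:C).
      by rewrite -!mulrA -mulrBl (normcM (u j z - f z)).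
    rewrite (funext E); move: (normc (cexp _ * _)) => c.
    by rewrite -[X in _ --> X](mul0r c); apply: cvgMl; exact: uf.
have : normc (bergman f w - f w) <= 0.
  rewrite leNgt; apply/negP => d0; have d2 := divr_gt0 d0 (ltr0n R 2).
  move/cvgrPdist_lt: (uf w) => /(_ _ d2) e1; move/cvgrPdist_lt: c1 => /(_ _ d2) e2.
  have [j [/=]] := filter_ex (filterI e1 e2).
  rewrite !sub0r !normrN !ger0_norm ?normc_ge0// => h1 h2.
  have := normcD (u j w - f w) (- (u j w - bergman f w)).
  rewrite (_ : _ + _ = bergman f w - f w); last by ring.
  by rewrite normcN leNgt [X in _ < X]splitr ltrD.
move=> h; apply/eqP; rewrite -subr_eq0; apply/eqP; apply: normc_eq0.
by apply/eqP; rewrite eq_le h normc_ge0.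
Qed.

Lemma sqnB_le (f h : Cn -> R[i]) : L2 f -> L2 h ->
  sqn (fun z => f z - h z) <= 2 * sqn f + 2 * sqn h.
Proof.
move=> Lf Lh; rewrite /sqn -!RintegralZl//; [|by case: Lh|by case: Lf].
have [i1 i2] := (integrableZR 2 measurableT Lf.2, integrableZR 2 measurableT Lh.2).
rewrite -RintegralD//.
apply: le_Rintegral => //; first by case: (L2B Lf Lh).
  under [X in integrable _ _ X]eq_fun do rewrite /= EFinD.
  exact: integrableD.
move=> z _; have := ler_wpM2r (gaussian_ge0 z) (ler_normc_sqrD (f z) (- h z)).
by rewrite normcN; move: (g z) (normc _ ^+ 2) (normc _ ^+ 2) (normc _ ^+ 2) => *; lra.
Qed.

(* Cauchy-Schwarz with the Gaussian exp(-|v - z|^2 / 2) split off, then        *)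
(* dominated convergence.                                                      *)
Lemma H2_vanishes (f : H2 R n) (z : nat -> Cn) :
  (forall A, \forall k \near \oo, A <= sqcnorm (z k)) ->
  normc (pint f (nkernel (z k))) @[k --> \oo] --> (0 : R).
Proof.
move=> zoo; have [mf i_f] := H2_L2 f.
pose E k v := expR (- (2^-1 * sqcnorm (v - z k))).
have mE k : measurable_fun setT (E k).
  apply: (measurableT_comp (@measurable_gauss R n 2^-1)).
  by apply: measurable_CnD => //; exact: measurable_cst.
have E0 k v : 0 <= E k v by exact: expR_ge0.
have E1 k v : E k v <= 1.
  by rewrite -[leRHS]expR0 ler_expR oppr_le0 mulr_ge0// sqcnorm_ge0.
pose P k := \int[V]_v (normc (f v) ^+ 2 * g v * E k v).
(* By translation invariance this is also the integral of the second Cauchy-Schwarz weight, centred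
   at z k, for every k. *)
pose K := \int[V]_v (pi ^- n * expR (- (2^-1 * sqcnorm v))).
have f0 v : 0 <= normc (f v) ^+ 2 * g v by rewrite mulr_ge0 ?sqr_ge0 ?gaussian_ge0.
have mP k : measurable_fun setT (fun v => normc (f v) ^+ 2 * g v * E k v).
  apply: measurable_funM => //; apply/measurable_EFinP; exact: (measurable_int V).
have leP k v : `|normc (f v) ^+ 2 * g v * E k v| <= normc (f v) ^+ 2 * g v.
  move: (_ * g v) (f0 v) (E k v) (E0 k v) (E1 k v) => x x0 y y0 y1.
  by rewrite ger0_norm ?mulr_ge0// ler_piMr.
have cP : P k @[k --> \oo] --> (0 : R).
  apply: (Rintegral_cvg0 (g := fun v => normc (f v) ^+ 2 * g v)) => //.
  move=> v _.
  suff cE : E k v @[k --> \oo] --> (0 : R).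
    by rewrite -[X in _ --> X](mulr0 (normc (f v) ^+ 2 * g v)); apply: cvgMr.
  apply/cvgrPdist_lt => e e0.
  have zoo' := sqcnorm_infty (- v) zoo.
  apply: filterS (zoo' (2 / e)) => k h.
  rewrite sub0r normrN ger0_norm// /E -opprB sqcnormN expRN -[e]invrK.
  rewrite ltf_pV2 ?posrE ?invr_gt0 ?expR_gt0//.
  by rewrite (lt_le_trans _ (expR_ge1Dx _))//; move: h; lra.
have cs k : normc (pint f (nkernel (z k))) ^+ 2 <= P k * K.
  have Lf := H2_L2 f; have Lk := L2_nkernel (z k).
  have i := L2_weight_integrable Lf Lk.
  pose r v := normc (f v) * normc (nkernel (z k) v) * g v.
  have ir : V.-integrable setT (EFin \o r) by exact: integrable_normcM.
  have le : normc (pint f (nkernel (z k))) <= \int[V]_v r v.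
    rewrite (le_trans (normc_cint_le measurableT i))//.
    by under eq_Rintegral do rewrite normc_weight.
  apply: (@le_trans _ _ ((\int[V]_v r v) ^+ 2)).
    by rewrite ler_pXn2r ?nnegrE ?normc_ge0// (le_trans (normc_ge0 _) le).
  pose q0 (v : Cn) := pi ^- n * expR (- (2^-1 * sqcnorm v)) : R.
  have iq0 : V.-integrable setT (EFin \o q0).
    by apply: integrableZR => //; apply: integrable_gauss; rewrite invr_gt0.
  have mq0 : measurable_fun setT q0 by apply/measurable_EFinP; exact: (measurable_int V).
  have iq := integrable_mpreserving (mpreserving_volumeD (- z k)) iq0.
  have -> : K = \int[V]_v q0 (v - z k).
    rewrite /K /Rintegral; congr fine.
    exact/esym/(integral_mpreserving (mpreserving_volumeD (- z k)) mq0).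
  apply: Rintegral_cauchy_schwarz => //.
  - have : V.-integrable setT (fun v => (normc (f v) ^+ 2 * g v)%:E) by [].
    apply: le_integrable => //; first exact/measurable_EFinP.
    by move=> v _ /=; rewrite lee_fin [leRHS]ger0_norm.
  - by move=> v; exact: mulr_ge0.
  (* The two weights p and q satisfy r^2 = p q, since |k_z|^2 g = pi^-n E^2; hence 4 t^2 r^2 <= (t^2
     p + q)^2. *)
  move=> v t; have := normc_nkernel_weight (z k) v.
  rewrite /r /q0 -/(E k v) => h.
  have h2 : pi ^- n * expR (- sqcnorm (v - z k)) = pi ^- n * E k v * E k v.
    by rewrite /E -mulrA -expRD; congr (_ * expR _); field.
  rewrite h2 in h; have pn0 := pin_gt0 R n.
  rewrite (le_trans (ler_norm _))// -(ler_pXn2r (n := 2))//; last first.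
    rewrite nnegrE; apply: addr_ge0; last by apply: mulr_ge0 => //; exact: ltW.
    by apply: mulr_ge0; [exact: sqr_ge0|exact: mulr_ge0].
  rewrite real_normK ?num_real// -subr_ge0.
  have -> : (2 * t * (normc (f v) * normc (nkernel (z k) v) * g v)) ^+ 2 =
      4 * t ^+ 2 * (normc (f v) ^+ 2 * g v) * (normc (nkernel (z k) v) ^+ 2 * g v) by ring.
  rewrite h; move: (_ * g v) (pi ^- n) (E k v) => x p y.
  rewrite (_ : _ - _ = (t ^+ 2 * (x * y) - p * y) ^+ 2) ?sqr_ge0//; ring.
apply/cvgrPdist_lt => e e0.
have K0 : 0 <= K by apply: Rintegral_ge0 => v _; rewrite mulr_ge0 ?expR_ge0// ltW// pin_gt0.
have d0 : 0 < e ^+ 2 / (K + 1) by rewrite divr_gt0 ?exprn_gt0// ltr_wpDl.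
move/cvgrPdist_lt: cP => /(_ _ d0); apply: filterS => k.
have P0 : 0 <= P k by apply: Rintegral_ge0 => v _; exact: mulr_ge0.
rewrite !sub0r !normrN !ger0_norm ?normc_ge0// => Pk.
rewrite -(ltr_pXn2r (n := 2))// ?nnegrE ?normc_ge0 ?(ltW e0)//.
rewrite (le_lt_trans (cs k))//; move: Pk; rewrite ltr_pdivlMr ?ltr_wpDl// => Pk.
by rewrite (le_lt_trans _ Pk)// ler_wpM2l// lerDl.
Qed.

End limits.

(** * Compactness of the extension *)

Section compactness.
Variables (R : realType) (n : nat).
Local Notation Cn := 'rV[R[i]]_n.
Local Notation V := (volume R n).
Local Notation g := (@gaussian R n).
Implicit Types (z w u : Cn).
Variables (B B' : {linear kspan R n -> H2 R n}) (C : R).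
Hypothesis BB' : adjoint_on_span B B'.
Hypothesis C0 : 0 < C.
Local Notation b := (kernel_of B).
Hypothesis b1 : forall z, (\int[V]_w (normc (b z w))%:E <= C%:E)%E.
Hypothesis b2 : forall w, (\int[V]_z (normc (b z w))%:E <= C%:E)%E.
Hypothesis tailB : tail_sup B r @[r --> +oo%R] --> (0 : \bar R)%E.

(** Far out the row mass is small and the norms are bounded; near the origin it is bounded by C, and
    pointwise convergence acts against a Gaussian weight. *)
Lemma weighted_mass_cvg (h : nat -> H2 R n) (M : R) : vanishes_at_infinity (berezin B) ->
  (forall j, normH2 (h j) <= M) -> (forall z, normc (h j z) @[j --> \oo] --> (0 : R)) ->
  \int[V]_z (normc (h j z) ^+ 2 * g z * row_mass B z) @[j --> \oo] --> (0 : R).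
Proof.
move=> Bv hM h0; have M0 : 0 <= M by exact: le_trans (normH2_ge0 _) (hM 0%N).
have A0 := row_mass_ge0 B.
have AC z : row_mass B z <= C by exact: (row_mass_le BB' b1).
have mA : measurable_fun setT (row_mass B) by exact: (measurable_row_mass BB').
have k0 j z : 0 <= normc (h j z) ^+ 2 * g z by rewrite mulr_ge0 ?sqr_ge0 ?gaussian_ge0.
have mk j : measurable_fun setT (fun z => normc (h j z) ^+ 2 * g z).
  by apply/measurable_EFinP; case: (H2_L2 (h j)) => _ /(measurable_int V).
have kM j z : normc (h j z) ^+ 2 * g z <= M ^+ 2 * pi ^- n.
  have := H2_pointwise_le (h j) z; rewrite gaussian_half => H.
  have H2 : normc (h j z) * expR (- (sqcnorm z / 2)) <= M by exact: le_trans H (hM j).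
  have e0 : 0 <= normc (h j z) * expR (- (sqcnorm z / 2)) by rewrite mulr_ge0 ?normc_ge0 ?expR_ge0.
  have -> : normc (h j z) ^+ 2 * (pi ^- n * expR (- (sqcnorm z / 2)) * expR (- (sqcnorm z / 2))) =
      (normc (h j z) * expR (- (sqcnorm z / 2))) ^+ 2 * pi ^- n by ring.
  apply: ler_wpM2r; first exact/ltW/pin_gt0.
  by rewrite ler_pXn2r ?nnegrE.
apply/cvgrPdist_lt => e e0.
have d0 : 0 < e / (2 * (M ^+ 2 + 1)).
  by rewrite divr_gt0// mulr_gt0// ltr_wpDl// sqr_ge0.
have [r rP] := row_mass_vanishes BB' C0 b1 b2 tailB Bv d0.
pose E z : R := expR (- (1 * sqcnorm z)).
have mE : measurable_fun setT E by exact: measurable_gauss.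
(* Here r bounds |z|^2, not |z|, so exp(r - |z|^2) >= 1 in the near region. *)
have AE z : row_mass B z <= e / (2 * (M ^+ 2 + 1)) + C * expR r * E z.
  have [rz|zr] := leP r (sqcnorm z).
    by rewrite (le_trans (ltW (rP z rz)))// lerDl !mulr_ge0 ?expR_ge0// ltW.
  rewrite (le_trans (AC z))// (@le_trans _ _ (C * expR r * E z))//; last by rewrite lerDr ltW.
  rewrite -[leLHS]mulr1 -mulrA ler_wpM2l ?(ltW C0)//.
  by rewrite /E -expRD mul1r -[leLHS]expR0 ler_expR subr_ge0 ltW.
have cE : \int[V]_z (normc (h j z) ^+ 2 * g z * E z) @[j --> \oo] --> (0 : R).
  apply: (Rintegral_cvg0 (g := fun z : Cn => M ^+ 2 * pi ^- n * E z)) => //.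
  - by move=> j; exact: measurable_funM.
  - move=> j z _; rewrite ger0_norm; last by apply: mulr_ge0 => //; exact: expR_ge0.
    by apply: ler_wpM2r => //; exact: expR_ge0.
  - by apply: integrableZR => //; exact: integrable_gauss.
  move=> z _; rewrite -[X in _ --> X](mul0r (E z)); apply: cvgMl.
  rewrite -[X in _ --> X](mul0r (g z)); apply: cvgMl.
  by rewrite -[X in _ --> X](mul0r 0); exact: cvgM (h0 z) (h0 z).
have d1 : 0 < e / 2 / (C * expR r) by rewrite !divr_gt0// mulr_gt0// expR_gt0.
move/cvgrPdist_lt: cE => /(_ _ d1); apply: filterS => j.
have i1 := (H2_L2 (h j)).2.
have i2 : V.-integrable setT (EFin \o (fun z => normc (h j z) ^+ 2 * g z * E z)).
  apply: le_integrable i1 => //; first by apply/measurable_EFinP; exact: measurable_funM.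
  move=> z _ /=; rewrite lee_fin; move: (_ * g z) (k0 j z) => x x0.
  rewrite !ger0_norm ?mulr_ge0 ?expR_ge0// ler_piMr//.
  by rewrite -[leRHS]expR0 ler_expR mul1r oppr_le0 sqcnorm_ge0.
have Ek0 : 0 <= \int[V]_z (normc (h j z) ^+ 2 * g z * E z).
  by apply: Rintegral_ge0 => z _; apply: mulr_ge0 => //; exact: expR_ge0.
have Ak0 : 0 <= \int[V]_z (normc (h j z) ^+ 2 * g z * row_mass B z).
  by apply: Rintegral_ge0 => z _; apply: mulr_ge0.
rewrite !sub0r !normrN !ger0_norm// => Ej.
apply: (@le_lt_trans _ _ (e / (2 * (M ^+ 2 + 1)) * sqn (h j) +
   C * expR r * \int[V]_z (normc (h j z) ^+ 2 * g z * E z))).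
  rewrite /sqn -!RintegralZl// -RintegralD//; [|exact: integrableZR|exact: integrableZR].
  apply: le_Rintegral => //; first exact: (weighted_mass_integrable BB' C0 b1 (H2_L2 (h j))).
    under [X in integrable _ _ X]eq_fun do rewrite /= EFinD.
    by apply: integrableD => //; exact: integrableZR.
  move=> z _; move: (_ * g z) (k0 j z) (AE z) => x x0 Az.
  by rewrite (le_trans (ler_wpM2l x0 Az))// le_eqVlt; apply/orP; left; apply/eqP; ring.
have sM : sqn (h j) <= M ^+ 2 by rewrite -normH2_sqr ler_pXn2r ?nnegrE ?normH2_ge0.
have p1 : e / (2 * (M ^+ 2 + 1)) * sqn (h j) <= e / 2.
  rewrite mulrAC ler_pdivrMr ?mulr_gt0// ?ltr_wpDl ?sqr_ge0//.
  have := sqn_ge0 (h j); move: (M ^+ 2) (sqn _) sM => m s sm s0; nra.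
rewrite [e in ltRHS]splitr ler_ltD//.
by rewrite mulrC -ltr_pdivlMr// mulr_gt0// expR_gt0.
Qed.

(** The limit of the images is the image of the pointwise limit F, by the weighted bound of
    [L2_ext_sqn] applied to the differences. *)
Lemma extH2_compact : vanishes_at_infinity (berezin B) ->
  sequentially_compact (extH2 BB' C0 b1 b2).
Proof.
move=> Bv u [M uM].
have [phi phiS [f fP]] := H2_subsequence uM.
exists phi => //.
have ff : f \in @fock R n := H2_limit (fun j => uM (phi j)) fP.
pose F : H2 R n := MkH2 ff.
exists (extH2 BB' C0 b1 b2 F).
have hM j : normH2 (u (phi j) - F) <= Num.sqrt (2 * M ^+ 2 + 2 * sqn F).
  rewrite normH2_sqn ler_wsqrtr//.
  apply: le_trans (sqnB_le (H2_L2 (u (phi j))) (H2_L2 F)) _.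
  rewrite lerD2r ler_wpM2l// -normH2_sqr ler_pXn2r ?nnegrE ?normH2_ge0//.
  exact: le_trans (normH2_ge0 _) (uM 0%N).
have := weighted_mass_cvg Bv hM fP => cv.
have D0 := ext_cst_ge0 n C0.
apply/cvgrPdist_lt => e e0.
have d0 : 0 < e ^+ 2 / (ext_cst n C + 1) by rewrite divr_gt0 ?exprn_gt0// ltr_wpDl.
move/cvgrPdist_lt: cv => /(_ _ d0); apply: filterS => j.
have Ak0 : 0 <= \int[V]_z (normc ((u (phi j) - F) z) ^+ 2 * g z * row_mass B z).
  apply: Rintegral_ge0 => z _; apply: mulr_ge0 (row_mass_ge0 B z).
  by rewrite mulr_ge0 ?sqr_ge0 ?gaussian_ge0.
rewrite !sub0r !normrN [X in X < _ -> _]ger0_norm// ger0_norm ?normH2_ge0// => lt.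
rewrite -linearB -(ltr_pXn2r (n := 2))// ?nnegrE ?normH2_ge0 ?(ltW e0)//.
rewrite normH2_sqr.
have [_ le] := L2_ext_sqn BB' C0 b1 b2 (H2_L2 (u (phi j) - F)).
apply: le_lt_trans le _.
move: lt; rewrite ltr_pdivlMr ?ltr_wpDl//.
move: (\int[V]_z _) (ext_cst n C) Ak0 D0 => x d x0 d0'; nra.
Qed.

End compactness.

Lemma pint_H2_split (R : realType) (n : nat) (f h : H2 R n) (k : 'rV[R[i]]_n -> R[i]) :
  L2 k -> pint f k = pint (f - h : H2 R n) k + pint h k.
Proof.
move=> Lk; rewrite -pintDl//; [|exact: H2_L2|exact: H2_L2].
by congr (pint _ k); apply/funext => v; rewrite -[(f - h : H2 R n) v]/(f v - h v) subrK.
Qed.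

(** Along a bad sequence, compactness yields h with T k_z close to h, and <T k_z, k_z> = <T k_z - h,
    k_z> + <h, k_z>: the first term is small since k_z has norm 1, the second by [H2_vanishes]. *)
Lemma compact_berezin (R : realType) (n : nat) (B : {linear kspan R n -> H2 R n}) :
  compact_operator B -> vanishes_at_infinity (berezin B).
Proof.
move=> [T [_ Text] Tc] e e0; apply: contrapT => H.
have /choice[z zP] : forall k : nat, exists z,
    k%:R <= sqcnorm z /\ e <= normc (berezin B z).
  (* The threshold k + 1 on the norm guarantees a squared norm of at least k. *)
  move=> k; apply: contrapT => Hk; apply: H; exists (k%:R + 1) => z kz.
  rewrite ltNge; apply/negP => ez; apply: Hk; exists z; split => //.
  have k0 : 0 <= k%:R :> R by [].
  by rewrite sqcnorm_cnorm; nra.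
have z1 : exists M : R, forall j, normH2 (kH2 (z j)) <= M.
  by exists 1 => j; rewrite -[H2val _]/(nkernel (z j)) normH2_nkernel.
have [phi phiS [h hP]] := Tc _ z1.
have kphi k : (k <= phi k)%N.
  by elim: k => // k IH; exact: leq_ltn_trans IH (phiS _ _ (ltnSn k)).
have zoo A : \forall k \near \oo, A <= sqcnorm (z (phi k)).
  near=> k; rewrite (le_trans _ (zP _).1)//.
  rewrite (@le_trans _ _ k%:R) ?ler_nat//; near: k; exact: nbhs_infty_ger.
have e2 : 0 < e / 2 by rewrite divr_gt0.
have c1 := H2_vanishes h zoo.
move/cvgrPdist_lt: hP => /(_ _ e2) hP.
move/cvgrPdist_lt: c1 => /(_ _ e2) c1.
have [k [/= l1 l2]] := filter_ex (filterI hP c1).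
rewrite !sub0r !normrN !ger0_norm ?normH2_ge0 ?normc_ge0// in l1 l2.
have := (zP (phi k)).2; apply/negP; rewrite -ltNge.
set w := z (phi k) in l1 l2 *.
rewrite /berezin innerE -(Text (k_ w) (kH2 w))//.
have Lk := L2_nkernel w; have LT := H2_L2 (T (kH2 w)); have Lh := H2_L2 h.
have -> : pint (T (kH2 w)) (nkernel w) = pint (T (kH2 w) - h : H2 R n) (nkernel w) +
    pint h (nkernel w).
  exact: pint_H2_split.
rewrite (le_lt_trans (normcD _ _))// [e]splitr ltrD//.
rewrite (le_lt_trans (pint_cauchy_schwarz (H2_L2 _) Lk))//.
by rewrite normH2_nkernel mulr1.
Unshelve. all: by end_near.
Qed.

Theorem corollary3p4 (R : realType) (n : nat) (n_ge1 : (1 <= n)%N)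
    (B : {linear kspan R n -> H2 R n}) :
  weakly_localized B ->
  (compact_operator B <-> vanishes_at_infinity (berezin B)).
Proof.
move=> [B' [BB' locB locB']]; split; first exact: compact_berezin.
have [C [C0 b1 b2]] := localized_bounds BB' locB locB'.
move=> Bv; exists (extH2 BB' C0 b1 b2).
  exact: extH2_bounded_extension.
by apply: extH2_compact => //; case: locB.
Qed.
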